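(* Let $d$ be a unitary in $\mathcal{D}_2$ such that $d(0)=d(-1)=1$. Then: \begin{enumerate} \item there exists the strong limit $d_\infty$ of the sequence $d_k = d\varphi(d)\varphi^2(d)\cdots\varphi^{k-1}(d)$ in the canonical representation; \item $\lambda_d$ is weakly inner in the canonical representation restricted to $\mathcal{O}_2$; \item $\lambda_d$ extends to a representation of $\mathcal{Q}_2$ on $\ell_2(\mathbb{Z})$; \item the automorphism $\lambda_d\in\mathrm{Aut}(\mathcal{O}_2)$ extends to an automorphism of $\mathcal{Q}_2$ if and only if, for a unique $\alpha\in\mathbb{T}$, the strong limit of the sequence $$x_k = \alpha\,|e_0\rangle\langle e_0| + d\varphi(d)\varphi^2(d)\cdots\varphi^{k-1}(d)\left(\sum_{i=0}^{k-1}S_2^iS_1S_1^*(S_2^* )^i\right)U\varphi^{k-1}(d^* )\cdots\varphi(d^* )d^*U^*$$ belongs to $\mathcal{D}_2$, in which case the limit coincides with $\check{d}$ and $\alpha=\check{d}(0)$; \item if $\lambda_d$ extends to an automorphism $\widetilde{\lambda_d}$ of $\mathcal{Q}_2$, then $\widetilde{\lambda_d}$ is weakly inner in the canonical representation if ($\lambda_d$ is inner or) $\check{d}(0)=1$. \end{enumerate}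
   Context: $\mathcal{Q}_2$ (the 2-adic ring $C^*$-algebra) is the universal unital $C^*$-algebra generated by an isometry $S_2$ and a unitary $U$ such that $S_2S_2^*+US_2S_2^*U^*=1$ and $S_2U=U^2S_2$. Put $S_1=US_2$. The $C^*$-subalgebra generated by $S_1,S_2$ is a copy of the Cuntz algebra $\mathcal{O}_2$, and $\mathcal{O}_2\subset\mathcal{Q}_2$ always refers to this copy. For a multi-index $\alpha=(\alpha_1,\ldots,\alpha_k)\in\{1,2\}^k$ let $S_\alpha=S_{\alpha_1}\cdots S_{\alpha_k}$ and $P_\alpha=S_\alpha S_\alpha^*$; the diagonal $\mathcal{D}_2\subset\mathcal{O}_2$ is the (commutative) $C^*$-algebra generated by all $P_\alpha$, and $\mathcal{U}(\mathcal{D}_2)$ is its unitary group. The canonical endomorphism is $\varphi(x)=S_1xS_1^*+S_2xS_2^*$. The canonical representation of $\mathcal{Q}_2$ (which is faithful) is on $\ell_2(\mathbb{Z})$ with canonical basis $\{e_k\}_{k\in\mathbb{Z}}$: $S_2e_k=e_{2k}$, $Ue_k=e_{k+1}$. In it $\mathcal{D}_2$ is a norm-closed subalgebra of $\ell_\infty(\mathbb{Z})$ (diagonal operators), and $d(k)=(e_k,de_k)$ denotes the $k$-th diagonal entry of $d\in\ell_\infty(\mathbb{Z})$; $\mathcal{Q}_2$ and its subalgebras are identified with their images. $|u\rangle\langle v|$ is the rank-one operator $w\mapsto (v,w)u$. For $d\in\mathcal{U}(\mathcal{D}_2)$, $\lambda_d$ is the automorphism of $\mathcal{O}_2$ with $\lambda_d(S_i)=dS_i$,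 $i=1,2$. If $\lambda_d$ extends to an automorphism of $\mathcal{Q}_2$, the extension is unique, is denoted $\widetilde{\lambda_d}$, and $\check{d}:=\widetilde{\lambda_d}(U)U^*$, which is a unitary in $\mathcal{D}_2$. An automorphism of a $C^*$-algebra acting on a Hilbert space is weakly inner (in that representation) if it is implemented by a unitary in the von Neumann algebra generated by the $C^*$-algebra. *)

(* Defs.v *)
From HB Require Import structures.
From mathcomp Require Import all_boot all_order all_algebra.
From mathcomp Require Import complex.
From mathcomp Require Import all_classical all_reals all_analysis.
From mathcomp Require Import ring lra.

Set Implicit Arguments.
Unset Strict Implicit.
Unset Printing Implicit Defensive.

Import Order.TTheory GRing.Theory Num.Theory.
Import numFieldNormedType.Exports.

Local Open Scope classical_set_scope.
Local Open Scope ring_scope.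

Section Ell2.
Variable R : realType.
Local Notation C := (R[i]).

Definition sqmod (z : C) : R := complex.Re z ^+ 2 + complex.Im z ^+ 2.

Definition sqnorm (f : int -> C) : \bar R :=
  (\esum_(k in [set: int]) (sqmod (f k))%:E)%E.

Lemma sqmod_ge0 z : 0 <= sqmod z.
Proof. by rewrite addr_ge0 ?sqr_ge0. Qed.

Lemma sqmod0 : sqmod 0 = 0.
Proof. by rewrite /sqmod /= expr0n addr0. Qed.

Lemma sqmodD (x y : C) : sqmod (x + y) <= 2 * sqmod x + 2 * sqmod y.
Proof.
case: x y => [a b] [c d]; rewrite /sqmod /=.
rewrite -subr_ge0 [X in 0 <= X](_ : _ = (a - c) ^+ 2 + (b - d) ^+ 2); last by ring.
by rewrite addr_ge0 ?sqr_ge0.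
Qed.

Lemma sqmodM (x y : C) : sqmod (x * y) = sqmod x * sqmod y.
Proof. by case: x y => [a b] [c d]; rewrite /sqmod /=; ring. Qed.

Lemma sqnorm_ge0 f : (0 <= sqnorm f)%E.
Proof. by apply: esum_ge0 => k _; rewrite lee_fin sqmod_ge0. Qed.

Lemma esumZl (c : R) (a : int -> R) : 0 <= c -> (forall k, 0 <= a k) ->
  (\esum_(k in [set: int]) (c * a k)%:E =
   c%:E * \esum_(k in [set: int]) (a k)%:E)%E.
Proof.
have le (b : R) (f : int -> R) : 0 <= b -> (forall k, 0 <= f k) ->
  (\esum_(k in [set: int]) (b * f k)%:E <=
   b%:E * \esum_(k in [set: int]) (f k)%:E)%E.
  move=> b0 f0; apply: ge_ereal_sup => _ [X [finX _] <-].
  rewrite fsbig_finite//=; under eq_bigr do rewrite EFinM.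
  rewrite -ge0_sume_distrr; last by move=> i _; rewrite lee_fin.
  apply: lee_wpmul2l; first by rewrite lee_fin.
  by apply: esum_ge; exists X => //; rewrite fsbig_finite.
move=> c0 a0; apply/eqP; rewrite eq_le le//=.
have [->|cn0] := eqVneq c 0.
  by rewrite mul0e; apply: esum_ge0 => k _; rewrite mul0r.
have cp : 0 < c by rewrite lt_def cn0.
rewrite -lee_pdivlMl//.
have := le c^-1 (fun k => c * a k).
rewrite invr_ge0 => /(_ c0 (fun k => mulr_ge0 c0 (a0 k))).
by under eq_esum do rewrite mulKf//.
Qed.

Lemma sqnormZ (a : C) f : sqnorm (a *: f) = ((sqmod a)%:E * sqnorm f)%E.
Proof.
rewrite /sqnorm -esumZl ?sqmod_ge0//; last by move=> k; exact: sqmod_ge0.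
by apply: eq_esum => k _; rewrite -sqmodM.
Qed.

Lemma sqnormD (f g : int -> C) :
  (sqnorm (f + g)%R <= 2%:E * sqnorm f + 2%:E * sqnorm g)%E.
Proof.
rewrite /sqnorm -!esumZl//; try by move=> k; exact: sqmod_ge0.
rewrite -esumD; try by move=> k _; rewrite lee_fin mulr_ge0 ?sqmod_ge0.
by apply: le_esum => k _; rewrite -EFinD lee_fin sqmodD.
Qed.

Definition sqsummable : {pred int -> C} := fun f => `[< (sqnorm f < +oo)%E >].

Record ell2 := Ell2 { ell2fun :> int -> C; _ : ell2fun \in sqsummable }.

HB.instance Definition _ := [isSub for ell2fun].
HB.instance Definition _ := [Choice of ell2 by <:].

Lemma sqsummable_submod : submod_closed sqsummable.
Proof.
split.
  rewrite unfold_in; apply/asboolP; rewrite /sqnorm esum1 ?ltry// => k _.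
  by rewrite sqmod0.
move=> a f g; rewrite !unfold_in => /asboolP f2 /asboolP g2; apply/asboolP.
apply: le_lt_trans (sqnormD _ _) _; apply: lte_add_pinfty.
  rewrite sqnormZ; apply: lte_mul_pinfty => //.
  by apply: lte_mul_pinfty => //; rewrite lee_fin sqmod_ge0.
by apply: lte_mul_pinfty.
Qed.

HB.instance Definition _ :=
  GRing.isSubmodClosed.Build _ _ sqsummable sqsummable_submod.
HB.instance Definition _ := [SubChoice_isSubLmodule of ell2 by <:].


Lemma ell2P (u : ell2) : (sqnorm u < +oo)%E.
Proof. by case: u => f /=; rewrite unfold_in => /asboolP. Qed.

Lemma ell2_ext (u v : ell2) : (forall k, u k = v k) -> u = v.
Proof. by move=> uv; apply: val_inj; apply: funext. Qed.

Lemma ell2DE (u v : ell2) k : (u + v) k = u k + v k.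
Proof. by []. Qed.

Lemma ell2ZE a (u : ell2) k : (a *: u) k = a * u k.
Proof. by []. Qed.

Lemma sqnorm_fin (u : ell2) : (fine (sqnorm u))%:E = sqnorm u.
Proof. by rewrite fineK// ge0_fin_numE ?sqnorm_ge0// ell2P. Qed.

Definition l2norm (u : ell2) : R := Num.sqrt (fine (sqnorm u)).

Lemma l2norm_ge0 u : 0 <= l2norm u. Proof. exact: sqrtr_ge0. Qed.

Lemma l2normK u : l2norm u ^+ 2 = fine (sqnorm u).
Proof. by rewrite sqr_sqrtr// fine_ge0// sqnorm_ge0. Qed.

Lemma l2norm0 : l2norm 0 = 0.
Proof.
rewrite /l2norm (_ : sqnorm _ = 0%E) ?sqrtr0//.
by rewrite /sqnorm esum1// => k _; rewrite sqmod0.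
Qed.

Lemma l2normZ a u : l2norm (a *: u) = Num.sqrt (sqmod a) * l2norm u.
Proof.
rewrite /l2norm sqnormZ -sqnorm_fin -EFinM /=.
by rewrite -sqrtrM ?sqmod_ge0.
Qed.

Lemma l2normD_sq u v :
  l2norm (u + v) ^+ 2 <= 2 * l2norm u ^+ 2 + 2 * l2norm v ^+ 2.
Proof.
rewrite !l2normK -lee_fin EFinD !EFinM !sqnorm_fin; exact: sqnormD.
Qed.

Lemma l2norm_leD u v : l2norm (u + v) <= 2 * (l2norm u + l2norm v).
Proof.
have u0 := l2norm_ge0 u; have v0 := l2norm_ge0 v; have w0 := l2norm_ge0 (u + v).
rewrite -ler_sqr ?nnegrE//; last by rewrite mulr_ge0// addr_ge0.
by apply: le_trans (l2normD_sq u v) _; nra.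
Qed.

Lemma delta_sqsummable k : (fun j : int => (j == k)%:R : C) \in sqsummable.
Proof.
rewrite unfold_in; apply/asboolP; rewrite /sqnorm (esumID [set k])//; last first.
  by move=> j _; rewrite lee_fin sqmod_ge0.
rewrite setTI esum_set1 ?lee_fin ?sqmod_ge0// esum1 ?adde0 ?ltry//.
by move=> j [_ /eqP jk]; rewrite (negPf jk) sqmod0.
Qed.

Definition delta k : ell2 := Ell2 (delta_sqsummable k).

(* The sum of an absolutely summable two-sided family; [Negz n] is [-(n+1)]. *)
Definition sumZ (f : int -> R) : R :=
  limn (fun n => \sum_(k < n) (f (Posz k) + f (Negz k))).

(* Antilinear in the first variable. *)
Definition inner (u v : ell2) : C :=
  Complex (sumZ (fun k => complex.Re (conjc (u k) * v k)))
          (sumZ (fun k => complex.Im (conjc (u k) * v k))).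

Definition bounded_linear : {pred ell2 -> ell2} := fun T =>
  `[< linear T /\ exists M : R, forall u, l2norm (T u) <= M * l2norm u >].

Record bop := Bop { bopfun :> ell2 -> ell2; _ : bopfun \in bounded_linear }.

HB.instance Definition _ := [isSub for bopfun].
HB.instance Definition _ := [Choice of bop by <:].

Lemma bounded_linear_submod : submod_closed bounded_linear.
Proof.
split.
  rewrite unfold_in; apply/asboolP; split=> [a u v|]; first by rewrite scaler0 addr0.
  by exists 0 => u; rewrite mul0r l2norm0.
move=> a S T; rewrite !unfold_in => /asboolP[Sl [M SM]] /asboolP[Tl [N TN]].
apply/asboolP; split=> [b u v|].
  have -> w : (a *: S + T) w = a *: S w + T w by [].
  by rewrite Sl Tl !scalerDr !scalerA [a * b]mulrC !addrA; congr (_ + _); rewrite addrAC.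
exists (2 * (Num.sqrt (sqmod a) * M + N)) => u.
have -> : (a *: S + T) u = a *: S u + T u by [].
have h : l2norm (a *: S u) <= Num.sqrt (sqmod a) * M * l2norm u.
  by rewrite l2normZ -mulrA; apply: ler_wpM2l; [exact: sqrtr_ge0|exact: SM].
have h' := TN u; apply: le_trans (l2norm_leD _ _) _.
lra.
Qed.

HB.instance Definition _ :=
  GRing.isSubmodClosed.Build _ _ bounded_linear bounded_linear_submod.
HB.instance Definition _ := [SubChoice_isSubLmodule of bop by <:].

Lemma bop_linear (T : bop) : linear T.
Proof. by case: T => T /=; rewrite unfold_in => /asboolP[]. Qed.

HB.instance Definition _ (T : bop) :=
  GRing.isLinear.Build _ _ _ _ (T : ell2 -> ell2) (bop_linear T).

Lemma bop_bounded (T : bop) :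
  exists2 M : R, 0 <= M & forall u, l2norm (T u) <= M * l2norm u.
Proof.
case: T => T /=; rewrite unfold_in => /asboolP[_ [M TM]].
exists `|M| => // u; apply: le_trans (TM u) _.
by rewrite ler_wpM2r ?l2norm_ge0// ler_norm.
Qed.

Lemma bop_ext (S T : bop) : (forall u, S u = T u) -> S = T.
Proof. by move=> ST; apply: val_inj; apply: funext. Qed.

Lemma idfun_bounded_linear : (idfun : ell2 -> ell2) \in bounded_linear.
Proof.
rewrite unfold_in; apply/asboolP; split=> //.
by exists 1 => u; rewrite mul1r.
Qed.

Lemma comp_bounded_linear (S T : bop) : (S \o T : ell2 -> ell2) \in bounded_linear.
Proof.
rewrite unfold_in; apply/asboolP; split=> [a u v|] /=; first by rewrite !linearP.
have [M M0 SM] := bop_bounded S; have [N N0 TN] := bop_bounded T.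
exists (M * N) => u; apply: le_trans (SM _) _.
by rewrite -mulrA; exact: ler_wpM2l.
Qed.

Definition bop_one : bop := Bop idfun_bounded_linear.
Definition bop_mul (S T : bop) : bop := Bop (comp_bounded_linear S T).

Lemma bop_mulA : associative bop_mul. Proof. by move=> S T W; apply: bop_ext. Qed.
Lemma bop_mul1 : left_id bop_one bop_mul. Proof. by move=> S; apply: bop_ext. Qed.
Lemma bop_1mul : right_id bop_one bop_mul. Proof. by move=> S; apply: bop_ext. Qed.
Lemma bop_mulDl : left_distributive bop_mul +%R.
Proof. by move=> S T W; apply: bop_ext. Qed.
Lemma bop_mulDr : right_distributive bop_mul +%R.
Proof. by move=> S T W; apply: bop_ext => u /=; rewrite linearD. Qed.
Lemma bop_one_neq0 : bop_one != 0.
Proof.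
apply/eqP => /(congr1 (fun T : bop => T (delta 0) 0)) /= /eqP.
by rewrite (oner_eq0 C).
Qed.

HB.instance Definition _ := GRing.Zmodule_isNzRing.Build bop
  bop_mulA bop_mul1 bop_1mul bop_mulDl bop_mulDr bop_one_neq0.

Lemma bop_scalerAl (a : C) (S T : bop) : a *: (S * T) = a *: S * T.
Proof. by apply: bop_ext. Qed.
HB.instance Definition _ := GRing.Lmodule_isLalgebra.Build C bop bop_scalerAl.

Lemma bop_scalerAr (a : C) (S T : bop) : a *: (S * T) = S * (a *: T).
Proof. by apply: bop_ext => u /=; rewrite linearZ. Qed.
HB.instance Definition _ := GRing.Lalgebra_isAlgebra.Build C bop bop_scalerAr.

Definition opnorm (T : bop) : R :=
  sup [set l2norm (T u) | u in [set u | l2norm u <= 1]].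

End Ell2.

Section Inner.
Variable R : realType.
Local Notation C := (R[i]).
Local Notation ell2 := (ell2 R).
Local Notation bop := (bop R).
Local Notation sumZ := (@sumZ R).

Let partZ (f : int -> R) (n : nat) := \sum_(k < n) (f (Posz k) + f (Negz k)).

Lemma partZ_le_esum (g : int -> R) n : (forall k, 0 <= g k) ->
  ((partZ g n)%:E <= \esum_(k in [set: int]) (g k)%:E)%E.
Proof.
move=> g0; pose s := [seq Posz k | k <- iota 0 n] ++ [seq Negz k | k <- iota 0 n].
apply: esum_ge; exists [set` s]; first by split=> //; exact: finite_seq.
rewrite -fsbig_seq; last first.
  rewrite cat_uniq !map_inj_uniq ?iota_uniq ?andbT/=; try by move=> ? ? [].
  by apply/hasPn => _ /mapP[j _ ->]; apply/mapP => -[].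
rewrite big_cat !big_map /= /partZ.
rewrite -(big_mkord xpredT (fun k => g (Posz k) + g (Negz k))) big_split /=.
by rewrite /index_iota subn0 EFinD !sumEFin.
Qed.

Definition summableZ (f : int -> R) :=
  (\esum_(k in [set: int]) `|f k|%:E < +oo)%E.

Lemma summableZ_le (f g : int -> R) : (forall k, `|f k| <= g k) ->
  (\esum_(k in [set: int]) (g k)%:E < +oo)%E -> summableZ f.
Proof. by move=> fg; apply: le_lt_trans; apply: le_esum => k _; rewrite lee_fin. Qed.

Lemma partZ_cvg f : summableZ f -> cvgn (partZ f).
Proof.
move=> sf; have -> : partZ f = series (fun n => f (Posz n) + f (Negz n)).
  by apply: funext => n; rewrite /partZ /series /= big_mkord.
apply: normed_cvg; apply: nondecreasing_is_cvgn.
  by apply: nondecreasing_series => n _ _; exact: normr_ge0.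
exists (fine (\esum_(k in [set: int]) `|f k|%:E)%E) => _ [n _ <-].
have h : (\esum_(k in [set: int]) `|f k|%:E)%E \is a fin_num.
  by rewrite ge0_fin_numE//; apply: esum_ge0 => k _; rewrite lee_fin.
rewrite -lee_fin fineK//; apply: le_trans (@partZ_le_esum (fun k => `|f k|) n _) => //.
rewrite lee_fin /partZ -(big_mkord xpredT (fun k => `|f (Posz k)| + `|f (Negz k)|)).
by apply: ler_sum => k _; exact: ler_normD.
Qed.

Lemma ler_norm_sumZ (f g : int -> R) : (forall k, `|f k| <= g k) ->
  (\esum_(k in [set: int]) (g k)%:E < +oo)%E ->
  `|sumZ f| <= fine (\esum_(k in [set: int]) (g k)%:E)%E.
Proof.
move=> fg sg; have g0 k : 0 <= g k by apply: le_trans (fg k).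
have h : (\esum_(k in [set: int]) (g k)%:E)%E \is a fin_num.
  by rewrite ge0_fin_numE//; apply: esum_ge0 => k _; rewrite lee_fin.
have cf := partZ_cvg (summableZ_le fg sg).
have b n : `|partZ f n| <= fine (\esum_(k in [set: int]) (g k)%:E)%E.
  rewrite -lee_fin fineK//; apply: le_trans (partZ_le_esum n g0).
  rewrite lee_fin; apply: le_trans (ler_norm_sum _ _ _) _; apply: ler_sum => k _.
  by apply: le_trans (ler_normD _ _) _; exact: lerD.
rewrite ler_norml; apply/andP; split.
  by apply: limr_ge => //; near=> n; have := b n; rewrite ler_norml => /andP[].
by apply: limr_le => //; near=> n; have := b n; rewrite ler_norml => /andP[].
Unshelve. all: by end_near.
Qed.

Lemma sumZD f g : summableZ f -> summableZ g -> sumZ (f \+ g) = sumZ f + sumZ g.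
Proof.
move=> /partZ_cvg cf /partZ_cvg cg; rewrite /sumZ.
rewrite -[RHS]limD//; congr (lim (_ @ \oo)); apply: funext => n /=.
rewrite [RHS](_ : _ = partZ f n + partZ g n)// /partZ -big_split /=.
by apply: eq_bigr => k _; rewrite addrACA.
Qed.

Lemma sumZZ a f : summableZ f -> sumZ (fun k => a * f k) = a * sumZ f.
Proof.
move=> /partZ_cvg cf; rewrite /sumZ -[RHS]limZr//; congr (lim (_ @ \oo)).
apply: funext => n; rewrite [RHS](_ : _ = a * partZ f n)// /partZ mulr_sumr.
by apply: eq_bigr => k _; rewrite mulrDr.
Qed.

Lemma re_conjM_le (x y : C) :
  `|complex.Re (conjc x * y)| <= sqmod x + sqmod y.
Proof.
case: x y => [a b] [c d]; rewrite /sqmod /= ler_norml.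
have := sqr_ge0 a; have := sqr_ge0 b; have := sqr_ge0 c; have := sqr_ge0 d.
have := sqr_ge0 (a + c); have := sqr_ge0 (a - c).
have := sqr_ge0 (b + d); have := sqr_ge0 (b - d).
by move=> *; apply/andP; split; lra.
Qed.

Lemma im_conjM_le (x y : C) :
  `|complex.Im (conjc x * y)| <= sqmod x + sqmod y.
Proof.
case: x y => [a b] [c d]; rewrite /sqmod /= ler_norml.
have := sqr_ge0 a; have := sqr_ge0 b; have := sqr_ge0 c; have := sqr_ge0 d.
have := sqr_ge0 (a + d); have := sqr_ge0 (a - d).
have := sqr_ge0 (b + c); have := sqr_ge0 (b - c).
by move=> *; apply/andP; split; lra.
Qed.

Lemma sqmodD_esum (u v : ell2) :
  (\esum_(k in [set: int]) (sqmod (u k) + sqmod (v k))%:E =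
   (l2norm u ^+ 2 + l2norm v ^+ 2)%:E)%E.
Proof.
under eq_esum do rewrite EFinD.
rewrite esumD; try by move=> k _; rewrite lee_fin sqmod_ge0.
by rewrite !l2normK EFinD !sqnorm_fin.
Qed.

Lemma re_conjM_summable (u v : ell2) :
  summableZ (fun k => complex.Re (conjc (u k) * v k)).
Proof.
apply: (@summableZ_le _ (fun k => sqmod (u k) + sqmod (v k))).
  by move=> k; exact: re_conjM_le.
by rewrite sqmodD_esum ltry.
Qed.

Lemma im_conjM_summable (u v : ell2) :
  summableZ (fun k => complex.Im (conjc (u k) * v k)).
Proof.
apply: (@summableZ_le _ (fun k => sqmod (u k) + sqmod (v k))).
  by move=> k; exact: im_conjM_le.
by rewrite sqmodD_esum ltry.
Qed.

Lemma summableZZ a f : summableZ f -> summableZ (fun k => a * f k).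
Proof.
move=> sf; apply: (@summableZ_le _ (fun k => `|a| * `|f k|)) => [k|].
  by rewrite normrM.
rewrite esumZl//; apply: lte_mul_pinfty => //.
Qed.

Lemma summableZD f g : summableZ f -> summableZ g -> summableZ (f \+ g).
Proof.
move=> sf sg; apply: (@summableZ_le _ (fun k => `|f k| + `|g k|)) => [k|].
  exact: ler_normD.
under eq_esum do rewrite EFinD.
by rewrite esumD//; exact: lte_add_pinfty.
Qed.

Lemma sumZ_lin a b f g h : summableZ f -> summableZ g -> summableZ h ->
  sumZ (fun k => a * f k + b * g k + h k) = a * sumZ f + b * sumZ g + sumZ h.
Proof.
move=> sf sg sh; have saf := summableZZ a sf; have sbg := summableZZ b sg.
rewrite -(sumZZ a sf) -(sumZZ b sg) -(sumZD saf sbg).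
by rewrite -(sumZD (summableZD saf sbg) sh).
Qed.

Lemma inner_linear (u : ell2) (a : C) (v w : ell2) :
  inner u (a *: v + w) = a * inner u v + inner u w.
Proof.
have rs := re_conjM_summable u; have is_ := im_conjM_summable u.
case: a => a b; apply/eqP; rewrite eq_complex; apply/andP; split; apply/eqP.
  have -> : complex.Re (Complex a b * inner u v + inner u w) =
      a * complex.Re (inner u v) + - b * complex.Im (inner u v) +
      complex.Re (inner u w).
    by case: (inner u v) (inner u w) => [? ?] [? ?] /=; ring.
  rewrite /inner /= -(sumZ_lin _ _ (rs v) (is_ v) (rs w)); congr sumZ.
  apply: funext => k.
  rewrite -[X in conjc _ * X]/(Complex a b * v k + w k).
  by case: (u k) (v k) (w k) => [? ?] [? ?] [? ?] /=; ring.
have -> : complex.Im (Complex a b * inner u v + inner u w) =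
    a * complex.Im (inner u v) + b * complex.Re (inner u v) +
    complex.Im (inner u w).
  by case: (inner u v) (inner u w) => [? ?] [? ?] /=; ring.
rewrite /inner /= -(sumZ_lin _ _ (is_ v) (rs v) (is_ w)); congr sumZ.
apply: funext => k.
  rewrite -[X in conjc _ * X]/(Complex a b * v k + w k).
by case: (u k) (v k) (w k) => [? ?] [? ?] [? ?] /=; ring.
Qed.

Lemma sqmod_le_l2norm (u : ell2) k : sqmod (u k) <= l2norm u ^+ 2.
Proof.
rewrite l2normK -lee_fin sqnorm_fin; apply: esum_ge; exists [set k] => //.
by rewrite fsbig_set1.
Qed.

Lemma l2norm_eq0 (u : ell2) : l2norm u = 0 -> u = 0.
Proof.
move=> u0; apply: ell2_ext => k; have := sqmod_le_l2norm u k.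
rewrite u0 expr0n /= /sqmod; case: (u k) => a b /= h.
have [-> ->] : a = 0 /\ b = 0 by split; nra.
by [].
Qed.

Lemma sqmod_inner (u v : ell2) :
  sqmod (inner u v) <= 2 * (l2norm u ^+ 2 + l2norm v ^+ 2) ^+ 2.
Proof.
have bR := @ler_norm_sumZ _ _ (fun k => re_conjM_le (u k) (v k)).
have bI := @ler_norm_sumZ _ _ (fun k => im_conjM_le (u k) (v k)).
move: bR bI; rewrite sqmodD_esum => /(_ (ltry _)) bR /(_ (ltry _)) bI.
have sq (x z : R) : `|x| <= z -> x ^+ 2 <= z ^+ 2.
  move=> xz; rewrite -(real_normK (num_real x)) ler_sqr ?nnegrE//.
  exact: le_trans xz.
rewrite /sqmod mulr2n mulrDl !mul1r.
by apply: lerD; [exact: sq bR|exact: sq bI].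
Qed.

Lemma inner_bounded (u : ell2) :
  exists M, forall v, sqmod (inner u v) <= M * l2norm v ^+ 2.
Proof.
exists (2 * (l2norm u ^+ 2 + 1) ^+ 2) => v.
have inner0 : inner u 0 = 0.
  by have := inner_linear u (-1) 0 0; rewrite scaler0 addr0 mulN1r addNr.
have [v0|vn0] := eqVneq (l2norm v) 0.
  by rewrite (l2norm_eq0 v0) inner0 sqmod0 l2norm0 expr0n mulr0.
have vp : 0 < l2norm v by rewrite lt_def vn0 l2norm_ge0.
pose w := (Complex (l2norm v)^-1 0) *: v.
have w1 : l2norm w = 1.
  rewrite l2normZ /sqmod /= expr0n addr0 sqrtr_sqr ger0_norm ?invr_ge0 ?ltW//.
  by rewrite mulVf.
have vw : v = Complex (l2norm v) 0 *: w + 0.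
  apply: ell2_ext => k; rewrite addr0 !ell2ZE mulrA -[LHS]mul1r; congr (_ * _).
  apply/eqP; rewrite eq_complex /= !mulr0 !mul0r subr0 addr0 mulfV//.
  by rewrite !eqxx.
rewrite [in inner u v]vw inner_linear inner0 addr0 sqmodM.
rewrite [sqmod (Complex _ _)]/sqmod /= expr0n addr0.
rewrite mulrC; apply: ler_wpM2r; first exact: sqr_ge0.
by have := sqmod_inner u w; rewrite w1 expr1n.
Qed.

Lemma ketbra_bounded_linear (u v : ell2) :
  (fun w => inner v w *: u) \in @bounded_linear R.
Proof.
rewrite unfold_in; apply/asboolP; split=> [a w w'|].
  by rewrite inner_linear scalerDl scalerA.
have [M bM] := inner_bounded v.
exists (Num.sqrt M * l2norm u) => w; rewrite l2normZ mulrAC.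
apply: ler_wpM2r; first exact: l2norm_ge0.
rewrite -[l2norm w]ger0_norm ?l2norm_ge0// -sqrtr_sqr.
have M0 : 0 <= M.
  have := bM (delta R 0); have := sqmod_ge0 (inner v (delta R 0)).
  have : 0 < l2norm (delta R 0) ^+ 2.
    apply: lt_le_trans (sqmod_le_l2norm _ 0).
    by rewrite /sqmod /= expr0n expr1n addr0.
  by move=> x0 y0 h; have := le_trans y0 h; rewrite pmulr_lge0.
by rewrite -sqrtrM// ler_wsqrtr.
Qed.

Definition ketbra (u v : ell2) : bop := Bop (ketbra_bounded_linear u v).

Definition shift_fun (u : int -> C) : int -> C := fun k => u (k - 1).
Definition dilate_fun (u : int -> C) : int -> C :=
  fun k => if (2 %| k)%Z then u (k %/ 2)%Z else 0.

Lemma sqnorm_shift u : sqnorm (shift_fun u) = sqnorm u.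
Proof.
rewrite /sqnorm [RHS](@reindex_esum _ _ _ setT setT (fun k => k - 1))//.
split=> // [j k _ _|k _]; first exact: addIr.
by exists (k + 1) => //; rewrite addrK.
Qed.

Lemma sqnorm_dilate u : sqnorm (dilate_fun u) = sqnorm u.
Proof.
rewrite /sqnorm (esumID [set k | (2 %| k)%Z])//; last first.
  by move=> k _; rewrite lee_fin sqmod_ge0.
rewrite !setTI [X in (_ + X)%E]esum1 ?adde0; last first.
  by move=> k /negP h; rewrite /dilate_fun (negPf h) sqmod0.
rewrite (@reindex_esum _ _ _ setT _ (fun k => k * 2)); last first.
  split=> [k _|j k _ _|k /dvdzP[q ->]] /=; last by exists q.
    exact: dvdz_mull.
  by apply: mulIf.
by apply: eq_esum => k _; rewrite /dilate_fun dvdz_mull// mulzK.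
Qed.

Lemma shift_sqsummable (u : ell2) : shift_fun u \in @sqsummable R.
Proof. by rewrite unfold_in; apply/asboolP; rewrite sqnorm_shift ell2P. Qed.

Lemma dilate_sqsummable (u : ell2) : dilate_fun u \in @sqsummable R.
Proof. by rewrite unfold_in; apply/asboolP; rewrite sqnorm_dilate ell2P. Qed.

Lemma shift_bounded_linear :
  (fun u : ell2 => Ell2 (shift_sqsummable u)) \in @bounded_linear R.
Proof.
rewrite unfold_in; apply/asboolP; split=> [a u v|]; first exact: ell2_ext.
by exists 1 => u; rewrite mul1r /l2norm /= sqnorm_shift.
Qed.

Lemma dilate_bounded_linear :
  (fun u : ell2 => Ell2 (dilate_sqsummable u)) \in @bounded_linear R.
Proof.
rewrite unfold_in; apply/asboolP; split=> [a u v|].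
  apply: ell2_ext => k; rewrite ell2DE ell2ZE /= /dilate_fun.
  by case: ifP => //; rewrite mulr0 addr0.
by exists 1 => u; rewrite mul1r /l2norm /= sqnorm_dilate.
Qed.

End Inner.

Section Q2.
Variable R : realType.
Local Notation C := (R[i]).
Local Notation ell2 := (ell2 R).
Local Notation bop := (bop R).
Local Notation e := (delta R).

Definition U : bop := Bop (@shift_bounded_linear R).
Definition S2 : bop := Bop (@dilate_bounded_linear R).
Definition S1 : bop := U * S2.

Lemma U_delta k : U (e k) = e (k + 1).
Proof. by apply: ell2_ext => j /=; rewrite /shift_fun /= subr_eq. Qed.

Lemma S2_delta k : S2 (e k) = e (2 * k).
Proof.
apply: ell2_ext => j /=; rewrite /dilate_fun /=.
case: ifP => [/dvdzP[q ->]|/negbT/dvdzP j2].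
  by rewrite mulzK// mulrC (inj_eq (mulfI _)).
by case: eqP => // jk; case: j2; exists k; rewrite mulrC.
Qed.

(* The Hilbert space adjoint, unique when it exists and existing for every
   bounded operator by the Riesz representation theorem; the default 0 is
   never taken. *)
Definition adj (x : bop) : bop :=
  xget 0 [set y : bop | forall u v : ell2, inner (y u) v = inner u (x v)].

Definition unitary (u : bop) : Prop := adj u * u = 1 /\ u * adj u = 1.

Definition diag (x : bop) (k : int) : C := inner (e k) (x (e k)).

Definition strong_cvg (x_ : nat -> bop) (x : bop) : Prop :=
  forall u : ell2, (fun n => l2norm (x_ n u - x u)) @ \oo --> (0 : R).

Definition norm_cvg (x_ : nat -> bop) (x : bop) : Prop :=
  (fun n => opnorm (x_ n - x)) @ \oo --> (0 : R).

Definition cstar_algebra (A : set bop) : Prop :=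
  [/\ A 0,
      forall (a : C) x y, A x -> A y -> A (a *: x + y),
      forall x y, A x -> A y -> A (x * y),
      forall x, A x -> A (adj x)
    & forall x_ x, (forall n, A (x_ n)) -> norm_cvg x_ x -> A x].

Definition cstar_gen (G : set bop) : set bop := smallest cstar_algebra G.

(* [Q2], [O2] and [D2] are the images in the (faithful) canonical
   representation. *)
Definition Q2 : set bop := cstar_gen [set U; S2].
Definition O2 : set bop := cstar_gen [set S1; S2].

(* Multi-indices over {1, 2} are coded by [true] for 1 and [false] for 2. *)
Definition S_ (i : bool) : bop := if i then S1 else S2.
Definition S_word (alpha : seq bool) : bop := \prod_(i <- alpha) S_ i.
Definition P_word (alpha : seq bool) : bop := S_word alpha * adj (S_word alpha).

Definition D2 : set bop := cstar_gen (range P_word).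

Definition phi (x : bop) : bop := S1 * x * adj S1 + S2 * x * adj S2.

(* Maps between operator algebras are total functions on [bop] of which only
   the values on the algebra [A] are relevant. *)
Definition star_hom (A : set bop) (f : bop -> bop) : Prop :=
  [/\ forall (a : C) x y, A x -> A y -> f (a *: x + y) = a *: f x + f y,
      forall x y, A x -> A y -> f (x * y) = f x * f y
    & forall x, A x -> f (adj x) = adj (f x)].

Definition representation (A : set bop) (f : bop -> bop) : Prop :=
  star_hom A f /\ f 1 = 1.

Definition automorphism (A : set bop) (f : bop -> bop) : Prop :=
  star_hom A f /\ set_bij A A f.

Definition extends (A : set bop) (f g : bop -> bop) : Prop :=
  forall x, A x -> g x = f x.

Definition implemented_by (A : set bop) (f : bop -> bop) (u : bop) : Prop :=
  unitary u /\ forall x, A x -> f x = u * x * adj u.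

Definition commutant (A : set bop) : set bop :=
  [set x | forall y, A y -> x * y = y * x].

(* The generated von Neumann algebra when [A] is self-adjoint and unital, as
   [Q2] and [O2] are. *)
Definition vonNeumann (A : set bop) : set bop := commutant (commutant A).

Definition inner_aut (A : set bop) (f : bop -> bop) : Prop :=
  exists2 u, A u & implemented_by A f u.

Definition weakly_inner (A : set bop) (f : bop -> bop) : Prop :=
  exists2 u, vonNeumann A u & implemented_by A f u.

(* [lam] is the automorphism [lambda_d] of [O2]; its values on [O2] are
   determined by this property. *)
Definition is_lambda (d : bop) (lam : bop -> bop) : Prop :=
  [/\ automorphism O2 lam, lam S1 = d * S1 & lam S2 = d * S2].

(* [L] is an extension of [lambda_d] (given as [lam]) in Aut([Q2]). *)
Definition is_extension (lam L : bop -> bop) : Prop :=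
  automorphism Q2 L /\ extends O2 lam L.

Definition dcheck (L : bop -> bop) : bop := L U * adj U.

Definition dprod (d : bop) (k : nat) : bop := \prod_(j < k) iter j phi d.

(* The factors of the last product appear with exponents k-1, ..., 1, 0. *)
Definition xseq (d : bop) (alpha : C) (k : nat) : bop :=
  alpha *: ketbra (e 0) (e 0) +
  dprod d k * (\sum_(i < k) S2 ^+ i * S1 * adj S1 * adj S2 ^+ i) * U *
  (\prod_(j < k) iter (rev_ord j) phi (adj d)) * adj U.

End Q2.

Arguments Q2 : clear implicits.
Arguments O2 : clear implicits.
Arguments D2 : clear implicits.

(* Main.v *)
(* In the canonical representation [d] is a diagonal operator whose entries
   form a uniformly continuous function for the 2-adic metric on the integers,
   and [phi d] has entries [d (floor (n / 2))]. Since the iterates of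
   [n |-> floor (n / 2)] end in 0 or -1, where [d] is 1, the products [dprod d k]
   are pointwise eventually constant; their limit [c] satisfies
   [c (2 n + i) = d (2 n + i) * c n], so that conjugation by [c] implements
   [lambda_d] on the generators, hence (by automatic continuity of
   *-homomorphisms) on [O2]. Multiplying [c] by [conj alpha] on the negative
   integers does not affect this, and conjugation then sends [U] to [x U], where
   [x] is the strong limit of [xseq d alpha], with entries [c n * conj (c (n - 1))]
   for [n <> 0] and [alpha] at 0.

   Conversely an extension [L] fixes [D2] pointwise, so [dcheck L] commutes with
   [D2] and is a diagonal element of [Q2]; the relations between [U] and [S2]
   determine its entries away from 0. That a diagonal element [x] of [Q2] lies
   in [D2] follows from two properties of limits of linear combinations of
   monomials [e n |-> e ((2^t n + b) / 2^s)]: their diagonal is 2-adically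
   uniformly continuous up to finitely many entries, and the vector states of
   [sum_(j <= i < 2 j) e (n + 2^i)] converge to that of [e n], which recovers the
   exceptional entries from the others. *)
Require Import Defs.
From mathcomp Require Import all_boot all_order all_algebra.
From mathcomp Require Import complex.
From mathcomp Require Import all_classical all_reals all_analysis.
From mathcomp Require Import ring lra zify.
Set Implicit Arguments.
Unset Strict Implicit.
Unset Printing Implicit Defensive.
Import Order.TTheory GRing.Theory Num.Theory.
Import numFieldNormedType.Exports.
Local Open Scope classical_set_scope.
Local Open Scope ring_scope.
Arguments inner : simpl never.


(** * The Hilbert space of square summable two-sided sequences *)

(** Algebra maps are given only algebraically, so agreement on generators spreads to the generated
    algebra through contractivity of star homomorphisms. That rests on a square root of [1 - t]
    found by fixed-point iteration, which is why completeness of the bounded operators is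
    established. The parameter alpha is free because [half] preserves the sign: O2 never links
    negative and nonnegative basis vectors, and only [U] crosses from -1 to 0. The obstacle is that
    taking the diagonal does not send Q2 into D2: the diagonal of [S2] is the point mass at 0. A
    monomial either fixes all basis vectors of a periodic set, or its affine map fixes at most one
    n, which creates such an isolated entry. Around that n the map multiplies offsets by 2^(t-s),
    hence shifts the exponents of the points n + 2^i. A long window of exponents is almost invariant
    under this shift (a Folner argument), so the averaged state also sees the isolated entry. On a
    diagonal operator the same state is a plain average of far entries, where continuity holds; this
    rules out exceptional entries. *)

Section Hilbert.
Variable R : realType.
Local Notation C := (R[i]).
Local Notation ell2 := (ell2 R).
Local Notation e := (delta R).
Implicit Types (u v w : ell2) (a : C).

(** Bridge between the unordered sum in [sqnorm] and the ordered limit in [sumZ]: the integers split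
    by sign, and each part is reindexed by the naturals. *)
Lemma esum_intE (f : int -> R) : (forall k, 0 <= f k) ->
  (\esum_(k in [set: int]) (f k)%:E)%E =
  limn (fun n => (\sum_(k < n) (f (Posz k) + f (Negz k)))%:E).
Proof.
move=> f0.
have -> : (fun n => (\sum_(k < n) (f (Posz k) + f (Negz k)))%:E) =
    (fun n => \sum_(0 <= k < n) ((f (Posz k))%:E + (f (Negz k))%:E))%E.
  by apply: funext => n /=; rewrite big_mkord -sumEFin.
rewrite nneseriesD; try by move=> *; rewrite lee_fin.
rewrite !nneseries_esumT; try by move=> *; rewrite lee_fin.
rewrite (esumID [set k : int | 0 <= k]); last by move=> k _; rewrite lee_fin.
congr (_ + _)%E; apply: reindex_esum; split.
- by move=> k _.
- by move=> i j _ _ [].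
- by move=> [k|k] [_ //= _]; exists k.
- by move=> k _; split.
- by move=> i j _ _ [].
- by move=> [k|k] [_ /= h]; [case: h|exists k].
Qed.

Lemma sumZ_esum (f : int -> R) : (forall k, 0 <= f k) ->
  (\esum_(k in [set: int]) (f k)%:E < +oo)%E ->
  (sumZ f)%:E = (\esum_(k in [set: int]) (f k)%:E)%E.
Proof.
move=> f0 fin; have sf : summableZ f.
  by apply: le_lt_trans fin; apply: le_esum => k _; rewrite ger0_norm.
by rewrite esum_intE// /sumZ -EFin_lim//; exact: partZ_cvg.
Qed.

Lemma sqnorm_le (f : int -> C) (M : R) :
  (forall n, \sum_(k < n) (sqmod (f (Posz k)) + sqmod (f (Negz k))) <= M) ->
  (sqnorm f <= M%:E)%E.
Proof.
move=> fM; rewrite /sqnorm esum_intE; last by move=> k; exact: sqmod_ge0.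
apply: lime_le; last by apply: nearW => n; rewrite lee_fin.
apply: ereal_nondecreasing_is_cvgn => m n mn; rewrite lee_fin.
rewrite -!(big_mkord xpredT (fun k => sqmod (f (Posz k)) + sqmod (f (Negz k)))).
by rewrite [leRHS](big_cat_nat (n := m))//= lerDl sumr_ge0// => k _; rewrite addr_ge0 ?sqmod_ge0.
Qed.

(** Builds vectors known only through their coordinates: the Riesz vectors in [adj_exists] and the
    limits in [ell2_complete]. *)
Lemma ell2_of_bounded (f : int -> C) (M : R) :
  (forall n, \sum_(k < n) (sqmod (f (Posz k)) + sqmod (f (Negz k))) <= M) ->
  exists2 u : ell2, (forall k, u k = f k) & l2norm u ^+ 2 <= M.
Proof.
move=> /sqnorm_le fM.
have f2 : f \in @sqsummable R.
  by rewrite unfold_in; apply/asboolP; apply: le_lt_trans fM (ltry _).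
by exists (Ell2 f2) => //; rewrite l2normK -lee_fin sqnorm_fin.
Qed.

Lemma sumZN (f : int -> R) : summableZ f -> sumZ (fun k => - f k) = - sumZ f.
Proof.
move=> sf; rewrite -mulN1r -sumZZ//; congr sumZ.
by apply: funext => k; rewrite mulN1r.
Qed.

Lemma inner_conj u v : inner v u = conjc (inner u v).
Proof.
have eqRe : sumZ (fun k => complex.Re (conjc (v k) * u k)) =
            sumZ (fun k => complex.Re (conjc (u k) * v k)).
  by congr sumZ; apply: funext => k; case: (u k) (v k) => [? ?] [? ?] /=; ring.
rewrite /inner eqRe /= -(sumZN (im_conjM_summable u v)).
congr (Complex _ (sumZ _)); apply: funext => k.
by case: (u k) (v k) => [? ?] [? ?] /=; ring.
Qed.

Lemma innerDr u v w : inner u (v + w) = inner u v + inner u w.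
Proof. by have := inner_linear u 1 v w; rewrite scale1r mul1r. Qed.

Lemma inner0r u : inner u 0 = 0.
Proof. by have := innerDr u 0 0; rewrite addr0 => /eqP; rewrite addrC -subr_eq subrr => /eqP. Qed.

Lemma innerZr u a v : inner u (a *: v) = a * inner u v.
Proof. by have := inner_linear u a v 0; rewrite inner0r !addr0. Qed.

Lemma innerNr u v : inner u (- v) = - inner u v.
Proof. by rewrite -scaleN1r innerZr mulN1r. Qed.

Lemma innerBr u v w : inner u (v - w) = inner u v - inner u w.
Proof. by rewrite innerDr innerNr. Qed.

Lemma innerDl u v w : inner (v + w) u = inner v u + inner w u.
Proof. by rewrite inner_conj innerDr (inner_conj u v) (inner_conj u w) rmorphD. Qed.

Lemma innerZl u a v : inner (a *: v) u = conjc a * inner v u.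
Proof. by rewrite inner_conj innerZr (inner_conj u v) rmorphM. Qed.

Lemma innerNl u v : inner (- v) u = - inner v u.
Proof. by rewrite inner_conj innerNr (inner_conj u v) rmorphN. Qed.

Lemma innerBl u v w : inner (v - w) u = inner v u - inner w u.
Proof. by rewrite innerDl innerNl. Qed.

Lemma inner0l u : inner 0 u = 0.
Proof. by rewrite inner_conj inner0r conjc0. Qed.

Lemma inner_suml u n (F : nat -> ell2) :
  inner (\sum_(k < n) F k) u = \sum_(k < n) inner (F k) u.
Proof.
elim: n => [|n IH]; first by rewrite !big_ord0 inner0l.
by rewrite !big_ord_recr /= innerDl IH.
Qed.

Lemma inner_sumr u n (F : nat -> ell2) :
  inner u (\sum_(k < n) F k) = \sum_(k < n) inner u (F k).
Proof.
elim: n => [|n IH]; first by rewrite !big_ord0 inner0r.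
by rewrite !big_ord_recr /= innerDr IH.
Qed.

Lemma sqmod_conjM a : conjc a * a = (sqmod a)%:C%C.
Proof.
by case: a => x y; apply/eqP; rewrite eq_complex /sqmod /=; apply/andP; split;
  apply/eqP; ring.
Qed.

Lemma inner_self u : inner u u = (l2norm u ^+ 2)%:C%C.
Proof.
apply/eqP; rewrite eq_complex /=; apply/andP; split; apply/eqP.
  apply: EFin_inj; rewrite l2normK sqnorm_fin.
  have -> : (fun k => complex.Re (conjc (u k) * u k)) = (fun k => sqmod (u k)).
    by apply: funext => k; rewrite sqmod_conjM.
  by rewrite sumZ_esum//; [move=> k; exact: sqmod_ge0|exact: ell2P].
have -> : (fun k => complex.Im (conjc (u k) * u k)) = (fun k => 0 * 0).
  by apply: funext => k; rewrite sqmod_conjM mulr0.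
rewrite sumZZ ?mul0r// /summableZ esum1 ?ltry// => k _.
by rewrite normr0.
Qed.

Lemma sqmod_conj a : sqmod (conjc a) = sqmod a.
Proof. by case: a => x y; rewrite /sqmod /= sqrrN. Qed.

Lemma cauchy_schwarz u v : sqmod (inner u v) <= l2norm u ^+ 2 * l2norm v ^+ 2.
Proof.
have [u0|un0] := eqVneq (l2norm u) 0.
  by rewrite (l2norm_eq0 u0) inner0l sqmod0 l2norm0 expr0n mul0r.
have N0 : 0 < l2norm u ^+ 2 by rewrite exprn_gt0// lt_def un0 l2norm_ge0.
set c := inner u v; set N := l2norm u ^+ 2 in N0 *.
(* [N v - c u] is [N] times the component of [v] orthogonal to [u]; scaling by [N] avoids a
   division. *)
have : inner (N%:C%C *: v - c *: u) (N%:C%C *: v - c *: u) =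
    (N * (N * l2norm v ^+ 2 - sqmod c))%:C%C.
  rewrite !innerBl !innerBr !innerZl !innerZr -/c (inner_conj u v) -/c.
  rewrite !inner_self -/N conjc_real.
  have := sqmod_conjM c; move: (conjc c) => c' cc'.
  rewrite !(rmorphM, rmorphB) /= -cc'; ring.
rewrite inner_self => /complexI h.
have := sqr_ge0 (l2norm (N%:C%C *: v - c *: u)).
by rewrite h pmulr_rge0// subr_ge0.
Qed.

Lemma Re_le_sqmod a : complex.Re a <= Num.sqrt (sqmod a).
Proof.
case: a => x y /=; apply: le_trans (ler_norm _) _.
by rewrite -sqrtr_sqr ler_wsqrtr// /sqmod /= lerDl sqr_ge0.
Qed.

Lemma sqmod_inner_le u v :
  Num.sqrt (sqmod (inner u v)) <= l2norm u * l2norm v.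
Proof.
rewrite -[leRHS]ger0_norm ?mulr_ge0 ?l2norm_ge0// -sqrtr_sqr ler_wsqrtr//.
by rewrite exprMn cauchy_schwarz.
Qed.

(** Expanding the square and applying Cauchy-Schwarz removes the factor 2 of [l2norm_leD]. *)
Lemma l2normD u v : l2norm (u + v) <= l2norm u + l2norm v.
Proof.
rewrite -ler_sqr ?nnegrE ?addr_ge0 ?l2norm_ge0//.
have := inner_self (u + v); rewrite innerDl !innerDr !inner_self (inner_conj u v).
move=> /(congr1 (@complex.Re R)).
have := le_trans (Re_le_sqmod _) (sqmod_inner_le u v).
case: (inner u v) => x y /= h <-; lra.
Qed.

Lemma l2normN u : l2norm (- u) = l2norm u.
Proof.
by rewrite -scaleN1r l2normZ /sqmod /= oppr0 sqrrN expr0n expr1n addr0 sqrtr1 mul1r.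
Qed.

Lemma deltaE j k : e j k = (k == j)%:R.
Proof. by []. Qed.

Lemma sumZ_supp1 (f : int -> R) j : (forall k, k != j -> f k = 0) -> sumZ f = f j.
Proof.
move=> fj; have -> : f = fun k => f j * (sqmod (e j k)).
  apply: funext => k; rewrite deltaE; have [->|kj] := eqVneq k j.
    by rewrite /sqmod /= expr1n expr0n addr0 mulr1.
  by rewrite fj// /sqmod /= expr0n addr0 mulr0.
have s : (\esum_(k in [set: int]) (sqmod (e j k))%:E = 1)%E.
  rewrite (esumID [set j])//; last by move=> k _; rewrite lee_fin sqmod_ge0.
  rewrite setTI esum_set1 ?lee_fin ?sqmod_ge0// esum1 ?adde0.
    by rewrite deltaE eqxx /sqmod /= expr1n expr0n addr0.
  by move=> k [_ /eqP kj]; rewrite deltaE (negPf kj) sqmod0.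
rewrite sumZZ; last first.
  rewrite /summableZ (_ : (\esum_(_ in _) _)%E = 1%E) ?ltry// -s.
  by apply: eq_esum => k _; rewrite ger0_norm ?sqmod_ge0.
congr (_ * _); apply: EFin_inj; rewrite sumZ_esum.
- by rewrite s deltaE eqxx /sqmod /= expr1n expr0n addr0.
- by move=> k; exact: sqmod_ge0.
- by rewrite s ltry.
Qed.

Lemma inner_delta k u : inner (e k) u = u k.
Proof.
rewrite /inner !(@sumZ_supp1 _ k).
- by rewrite deltaE eqxx conjc1 mul1r; case: (u k).
- by move=> j jk; rewrite deltaE (negPf jk) conjc0 mul0r.
- by move=> j jk; rewrite deltaE (negPf jk) conjc0 mul0r.
Qed.

Lemma l2norm_delta k : l2norm (e k) = 1.
Proof.
have := inner_self (e k); rewrite inner_delta deltaE eqxx => /complexI/esym/eqP.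
by rewrite sqrf_eq1 => /orP[/eqP//|/eqP h]; have := l2norm_ge0 (e k); rewrite h; lra.
Qed.

Definition trunc (u : int -> C) (n : nat) : ell2 :=
  \sum_(k < n) (u (Posz k) *: e (Posz k) + u (Negz k) *: e (Negz k)).

Lemma ell2_sumE n (F : nat -> ell2) k : (\sum_(i < n) F i) k = \sum_(i < n) F i k.
Proof. by elim: n => [|n IH]; rewrite ?big_ord0// !big_ord_recr /= -IH. Qed.

Lemma inner_truncl (u : int -> C) n v : inner (trunc u n) v =
  \sum_(k < n) (conjc (u (Posz k)) * v (Posz k) + conjc (u (Negz k)) * v (Negz k)).
Proof.
rewrite (inner_suml v n (fun k => u (Posz k) *: e (Posz k) + u (Negz k) *: e (Negz k))).
by apply: eq_bigr => k _; rewrite innerDl !innerZl !inner_delta.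
Qed.

Lemma truncE (u : int -> C) n k :
  trunc u n k = if (- (n%:Z) <= k) && (k < n%:Z) then u k else 0.
Proof.
have -> : trunc u n k = \sum_(i < n)
    (u (Posz i) * (k == Posz i)%:R + u (Negz i) * (k == Negz i)%:R).
  exact: (ell2_sumE n (fun i => u (Posz i) *: e (Posz i) + u (Negz i) *: e (Negz i))).
elim: n => [|n IH]; first by rewrite big_ord0; case: ifP => //; lia.
rewrite big_ord_recr /= IH.
have [->|k1] := eqVneq k (Posz n).
  by rewrite mulr0 mulr1 addr0 ifF ?ifT ?add0r//; lia.
have [->|k2] := eqVneq k (Negz n).
  by rewrite mulr0 mulr1 ifF ?ifT ?add0r//; lia.
rewrite !mulr0 !addr0.
by have -> : (- n.+1%:Z <= k) && (k < n.+1%:Z) = (- n%:Z <= k) && (k < n%:Z) by lia.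
Qed.

Lemma l2norm_trunc_sub u n :
  l2norm (u - trunc u n) ^+ 2 = l2norm u ^+ 2 -
   \sum_(k < n) (sqmod (u (Posz k)) + sqmod (u (Negz k))).
Proof.
apply: (@complexI R); rewrite -inner_self innerBl !innerBr !inner_truncl.
rewrite (inner_conj (trunc u n)) inner_truncl.
have -> : \sum_(k < n) (conjc (u (Posz k)) * trunc u n (Posz k) +
    conjc (u (Negz k)) * trunc u n (Negz k)) =
    (\sum_(k < n) (sqmod (u (Posz k)) + sqmod (u (Negz k))))%:C%C.
  rewrite rmorph_sum /=; apply: eq_bigr => k _; have := ltn_ord k => kn.
  by rewrite !truncE !ifT ?sqmod_conjM ?rmorphD//; lia.
have -> : \sum_(k < n) (conjc (u (Posz k)) * u (Posz k) +
    conjc (u (Negz k)) * u (Negz k)) =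
    (\sum_(k < n) (sqmod (u (Posz k)) + sqmod (u (Negz k))))%:C%C.
  rewrite rmorph_sum; apply: eq_bigr => k _.
  by rewrite !sqmod_conjM -rmorphD.
by rewrite conjc_real subrr subr0 inner_self rmorphB.
Qed.

Lemma trunc_cvg u eps : 0 < eps -> exists n, l2norm (u - trunc u n) < eps.
Proof.
move=> e0.
have s : sumZ (fun k => sqmod (u k)) = l2norm u ^+ 2.
  apply: EFin_inj; rewrite sumZ_esum ?l2normK ?sqnorm_fin//; last exact: ell2P.
  by move=> k; exact: sqmod_ge0.
have sm : summableZ (fun k => sqmod (u k)).
  rewrite /summableZ; have := ell2P u; congr (_ < _)%E.
  by apply: eq_esum => k _; rewrite ger0_norm ?sqmod_ge0.
have := partZ_cvg sm; rewrite -[limn _]/(sumZ (fun k => sqmod (u k))) s.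
move=> /cvgrPdist_lt.
move=> /(_ (eps ^+ 2) (exprn_gt0 _ e0)) [n _ /(_ n (leqnn n))] /= h.
exists n; rewrite -ltr_sqr ?nnegrE ?l2norm_ge0 ?ltW// l2norm_trunc_sub.
exact: le_lt_trans (ler_norm _) h.
Qed.

Lemma inner_ext u v : (forall w, inner w u = inner w v) -> u = v.
Proof. by move=> h; apply: ell2_ext => k; rewrite -!inner_delta. Qed.

Lemma inner_extl u v : (forall w, inner u w = inner v w) -> u = v.
Proof. by move=> h; apply: inner_ext => w; rewrite inner_conj h -inner_conj. Qed.

End Hilbert.

(** * Adjoints and completeness of the algebra of bounded operators *)

Section Operators.
Variable R : realType.
Local Notation C := (R[i]).
Local Notation ell2 := (ell2 R).
Local Notation bop := (bop R).
Local Notation e := (delta R).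
Implicit Types (u v w : ell2) (a : C) (S T x y z : bop).

Lemma bopDE S T u : (S + T) u = S u + T u. Proof. by []. Qed.
Lemma bopZE a T u : (a *: T) u = a *: T u. Proof. by []. Qed.
Lemma bopNE T u : (- T) u = - T u.
Proof. by apply/eqP; rewrite -addr_eq0 -bopDE addNr. Qed.
Lemma bopBE S T u : (S - T) u = S u - T u.
Proof. by rewrite bopDE bopNE. Qed.
Lemma bopME S T u : (S * T) u = S (T u). Proof. by []. Qed.
Lemma bop1E u : (1 : bop) u = u. Proof. by []. Qed.

Lemma bop_add T u v : T (u + v) = T u + T v. Proof. exact: linearD. Qed.
Lemma bop_sub T u v : T (u - v) = T u - T v. Proof. exact: linearB. Qed.
Lemma bop_scale T a u : T (a *: u) = a *: T u. Proof. exact: linearZ. Qed.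
Lemma bop_0 T : T 0 = 0. Proof. exact: linear0. Qed.
Lemma bop_sum T n (F : nat -> ell2) : T (\sum_(k < n) F k) = \sum_(k < n) T (F k).
Proof. exact: linear_sum. Qed.

Lemma bop_trunc T (f : int -> C) n : T (trunc f n) =
  \sum_(k < n) (f (Posz k) *: T (e (Posz k)) + f (Negz k) *: T (e (Negz k))).
Proof.
rewrite /trunc (bop_sum T n (fun k => f (Posz k) *: e (Posz k) + f (Negz k) *: e (Negz k))).
by apply: eq_bigr => k _; rewrite bop_add !bop_scale.
Qed.

Lemma l2norm_small u : (forall eps : R, 0 < eps -> l2norm u <= eps) -> u = 0.
Proof.
move=> h; apply: l2norm_eq0; apply/eqP; rewrite eq_le l2norm_ge0 andbT.
by apply/ler_addgt0Pr => eps /h; rewrite add0r.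
Qed.

(** Truncations are dense and [S - T] kills each of them, so only the arbitrarily small tail of [u]
    contributes. *)
Lemma bop_ext_delta S T : (forall k, S (e k) = T (e k)) -> S = T.
Proof.
move=> ST; apply: bop_ext => u; apply/eqP; rewrite -subr_eq0 -bopBE; apply/eqP.
have [M M0 bM] := bop_bounded (S - T).
apply: l2norm_small => eps eps0.
have p : 0 < eps / (M + 1) by apply: divr_gt0 => //; lra.
have [n /ltW un] := trunc_cvg u p.
have -> : (S - T) u = (S - T) (u - trunc u n).
  rewrite bop_sub [X in _ = _ - X](_ : _ = 0) ?subr0//.
  rewrite bop_trunc big1// => k _.
  by rewrite !bopBE !ST !subrr !scaler0 addr0.
apply: le_trans (bM _) _.
have : M * l2norm (u - trunc u n) <= M * (eps / (M + 1)) by exact: ler_wpM2l.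
move/le_trans; apply; rewrite mulrA ler_pdivrMr; last by lra.
by rewrite mulrDr mulr1 mulrC lerDl ltW.
Qed.

(** Riesz representation by hand. The candidate for the adjoint at [u] has coordinates <T e_k, u>.
    If [S] is a partial sum of their squared moduli and [w] the matching truncation, then [S] = <T
    w, u> and |w|^2 = [S], so Cauchy-Schwarz gives S^2 <= S (M |u|)^2, a bound independent of the
    truncation. *)
Lemma adj_exists T : exists y, forall u v, inner (y u) v = inner u (T v).
Proof.
have [M M0 TM] := bop_bounded T.
have rep u : exists2 w : ell2, (forall k, w k = inner (T (e k)) u) &
    l2norm w ^+ 2 <= (M * l2norm u) ^+ 2.
  apply: ell2_of_bounded => n; set S := \sum_(k < n) _.
  pose y k := inner (T (e k)) u; pose w := trunc y n.
  have yS v : (forall k, - (n%:Z) <= k < n%:Z -> v k = y k) ->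
      inner w v = S%:C%C.
    move=> vy; rewrite inner_truncl /S rmorph_sum; apply: eq_bigr => k _.
    have kn := ltn_ord k.
    by rewrite !vy ?sqmod_conjM -?rmorphD//; lia.
  have wS : l2norm w ^+ 2 = S.
    apply: (@complexI R); rewrite -inner_self; apply: yS => k kn.
    by rewrite truncE kn.
  have TwS : inner (T w) u = S%:C%C.
    rewrite bop_trunc (inner_suml u n
      (fun k => y (Posz k) *: T (e (Posz k)) + y (Negz k) *: T (e (Negz k)))).
    rewrite /S rmorph_sum; apply: eq_bigr => k _.
    by rewrite innerDl !innerZl -/(y _) -/(y (Negz k)) !sqmod_conjM -rmorphD.
  have S0 : 0 <= S by rewrite -wS sqr_ge0.
  have := cauchy_schwarz (T w) u; rewrite TwS {1}/sqmod /= expr0n addr0 => h.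
  have : S ^+ 2 <= S * (M * l2norm u) ^+ 2.
    apply: le_trans h _; rewrite exprMn [S * (_ * _)]mulrA; apply: ler_wpM2r; first exact: sqr_ge0.
    rewrite [S * _]mulrC -wS -exprMn ler_sqr ?nnegrE ?mulr_ge0 ?l2norm_ge0//.
  have [->|Sn0] := eqVneq S 0; first by rewrite sqr_ge0.
  by rewrite expr2 ler_pM2l// lt_def Sn0.
pose f u := xget 0 [set w : ell2 | (forall k, w k = inner (T (e k)) u) /\
   l2norm w ^+ 2 <= (M * l2norm u) ^+ 2].
have fP u : (forall k, f u k = inner (T (e k)) u) /\
   l2norm (f u) ^+ 2 <= (M * l2norm u) ^+ 2.
  apply: (@xgetPex _ 0 [set w : ell2 | (forall k, w k = inner (T (e k)) u) /\
    l2norm w ^+ 2 <= (M * l2norm u) ^+ 2]).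
  by have [w ? ?] := rep u; exists w.
have fB : f \in @bounded_linear R.
  rewrite unfold_in; apply/asboolP; split=> [a u v|].
    apply: ell2_ext => k; rewrite ell2DE ell2ZE !(fP _).1.
    by rewrite innerDr innerZr.
  exists M => u; rewrite -ler_sqr ?nnegrE ?mulr_ge0 ?l2norm_ge0//.
  exact: (fP u).2.
exists (Bop fB) => u v /=.
have fk k : inner (f u) (e k) = inner u (T (e k)).
  by rewrite inner_conj inner_delta (fP u).1 -inner_conj.
apply/eqP; rewrite -subr_eq0; apply/eqP.
suff h eps : 0 < eps -> sqmod (inner (f u) v - inner u (T v)) <= eps ^+ 2.
  set z := _ - _ in h *.
  have z0 : sqmod z <= 0.
    apply/ler_addgt0Pr => eps eps0; rewrite add0r.
    by have := h (Num.sqrt eps); rewrite sqrtr_gt0 => /(_ eps0); rewrite sqr_sqrtr// ltW.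
  move: z0; rewrite /sqmod; case: (z) => p q /= pq.
  by have [-> ->] : p = 0 /\ q = 0 by split; nra.
move=> eps0.
(* The adjoint identity holds on truncations of [v]; for the tail [r], each of the two inner
   products is at most M |u| |r|, whence the factor 2. *)
pose K := 2 * M * l2norm u; have K0 : 0 <= K by rewrite !mulr_ge0 ?l2norm_ge0.
have [n /ltW vn] := trunc_cvg v (divr_gt0 eps0 (ltr_wpDl K0 ltr01)).
set r := v - trunc v n in vn.
have -> : inner (f u) v - inner u (T v) = inner (f u) r - inner u (T r).
  suff E : inner (f u) (trunc v n) = inner u (T (trunc v n)).
    by rewrite /r bop_sub !innerBr E; ring.
  rewrite bop_trunc (inner_sumr u n
      (fun k => v (Posz k) *: T (e (Posz k)) + v (Negz k) *: T (e (Negz k)))).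
  rewrite (inner_sumr (f u) n
      (fun k => v (Posz k) *: e (Posz k) + v (Negz k) *: e (Negz k))).
  by apply: eq_bigr => k _; rewrite !innerDr !innerZr !fk.
have -> : inner (f u) r - inner u (T r) = inner (e 0) ((inner (f u) r - inner u (T r)) *: e 0).
  by rewrite innerZr inner_delta deltaE eqxx mulr1.
(* The triangle inequality for complex numbers, read off from that of multiples of [e 0]. *)
have sq (b c : C) : sqmod (b - c) <= (Num.sqrt (sqmod b) + Num.sqrt (sqmod c)) ^+ 2.
  have := l2normD (b *: e 0) ((- c) *: e 0).
  rewrite -scalerDl !l2normZ l2norm_delta !mulr1.
  have -> : sqmod (- c) = sqmod c by case: (c) => ? ?; rewrite /sqmod /= !sqrrN.
  rewrite -ler_sqr ?nnegrE ?addr_ge0 ?sqrtr_ge0// sqr_sqrtr ?sqmod_ge0//.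
rewrite innerZr inner_delta deltaE eqxx mulr1; apply: le_trans (sq _ _) _.
rewrite ler_sqr ?nnegrE ?addr_ge0 ?sqrtr_ge0 ?(ltW eps0)//.
have h1 := sqmod_inner_le (f u) r; have h2 := sqmod_inner_le u (T r).
have h3 : l2norm (f u) <= M * l2norm u.
  by rewrite -ler_sqr ?nnegrE ?mulr_ge0 ?l2norm_ge0//; exact: (fP u).2.
have r0 := l2norm_ge0 r; have u0 := l2norm_ge0 u.
have h4 : l2norm (f u) * l2norm r <= M * l2norm u * l2norm r by exact: ler_wpM2r.
have h5 : l2norm u * l2norm (T r) <= l2norm u * (M * l2norm r) by apply: ler_wpM2l.
have h6 : K * l2norm r <= K * (eps / (K + 1)) by exact: ler_wpM2l.
have h7 : K * (eps / (K + 1)) <= eps.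
  by rewrite mulrA ler_pdivrMr ?ltr_wpDl// mulrDr mulr1 mulrC lerDl ltW.
apply: le_trans (lerD (le_trans h1 h4) (le_trans h2 h5)) (le_trans _ (le_trans h6 h7)).
by rewrite le_eqVlt; apply/orP; left; apply/eqP; rewrite /K; ring.
Qed.

Lemma adjP T u v : inner (adj T u) v = inner u (T v).
Proof.
exact: (@xgetPex _ 0 [set y : bop | forall u v, inner (y u) v = inner u (T v)]
  (adj_exists T)).
Qed.

Lemma adjP' T u v : inner (T u) v = inner u (adj T v).
Proof. by rewrite inner_conj -adjP -inner_conj. Qed.

Lemma adj_uniq T S : (forall u v, inner (S u) v = inner u (T v)) -> adj T = S.
Proof. by move=> h; apply: bop_ext => u; apply: inner_extl => w; rewrite adjP h. Qed.

Lemma adjK : involutive (@adj R).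
Proof. by move=> T; apply: adj_uniq => u v; rewrite adjP'. Qed.

Lemma adjM S T : adj (S * T) = adj T * adj S.
Proof. by apply: adj_uniq => u v; rewrite !bopME !adjP. Qed.

Lemma adjD S T : adj (S + T) = adj S + adj T.
Proof. by apply: adj_uniq => u v; rewrite !bopDE innerDl innerDr !adjP. Qed.

Lemma adjZ a T : adj (a *: T) = conjc a *: adj T.
Proof. by apply: adj_uniq => u v; rewrite !bopZE innerZl innerZr !adjP conjcK. Qed.

Lemma adj1 : adj 1 = 1 :> bop.
Proof. by apply: adj_uniq => u v; rewrite !bop1E. Qed.

Lemma adj0 : adj 0 = 0 :> bop.
Proof. by apply: adj_uniq => u v; rewrite inner0l inner0r. Qed.

Lemma adjN T : adj (- T) = - adj T.
Proof. by rewrite -scaleN1r adjZ rmorphN1 scaleN1r. Qed.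

Lemma adjB S T : adj (S - T) = adj S - adj T.
Proof. by rewrite adjD adjN. Qed.

Lemma adj_entry T j k : inner (e j) (adj T (e k)) = conjc (inner (e k) (T (e j))).
Proof. by rewrite -adjP' -inner_conj. Qed.

Lemma opnorm_has_sup T :
  has_sup [set l2norm (T u) | u in [set u | l2norm u <= 1]].
Proof.
split; first by exists (l2norm (T 0)); exists 0 => //=; rewrite l2norm0.
have [M M0 TM] := bop_bounded T; exists M => _ [u u1 <-].
by apply: le_trans (TM u) _; rewrite -[leRHS]mulr1 ler_wpM2l.
Qed.

Lemma opnorm_ge0 T : 0 <= opnorm T.
Proof.
apply: le_trans (l2norm_ge0 (T 0)) _; apply: sup_upper_bound.
  exact: opnorm_has_sup.
by exists 0 => //=; rewrite l2norm0.
Qed.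

Lemma opnorm_bound T u : l2norm (T u) <= opnorm T * l2norm u.
Proof.
have [u0|un0] := eqVneq (l2norm u) 0.
  by rewrite (l2norm_eq0 u0) bop_0 l2norm0 mulr0.
have up : 0 < l2norm u by rewrite lt_def un0 l2norm_ge0.
pose c := (l2norm u)^-1%:C%C.
have sc : Num.sqrt (sqmod c) = (l2norm u)^-1.
  by rewrite /sqmod /= expr0n addr0 sqrtr_sqr ger0_norm ?invr_ge0 ?ltW.
rewrite -ler_pdivrMr// mulrC -sc -l2normZ -bop_scale.
apply: sup_upper_bound; first exact: opnorm_has_sup.
by exists (c *: u) => //=; rewrite l2normZ sc mulVf.
Qed.

Lemma opnorm_le T (M : R) : 0 <= M -> (forall u, l2norm (T u) <= M * l2norm u) ->
  opnorm T <= M.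
Proof.
move=> M0 TM; apply: ge_sup; first exact: (opnorm_has_sup T).1.
move=> _ [u u1 <-]; apply: le_trans (TM u) _.
by rewrite -[leRHS]mulr1 ler_wpM2l.
Qed.

Lemma opnormD S T : opnorm (S + T) <= opnorm S + opnorm T.
Proof.
apply: opnorm_le => [|u]; first by rewrite addr_ge0 ?opnorm_ge0.
rewrite bopDE mulrDl; apply: le_trans (l2normD _ _) _.
by apply: lerD; exact: opnorm_bound.
Qed.

Lemma opnormM S T : opnorm (S * T) <= opnorm S * opnorm T.
Proof.
apply: opnorm_le => [|u]; first by rewrite mulr_ge0 ?opnorm_ge0.
rewrite bopME -mulrA; apply: le_trans (opnorm_bound _ _) _.
by apply: ler_wpM2l; [exact: opnorm_ge0|exact: opnorm_bound].
Qed.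

Lemma opnormZ_le a T : opnorm (a *: T) <= Num.sqrt (sqmod a) * opnorm T.
Proof.
apply: opnorm_le => [|u]; first by rewrite mulr_ge0 ?opnorm_ge0 ?sqrtr_ge0.
rewrite bopZE l2normZ -mulrA; apply: ler_wpM2l; first exact: sqrtr_ge0.
exact: opnorm_bound.
Qed.

Lemma opnormN T : opnorm (- T) = opnorm T.
Proof.
have h S : opnorm (- S) <= opnorm S.
  apply: opnorm_le => [|u]; first exact: opnorm_ge0.
  by rewrite bopNE l2normN opnorm_bound.
by apply/eqP; rewrite eq_le h -{1}[T]opprK h.
Qed.

Lemma opnormB S T : opnorm (S - T) = opnorm (T - S).
Proof. by rewrite -opnormN opprB. Qed.

(** With y = [adj T u], |y|^2 = <u, T y> <= |u| |T| |y|; then |y| is cancelled. *)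
Lemma opnorm_adj_le T : opnorm (adj T) <= opnorm T.
Proof.
apply: opnorm_le => [|u]; first exact: opnorm_ge0.
have [u0|un0] := eqVneq (l2norm (adj T u)) 0.
  by rewrite u0 mulr_ge0 ?l2norm_ge0 ?opnorm_ge0.
have up : 0 < l2norm (adj T u) by rewrite lt_def un0 l2norm_ge0.
rewrite -(ler_pM2r up) -expr2.
have := sqmod_inner_le u (T (adj T u)).
rewrite -adjP inner_self {1}/sqmod /= expr0n addr0 sqrtr_sqr ger0_norm ?sqr_ge0//.
move/le_trans; apply; rewrite [X in _ <= X * _]mulrC -mulrA.
by apply: ler_wpM2l; [exact: l2norm_ge0|exact: opnorm_bound].
Qed.

Lemma opnorm_adj T : opnorm (adj T) = opnorm T.
Proof. by apply/eqP; rewrite eq_le opnorm_adj_le -{1}[T]adjK opnorm_adj_le. Qed.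

Lemma opnorm0 : opnorm (0 : bop) = 0.
Proof.
apply/eqP; rewrite eq_le opnorm_ge0 andbT; apply: opnorm_le => // u.
by rewrite mul0r l2norm0.
Qed.

Lemma opnorm_eq0 T : opnorm T = 0 -> T = 0.
Proof.
move=> T0; apply: bop_ext => u; apply: l2norm_eq0; apply/eqP.
by rewrite eq_le l2norm_ge0 andbT (le_trans (opnorm_bound _ _))// T0 mul0r.
Qed.

Lemma norm_cvgP (x_ : nat -> bop) x : norm_cvg x_ x <->
  forall eps, 0 < eps -> exists N, forall n, (N <= n)%N -> opnorm (x_ n - x) < eps.
Proof.
split=> [/cvgrPdist_lt h eps /h [N _ hN]|h].
  exists N => n /hN /=; rewrite sub0r normrN ger0_norm//; exact: opnorm_ge0.
apply/cvgrPdist_lt => eps /h [N hN]; exists N => // n /hN /=.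
by rewrite sub0r normrN ger0_norm//; exact: opnorm_ge0.
Qed.

Lemma norm_cvg_approx (A : set bop) x : (forall eps : R, 0 < eps ->
  exists2 y, A y & opnorm (y - x) <= eps) ->
  exists2 x_ : nat -> bop, (forall n, A (x_ n)) & norm_cvg x_ x.
Proof.
move=> h.
pose x_ n := xget 0 [set y | A y /\ opnorm (y - x) <= n.+1%:R^-1].
have x_P n : A (x_ n) /\ opnorm (x_ n - x) <= n.+1%:R^-1.
  apply: (@xgetPex _ 0 [set y | A y /\ opnorm (y - x) <= n.+1%:R^-1]).
  have n0 : 0 < n.+1%:R^-1 :> R by rewrite invr_gt0 ltr0n.
  by have [y Ay yx] := h _ n0; exists y.
exists x_ => [n|]; first by have [] := x_P n.
apply/norm_cvgP => eps eps0.
have /cvgrPdist_lt/(_ eps eps0)[N _ hN] := @cvg_harmonic R.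
exists N => n /hN /=; rewrite sub0r normrN ger0_norm ?invr_ge0 ?ler0n//.
exact: le_lt_trans (x_P n).2.
Qed.

(** The limit inherits every pair ([eps], [N]) valid for the Cauchy property. This keeps the modulus
    uniform in the vector, as [bop_complete] needs for a limit in operator norm. *)
Lemma ell2_complete (u_ : nat -> ell2) :
  (forall eps, 0 < eps -> exists N, forall m n, (N <= m)%N -> (N <= n)%N ->
     l2norm (u_ m - u_ n) <= eps) ->
  exists u : ell2, forall eps (N : nat), 0 < eps ->
    (forall m n, (N <= m)%N -> (N <= n)%N -> l2norm (u_ m - u_ n) <= eps) ->
    forall n, (N <= n)%N -> l2norm (u_ n - u) <= eps.
Proof.
move=> cu.
have cz k : cvgn (fun n => complex.Re (u_ n k)) /\ cvgn (fun n => complex.Im (u_ n k)).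
  have h eps : 0 < eps -> exists N, forall m n, (N <= m)%N -> (N <= n)%N ->
      `|complex.Re (u_ m k) - complex.Re (u_ n k)| <= eps /\
      `|complex.Im (u_ m k) - complex.Im (u_ n k)| <= eps.
    move=> eps0; have [N hN] := cu _ eps0; exists N => m n Nm Nn.
    have := le_trans (sqmod_le_l2norm (u_ m - u_ n) k)
      (_ : l2norm (u_ m - u_ n) ^+ 2 <= eps ^+ 2).
    rewrite ler_sqr ?nnegrE ?l2norm_ge0 ?(ltW eps0)// => /(_ (hN _ _ Nm Nn)).
    have -> : (u_ m - u_ n) k = u_ m k - u_ n k by [].
    case: (u_ m k) (u_ n k) => [a b] [c d]; rewrite /sqmod /= => h.
    rewrite -!(ler_sqr (_ : `|_| \is Num.nneg)) ?nnegrE ?normr_ge0 ?(ltW eps0)//.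
    rewrite !real_normK ?num_real//.
    have := sqr_ge0 (a - c); have := sqr_ge0 (b - d); split; lra.
  by split; apply/cauchy_cvgP/cauchy_exP => eps eps0;
    have [N hN] := h _ (divr_gt0 eps0 (ltr0Sn R 1));
    [exists (complex.Re (u_ N k))|exists (complex.Im (u_ N k))];
    exists N => // n /= Nn; rewrite /ball /=; have [h1 h2] := hN N n (leqnn N) Nn;
    [apply: le_lt_trans h1 _|apply: le_lt_trans h2 _]; lra.
pose f k := Complex (limn (fun n => complex.Re (u_ n k))) (limn (fun n => complex.Im (u_ n k))).

have cf n k : (fun m => sqmod (u_ n k - u_ m k)) @ \oo --> sqmod (u_ n k - f k).
  have [c1 c2] := cz k.
  have E (z1 z2 : C) : sqmod (z1 - z2) = (complex.Re z1 - complex.Re z2) * (complex.Re z1 - complex.Re z2) +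
      (complex.Im z1 - complex.Im z2) * (complex.Im z1 - complex.Im z2).
    by case: z1 z2 => [? ?] [? ?].
  rewrite E /f /=; under eq_fun do rewrite E.
  by apply: cvgD; apply: cvgM; apply: cvgB => //; exact: cvg_cst.
have cS n K : (fun m => \sum_(k < K) (sqmod (u_ n (Posz k) - u_ m (Posz k)) +
      sqmod (u_ n (Negz k) - u_ m (Negz k)))) @ \oo -->
    \sum_(k < K) (sqmod (u_ n (Posz k) - f (Posz k)) + sqmod (u_ n (Negz k) - f (Negz k))).
  elim: K => [|K IH].
    by rewrite big_ord0; under eq_fun do rewrite big_ord0; exact: cvg_cst.
  rewrite big_ord_recr /=; under eq_fun do rewrite big_ord_recr /=.
  by apply: cvgD => //; apply: cvgD; exact: cf.
(* Fatou for finite sums: the Cauchy bound on each partial sum survives the limit in the second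
   index, before [f] is known to be square summable. *)
have key eps (N : nat) : 0 < eps ->
    (forall m n, (N <= m)%N -> (N <= n)%N -> l2norm (u_ m - u_ n) <= eps) ->
    forall n, (N <= n)%N -> forall K,
    \sum_(k < K) (sqmod (u_ n (Posz k) - f (Posz k)) + sqmod (u_ n (Negz k) - f (Negz k))) <= eps ^+ 2.
  move=> eps0 h n Nn K; rewrite -(cvg_lim (@Rhausdorff R) (cS n K)).
  apply: limr_le; first by apply/cvg_ex; eexists; exact: cS.
  exists N => // m /= Nm; apply: le_trans (_ : l2norm (u_ n - u_ m) ^+ 2 <= _).
    have := sqr_ge0 (l2norm ((u_ n - u_ m) - trunc (u_ n - u_ m) K)).
    by rewrite l2norm_trunc_sub subr_ge0.
  by rewrite ler_sqr ?nnegrE ?l2norm_ge0 ?(ltW eps0)// h.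
have wit eps (N : nat) : 0 < eps ->
    (forall m n, (N <= m)%N -> (N <= n)%N -> l2norm (u_ m - u_ n) <= eps) ->
    forall n, (N <= n)%N -> exists2 w : ell2, (forall k, w k = u_ n k - f k) & l2norm w <= eps.
  move=> eps0 h n Nn.
  have [w wE wn] := @ell2_of_bounded R (fun k => u_ n k - f k) _ (key _ _ eps0 h n Nn).
  by exists w => //; rewrite -ler_sqr ?nnegrE ?l2norm_ge0 ?(ltW eps0).
have [N1 h1] := cu 1 ltr01.
have [w1 w1E _] := wit _ _ ltr01 h1 N1 (leqnn N1).
(* This vector has coordinates [f]; square summability comes from the difference [w1]. *)
exists (u_ N1 - w1) => eps N eps0 h n Nn.
have [w wE wn] := wit _ _ eps0 h n Nn.
rewrite (_ : _ - _ = w)//; apply: ell2_ext => k.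
rewrite wE -[LHS]/(u_ n k - (u_ N1 k - w1 k)) w1E; ring.
Qed.

Lemma bop_complete (T_ : nat -> bop) :
  (forall eps, 0 < eps -> exists N, forall m n, (N <= m)%N -> (N <= n)%N ->
     opnorm (T_ m - T_ n) <= eps) ->
  exists T, norm_cvg T_ T.
Proof.
move=> cT.
have ptw u eps : 0 < eps -> exists N, forall m n, (N <= m)%N -> (N <= n)%N ->
     l2norm (T_ m u - T_ n u) <= eps.
  move=> eps0; have p : 0 < eps / (l2norm u + 1).
    by apply: divr_gt0 => //; rewrite ltr_wpDl ?l2norm_ge0.
  have [N hN] := cT _ p; exists N => m n Nm Nn.
  rewrite -bopBE; apply: le_trans (opnorm_bound _ _) _.
  apply: le_trans (_ : _ <= eps / (l2norm u + 1) * l2norm u) _.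
    by apply: ler_wpM2r; [exact: l2norm_ge0|exact: hN].
  rewrite mulrAC ler_pdivrMr ?ltr_wpDl ?l2norm_ge0//.
  by rewrite mulrDr mulr1 lerDl ltW.
pose lims u := [set v : ell2 | forall eps (N : nat), 0 < eps ->
    (forall m n, (N <= m)%N -> (N <= n)%N -> l2norm (T_ m u - T_ n u) <= eps) ->
    forall n, (N <= n)%N -> l2norm (T_ n u - v) <= eps].
pose f u := xget 0 (lims u).
have fP u : lims u (f u) by apply: xgetPex; exact: ell2_complete (ptw u).
have fcvg u eps : 0 < eps -> exists N, forall n, (N <= n)%N -> l2norm (T_ n u - f u) <= eps.
  by move=> eps0; have [N hN] := ptw u eps eps0; exists N; exact: fP.
have [N1 h1] := cT 1 ltr01.
have fB : f \in @bounded_linear R.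
  rewrite unfold_in; apply/asboolP; split=> [a u v|].
    apply/eqP; rewrite -subr_eq0; apply/eqP/l2norm_small => eps eps0.
    have s0 := sqrtr_ge0 (sqmod a).
    have [q q0 qeps] : exists2 q, 0 < q & q + (Num.sqrt (sqmod a) * q + q) = eps.
      move: (Num.sqrt _) s0 => s s0; have s2 : 0 < s + 2 by lra.
      by exists (eps / (s + 2)); [exact: divr_gt0|field; exact: lt0r_neq0].
    have [A hA] := fcvg u _ q0; have [B hB] := fcvg v _ q0.
    have [D hD] := fcvg (a *: u + v) _ q0.
    pose n := maxn A (maxn B D).
    have {}hA := hA n (leq_maxl _ _).
    have {}hB : l2norm (T_ n v - f v) <= q.
      by apply: hB; rewrite /n; lia.
    have {}hD : l2norm (T_ n (a *: u + v) - f (a *: u + v)) <= q.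
      by apply: hD; rewrite /n; lia.
    have -> : f (a *: u + v) - (a *: f u + f v) =
        - (T_ n (a *: u + v) - f (a *: u + v)) + (a *: (T_ n u - f u) + (T_ n v - f v)).
      rewrite bop_add bop_scale scalerBr opprB.
      by rewrite [X in _ = _ + X]addrACA -opprD addrA subrK.
    apply: le_trans (l2normD _ _) _; rewrite l2normN.
    have h := l2normD (a *: (T_ n u - f u)) (T_ n v - f v).
    rewrite (l2normZ a (T_ n u - f u)) in h.
    have h' := ler_wpM2l s0 hA.
    by rewrite -qeps; exact: lerD hD (le_trans h (lerD h' hB)).
  exists (opnorm (T_ N1) + 1) => u.
  have h : l2norm (T_ N1 u - f u) <= l2norm u.
    apply/ler_addgt0Pr => eps eps0.
    apply: (fP u (l2norm u + eps) N1 _ _ _ (leqnn N1)) => [|m n Nm Nn].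
      by rewrite ltr_wpDl ?l2norm_ge0.
    rewrite -bopBE; apply: le_trans (opnorm_bound _ _) _.
    apply: le_trans (_ : l2norm u <= _); last by rewrite lerDl ltW.
    by rewrite -[leRHS]mul1r; apply: ler_wpM2r; [exact: l2norm_ge0|exact: h1].
  have -> : f u = T_ N1 u - (T_ N1 u - f u) by rewrite opprB addrC subrK.
  apply: le_trans (l2normD _ _) _; rewrite l2normN mulrDl mul1r.
  by apply: lerD => //; exact: opnorm_bound.
exists (Bop fB); apply/norm_cvgP => eps eps0.
have p : 0 < eps / 2 by lra.
have [N hN] := cT _ p; exists N => n Nn.
apply: le_lt_trans (_ : eps / 2 < _); last by lra.
apply: opnorm_le => [|u]; first by lra.
(* The extra [del] keeps the tolerance positive even when [l2norm u] is 0. *)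
rewrite bopBE /=; apply/ler_addgt0Pr => del del0.
apply: (fP u _ N _ _ _ Nn) => [|m k Nm Nk].
  by rewrite ltr_wpDl// mulr_ge0 ?l2norm_ge0// ltW.
rewrite -bopBE; apply: le_trans (opnorm_bound _ _) _.
apply: le_trans (_ : eps / 2 * l2norm u <= _); last by rewrite lerDl ltW.
by apply: ler_wpM2r; [exact: l2norm_ge0|exact: hN].
Qed.

End Operators.

(** * Concrete C*-algebras and *-homomorphisms *)

Section CstarAlgebras.
Variable R : realType.
Local Notation C := (R[i]).
Local Notation ell2 := (ell2 R).
Local Notation bop := (bop R).
Implicit Types (u v w : ell2) (a : C) (x y z : bop) (A G P : set bop).

Lemma norm_cvg_le (x_ y_ : nat -> bop) x y (K : R) :
  (forall n, opnorm (y_ n - y) <= K * opnorm (x_ n - x)) ->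
  norm_cvg x_ x -> norm_cvg y_ y.
Proof.
move=> le_xy /norm_cvgP h; apply/norm_cvgP => eps eps0.
have K0 : 0 < `|K| + 1 by rewrite ltr_wpDl.
have [N hN] := h _ (divr_gt0 eps0 K0); exists N => n /hN.
rewrite ltr_pdivlMr// => /(le_lt_trans _); apply; apply: le_trans (le_xy n) _.
rewrite mulrC; apply: ler_wpM2l; first exact: opnorm_ge0.
by apply: le_trans (ler_norm _) _; rewrite lerDl.
Qed.

Lemma norm_cvg_uniq (x_ : nat -> bop) x y :
  norm_cvg x_ x -> norm_cvg x_ y -> x = y.
Proof.
move=> /norm_cvgP hx /norm_cvgP hy; apply/eqP; rewrite -subr_eq0; apply/eqP.
apply: opnorm_eq0; apply/eqP; rewrite eq_le opnorm_ge0 andbT.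
apply/ler_addgt0Pr => eps eps0; rewrite add0r.
have e2 : 0 < eps / 2 by exact: divr_gt0.
have [N hN] := hx _ e2; have [M hM] := hy _ e2.
have {}hN := hN _ (leq_maxl N M); have {}hM := hM _ (leq_maxr N M).
have -> : x - y = (x_ (maxn N M) - y) - (x_ (maxn N M) - x) by rewrite opprB [RHS]addrC addrA subrK.
apply: le_trans (opnormD _ _) _; rewrite opnormN.
by rewrite [leRHS](splitr eps); apply: lerD; exact: ltW.
Qed.

Lemma norm_cvg_shift (x_ : nat -> bop) x :
  norm_cvg x_ x -> norm_cvg (fun n => x_ n.+1) x.
Proof.
move=> /norm_cvgP h; apply/norm_cvgP => eps /h [N hN].
by exists N => n Nn; apply: hN; exact: leqW.
Qed.

Lemma norm_cvg_adj (x_ : nat -> bop) x :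
  norm_cvg x_ x -> norm_cvg (fun n => adj (x_ n)) (adj x).
Proof. by apply: (@norm_cvg_le _ _ _ _ 1) => n; rewrite -adjB opnorm_adj mul1r. Qed.

Lemma norm_cvgMl (x_ : nat -> bop) x y :
  norm_cvg x_ x -> norm_cvg (fun n => y * x_ n) (y * x).
Proof. by apply: (@norm_cvg_le _ _ _ _ (opnorm y)) => n; rewrite -mulrBr opnormM. Qed.

Lemma norm_cvgMr (x_ : nat -> bop) x y :
  norm_cvg x_ x -> norm_cvg (fun n => x_ n * y) (x * y).
Proof.
by apply: (@norm_cvg_le _ _ _ _ (opnorm y)) => n; rewrite -mulrBl mulrC opnormM.
Qed.

Lemma norm_cvg_contract (f : bop -> bop) (x_ : nat -> bop) x :
  (forall n, opnorm (f (x_ n) - f x) <= opnorm (x_ n - x)) ->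
  norm_cvg x_ x -> norm_cvg (fun n => f (x_ n)) (f x).
Proof. by move=> h; apply: (@norm_cvg_le _ _ _ _ 1) => n; rewrite mul1r. Qed.

Definition closed_subspace A : Prop :=
  [/\ A 0,
      forall a x y, A x -> A y -> A (a *: x + y)
    & forall (x_ : nat -> bop) x, (forall n, A (x_ n)) -> norm_cvg x_ x -> A x].

Definition closed_span G : set bop := smallest closed_subspace G.

Lemma closed_spanP G : closed_subspace (closed_span G).
Proof.
split=> [B [[B0 _ _] _]//|a x y Ax Ay B BG|x_ x Ax_ xx B BG].
  by have [[_ lin _] _] := BG; apply: lin; [exact: Ax|exact: Ay].
by have [[_ _ cl] _] := BG; apply: (cl x_) => // n; exact: Ax_.
Qed.

Lemma cstar_genP G : cstar_algebra (cstar_gen G).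
Proof.
split=> [B [[B0 _ _] _]//|a x y Ax Ay B BG|x y Ax Ay B BG|x Ax B BG|x_ x Ax_ xx B BG].
- by have [[_ lin _ _ _] _] := BG; apply: lin; [exact: Ax|exact: Ay].
- by have [[_ _ mul _ _] _] := BG; apply: mul; [exact: Ax|exact: Ay].
- by have [[_ _ _ ad _] _] := BG; apply: ad; exact: Ax.
- by have [[_ _ _ _ cl] _] := BG; apply: (cl x_) => // n; exact: Ax_.
Qed.

Lemma cstar_gen_mem G : G `<=` cstar_gen G.
Proof. exact: sub_gen_smallest. Qed.

Lemma cstar_gen_sub G A : cstar_algebra A -> G `<=` A -> cstar_gen G `<=` A.
Proof. exact: smallest_sub. Qed.

Lemma cstar_subspace A : cstar_algebra A -> closed_subspace A.
Proof. by case. Qed.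

Lemma subspaceD A x y : closed_subspace A -> A x -> A y -> A (x + y).
Proof. by case=> _ lin _ Ax Ay; rewrite -[x]scale1r; exact: lin. Qed.

Lemma subspaceZ A a x : closed_subspace A -> A x -> A (a *: x).
Proof. by case=> A0 lin _ Ax; rewrite -[_ *: _]addr0; exact: lin. Qed.

Lemma subspaceB A x y : closed_subspace A -> A x -> A y -> A (x - y).
Proof.
by move=> sA Ax Ay; apply: subspaceD => //; rewrite -scaleN1r; exact: subspaceZ.
Qed.

Lemma subspace_approx A x : closed_subspace A -> (forall eps : R, 0 < eps ->
  exists2 y, A y & opnorm (y - x) <= eps) -> A x.
Proof. by case=> _ _ cl /norm_cvg_approx [x_ Ax_ xx]; exact: cl xx. Qed.

(** For properties that are linear and norm closed but not multiplicative: the closed span of a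
    multiplicative self-adjoint set [P] is already a C*-algebra, so checking the elements of [P] is
    enough. *)
Lemma cstar_gen_sub_span G P A : closed_subspace A ->
  (forall x y, P x -> P y -> P (x * y)) -> (forall x, P x -> P (adj x)) ->
  G `<=` P -> P `<=` A -> cstar_gen G `<=` A.
Proof.
move=> sA PM Padj GP PA.
have memP : P `<=` closed_span P by exact: sub_gen_smallest.
have [B0 Blin Bcl] := closed_spanP P.
have BA : closed_span P `<=` A by exact: smallest_sub.
apply: subset_trans BA; apply: cstar_gen_sub; last exact: subset_trans memP.
(* Products enter the span in two passes: first the left factor is in [P] and the right one varies
   by linearity and closure, then the left factor varies. *)
have lmul x : P x -> closed_span P `<=` [set y | closed_span P (x * y)].
  move=> Px; apply: smallest_sub => [|y Py]; last by apply: memP; exact: PM.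
  split=> [|a y z By Bz|y_ y By_ yy] /=; first by rewrite mulr0.
    by rewrite mulrDr -scalerAr; exact: Blin.
  by apply: Bcl By_ _; exact: norm_cvgMl.
have mul y : closed_span P y -> closed_span P `<=` [set x | closed_span P (x * y)].
  move=> By; apply: smallest_sub => [|x Px]; last exact: lmul.
  split=> [|a x z Bx Bz|x_ x Bx_ xx] /=; first by rewrite mul0r.
    by rewrite mulrDl -scalerAl; exact: Blin.
  by apply: Bcl Bx_ _; exact: norm_cvgMr.
have ad : closed_span P `<=` [set x | closed_span P (adj x)].
  apply: smallest_sub => [|x Px]; last by apply: memP; exact: Padj.
  split=> [|a x z Bx Bz|x_ x Bx_ xx] /=; first by rewrite adj0.
    by rewrite adjD adjZ; exact: Blin.
  by apply: Bcl Bx_ _; exact: norm_cvg_adj.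
by split=> // x y Bx By; exact: mul By _ Bx.
Qed.

(** The element [1 - y] is a square root of [1 - t], since (1 - y)^2 = 1 - t unfolds to y = (t +
    y^2)/2. The map on the right preserves the ball of radius [c] and contracts it with ratio [c],
    so Banach iteration from 0 converges inside [A]. *)
Lemma sqrt_one_sub A t (c : R) : cstar_algebra A -> A t -> adj t = t ->
  opnorm t <= c -> c < 1 ->
  exists y, [/\ A y, adj y = y & y = (2%:R^-1 : C) *: (t + y * y)].
Proof.
move=> cA At tt tc c1; have [A0 Alin AM _ Acl] := cA.
have c0 : 0 <= c by exact: le_trans (opnorm_ge0 t) tc.
pose g y := (2%:R^-1 : C) *: (t + y * y).
have half z : opnorm ((2%:R^-1 : C) *: z) <= 2^-1 * opnorm z.
  apply: le_trans (opnormZ_le _ _) _; apply: ler_wpM2r; first exact: opnorm_ge0.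
  have -> : (2%:R^-1 : C) = (2^-1 : R)%:C%C.
    rewrite [RHS](fmorphV (real_complex R)). by rewrite (rmorph_nat (real_complex R)).
  by rewrite /sqmod /= expr0n addr0 sqrtr_sqr ger0_norm// invr_ge0.
have gc y : opnorm y <= c -> opnorm (g y) <= c.
  move=> yc; apply: le_trans (half _) _.
  have h : opnorm (t + y * y) <= c + c * c.
    apply: le_trans (opnormD _ _) _; apply: lerD => //.
    by apply: le_trans (opnormM _ _) _; apply: ler_pM => //; exact: opnorm_ge0.
  have : c * c <= c by rewrite -[leRHS]mulr1; apply: ler_wpM2l => //; exact: ltW.
  by move: (opnorm _) h => n h; lra.
(* [K] is separate from [c] because the final step compares the iterates with their limit, bounded
   there by its own norm. *)
have gl (K : R) y z : opnorm y <= c -> opnorm z <= K ->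
    opnorm (g y - g z) <= 2^-1 * (c + K) * opnorm (y - z).
  move=> yc zc; rewrite /g -scalerBr -mulrA; apply: le_trans (half _) _.
  apply: ler_wpM2l; first by rewrite invr_ge0.
  have -> : t + y * y - (t + z * z) = y * (y - z) + (y - z) * z.
    by rewrite opprD addrACA subrr add0r mulrBr mulrBl addrA subrK.
  apply: le_trans (opnormD _ _) _; rewrite [leRHS]mulrDl; apply: lerD.
    by apply: le_trans (opnormM _ _) _; apply: ler_wpM2r => //; exact: opnorm_ge0.
  apply: le_trans (opnormM _ _) _; rewrite [leLHS]mulrC.
  by apply: ler_wpM2r => //; exact: opnorm_ge0.
pose y_ n := iter n g 0.
have yc n : opnorm (y_ n) <= c.
  by elim: n => [|n IH]; [rewrite /y_ /= opnorm0|exact: gc].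
have yA n : A (y_ n).
  elim: n => [|n IH] //=; apply: subspaceZ; first exact: cstar_subspace.
  by apply: subspaceD; [exact: cstar_subspace|by []|exact: AM].
have ysa n : adj (y_ n) = y_ n.
  elim: n => [|n IH] /=; first exact: adj0.
  by rewrite /g adjZ adjD adjM IH tt fmorphV rmorph_nat.
(* Two points of the ball differ by at most [c + c], and [N] common iterations each contribute a
   factor [c]. *)
have geo N m n : opnorm (y_ (N + m)%N - y_ (N + n)%N) <= c ^+ N * (c + c).
  elim: N => [|N IH].
    by rewrite expr0 mul1r; apply: le_trans (opnormD _ _) _; rewrite opnormN lerD.
  rewrite !addSn exprS -mulrA; apply: le_trans (gl c _ _ (yc _) (yc _)) _.
  have -> : 2^-1 * (c + c) = c by lra.
  exact: ler_wpM2l.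
have [y yy] : exists y, norm_cvg y_ y.
  apply: bop_complete => eps eps0.
  have /cvgrPdist_lt h := @cvg_expr R c (ltac:(by rewrite ger0_norm)).
  have d : 0 < eps / (c + c + 1) by apply: divr_gt0 => //; rewrite ltr_wpDl// addr_ge0.
  have [N _ hN] := h _ d; exists N => m n Nm Nn.
  have := hN N (leqnn N); rewrite /= sub0r normrN ger0_norm ?exprn_ge0// => cN.
  rewrite -(subnKC Nm) -(subnKC Nn); apply: le_trans (geo _ _ _) _.
  apply: le_trans (_ : eps / (c + c + 1) * (c + c) <= _).
    by apply: ler_wpM2r; [exact: addr_ge0|exact: ltW].
  rewrite mulrAC ler_pdivrMr ?ltr_wpDl ?addr_ge0//.
  by rewrite [leRHS]mulrDr mulr1 lerDl ltW.
exists y; split; first exact: Acl yy.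
  have := norm_cvg_adj yy; have -> : (fun n => adj (y_ n)) = y_ by apply: funext.
  by move=> h; exact: norm_cvg_uniq h yy.
apply: norm_cvg_uniq (norm_cvg_shift yy) _.
apply: (@norm_cvg_le y_ _ y _ (2^-1 * (c + opnorm y))) => // n.
exact: gl.
Qed.

Section StarHom.
Variables (A : set bop) (f : bop -> bop).
Hypotheses (cA : cstar_algebra A) (fA : star_hom A f).

Lemma star_hom0 : f 0 = 0.
Proof.
have [A0 _ _ _ _] := cA; have [lin _ _] := fA.
have h := lin 1 0 0 A0 A0; rewrite !scale1r addr0 in h.
by apply: (addrI (f 0)); rewrite addr0 -h.
Qed.

Lemma star_homD x y : A x -> A y -> f (x + y) = f x + f y.
Proof. by have [lin _ _] := fA => Ax Ay; have := lin 1 x y Ax Ay; rewrite !scale1r. Qed.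

Lemma star_homZ a x : A x -> f (a *: x) = a *: f x.
Proof.
have [A0 _ _ _ _] := cA; have [lin _ _] := fA => Ax.
by have := lin a x 0 Ax A0; rewrite star_hom0 !addr0.
Qed.

Lemma star_homB x y : A x -> A y -> f (x - y) = f x - f y.
Proof.
move=> Ax Ay; have ANy : A (-1 *: y) by apply: subspaceZ => //; exact: cstar_subspace.
by rewrite -[in LHS]scaleN1r star_homD// star_homZ// scaleN1r.
Qed.

(* For [c < 1] and [t = x^* x / r^2], the element [1 - t] is a square [k^2] of
   a self-adjoint [k] in [A], so that [f (x^* x / r^2) <= f 1 <= 1]. *)
Lemma star_hom_contract x : A 1 -> A x -> opnorm (f x) <= opnorm x.
Proof.
move=> A1 Ax; have [_ fM fadj] := fA; have [A0 _ AM Aadj _] := cA.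
have sA := cstar_subspace cA.
apply/ler_addgt0Pr => eps eps0; set r := opnorm x + eps.
have r0 : 0 < r by rewrite ltr_wpDl ?opnorm_ge0.
apply: opnorm_le; first exact: ltW.
pose h := (r^-1)%:C%C *: x; have Ah : A h by exact: subspaceZ.
have fhE : f x = r%:C%C *: f h.
  by rewrite star_homZ// scalerA -rmorphM mulfV ?gt_eqF// rmorph1 scale1r.
have b1 : r^-1 * opnorm x < 1 by rewrite mulrC ltr_pdivrMr// mul1r ltrDl.
have b0 : 0 <= r^-1 * opnorm x by rewrite mulr_ge0 ?opnorm_ge0// invr_ge0 ltW.
have hb : opnorm h <= r^-1 * opnorm x.
  apply: le_trans (opnormZ_le _ _) _; rewrite /sqmod /= expr0n addr0 sqrtr_sqr.
  by rewrite ger0_norm// invr_ge0 ltW.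
pose t := adj h * h; have At : A t by apply: AM => //; exact: Aadj.
have tsa : adj t = t by rewrite adjM adjK.
have tb : opnorm t <= (r^-1 * opnorm x) * (r^-1 * opnorm x).
  apply: le_trans (opnormM _ _) _; rewrite opnorm_adj.
  by apply: ler_pM => //; exact: opnorm_ge0.
have c1 : (r^-1 * opnorm x) * (r^-1 * opnorm x) < 1 by rewrite mulr_ilt1.
have [y [Ay ysa yE]] := sqrt_one_sub cA At tsa tb c1.
pose k := 1 - y; have Ak : A k by exact: subspaceB.
have kk : adj k * k = 1 - t.
  rewrite /k adjB adj1 ysa mulrBl mul1r mulrBr mulr1.
  have -> : t = y + y - y * y.
    have E : y + y = t + y * y.
      have h2 : 2%:R^-1 + 2%:R^-1 = 1 :> C by field.
      by rewrite {1 2}yE -scalerDl h2 scale1r.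
    by rewrite E addrK.
  by rewrite -addrA -opprD [y + (y - _)]addrA.
(* [f] may fail to be unital, but [f 1] is a projection and hence a contraction, which is what
   bounds [f h]. *)
have p1 : adj (f 1) * f 1 = f 1 by rewrite -fadj// adj1 -fM// mulr1.
have fkk : adj (f k) * f k = f 1 - adj (f h) * f h.
  rewrite -!fadj// -!fM//; try exact: Aadj.
  by rewrite kk star_homB.
move=> u.
have E S : inner u ((adj S * S) u) = (l2norm (S u) ^+ 2)%:C%C.
  by rewrite bopME -adjP' inner_self.
have e1 : l2norm (f k u) ^+ 2 = l2norm (f 1 u) ^+ 2 - l2norm (f h u) ^+ 2.
  have : (l2norm (f k u) ^+ 2)%:C%C =
      (l2norm (f 1 u) ^+ 2)%:C%C - (l2norm (f h u) ^+ 2)%:C%C.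
    by rewrite -(E (f k)) -(E (f 1)) -(E (f h)) p1 -innerBr fkk bopBE.
  by rewrite -rmorphB => /complexI.
have e2 : l2norm (f 1 u) <= l2norm u.
  have [p0|pn0] := eqVneq (l2norm (f 1 u)) 0; first by rewrite p0 l2norm_ge0.
  have pp : 0 < l2norm (f 1 u) by rewrite lt_def pn0 l2norm_ge0.
  rewrite -(ler_pM2r pp) -expr2.
  have := sqmod_inner_le u (f 1 u).
  rewrite -{1}p1 E /sqmod /= expr0n addr0 sqrtr_sqr ger0_norm ?sqr_ge0//.
have e3 : l2norm (f h u) <= l2norm (f 1 u).
  by rewrite -ler_sqr ?nnegrE ?l2norm_ge0// -subr_ge0 -e1 sqr_ge0.
rewrite fhE bopZE l2normZ /sqmod /= expr0n addr0 sqrtr_sqr ger0_norm ?(ltW r0)//.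
by apply: ler_wpM2l; [exact: ltW|exact: le_trans e2].
Qed.

End StarHom.

(** The agreement set is a C*-algebra, norm closed because both maps are contractive. Membership in
    [cstar_gen G] is carried along since the maps are constrained only there. *)
Lemma star_hom_eq G f g : cstar_gen G 1 -> star_hom (cstar_gen G) f ->
  star_hom (cstar_gen G) g -> (forall x, G x -> f x = g x) ->
  forall x, cstar_gen G x -> f x = g x.
Proof.
move=> G1 hf hg fg; have cG := cstar_genP G.
have [flin fM fadj] := hf; have [glin gM gadj] := hg.
suff : cstar_gen G `<=` [set x | cstar_gen G x /\ f x = g x] by move=> h x Gx; have [] := h x Gx.
apply: cstar_gen_sub => [|x Gx]; last by split; [exact: cstar_gen_mem|exact: fg].
have [A0 Alin AM Aadj Acl] := cG; have sG := cstar_subspace cG.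
split=> [|a x y [Ax fx] [Ay fy]|x y [Ax fx] [Ay fy]|x [Ax fx]|x_ x Ax_ xx].
- by split => //; rewrite (star_hom0 cG hf) (star_hom0 cG hg).
- split; first exact: Alin.
  by rewrite flin// glin// fx fy.
- by split; [exact: AM|rewrite fM// gM// fx fy].
- by split; [exact: Aadj|rewrite fadj// gadj// fx].
have Ax : cstar_gen G x by apply: Acl xx => n; have [] := Ax_ n.
split => //.
have cvg k : star_hom (cstar_gen G) k -> norm_cvg (fun n => k (x_ n)) (k x).
  move=> hk; apply: norm_cvg_contract xx => n.
  rewrite -(star_homB cG hk)//; last by have [] := Ax_ n.
  by apply: (star_hom_contract cG hk) => //; apply: (subspaceB sG) => //; have [] := Ax_ n.
have := cvg _ hf; have -> : (fun n => f (x_ n)) = (fun n => g (x_ n)).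
  by apply: funext => n; have [] := Ax_ n.
by move=> h; exact: norm_cvg_uniq h (cvg _ hg).
Qed.

Lemma star_hom_conj A (u : bop) : unitary u -> star_hom A (fun x => u * x * adj u).
Proof.
move=> [uu _]; split=> [a x y _ _|x y _ _|x _].
- by rewrite mulrDr mulrDl -scalerAr -scalerAl.
- by rewrite !mulrA -(mulrA (u * x) (adj u)) uu mulr1.
- by rewrite !adjM adjK mulrA.
Qed.

End CstarAlgebras.

(** * Diagonal operators and the algebra D2 *)

Section Diagonal.
Variable R : realType.
Local Notation C := (R[i]).
Local Notation ell2 := (ell2 R).
Local Notation bop := (bop R).
Local Notation e := (delta R).
Local Notation U := (U R).
Local Notation S2 := (S2 R).
Local Notation S_ := (S_ R).
Local Notation D2 := (D2 R).
Implicit Types (u v w : ell2) (a b : C) (x y z : bop) (f g : int -> C).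

(** The modulus as a real number; the norm on [R[i]] takes its values in [R[i]]. *)
Definition modc (z : C) : R := Num.sqrt (sqmod z).

Lemma modc_ge0 a : 0 <= modc a. Proof. exact: sqrtr_ge0. Qed.
Lemma modc0 : modc 0 = 0. Proof. by rewrite /modc sqmod0 sqrtr0. Qed.
Lemma modcM a b : modc (a * b) = modc a * modc b.
Proof. by rewrite /modc sqmodM sqrtrM// sqmod_ge0. Qed.
Lemma modc_conj a : modc (conjc a) = modc a.
Proof. by rewrite /modc sqmod_conj. Qed.
Lemma modc_real (r : R) : 0 <= r -> modc r%:C%C = r.
Proof. by move=> r0; rewrite /modc /sqmod /= expr0n addr0 sqrtr_sqr ger0_norm. Qed.
Lemma modc1 : modc 1 = 1. Proof. exact: modc_real. Qed.

Lemma modcD a b : modc (a + b) <= modc a + modc b.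
Proof.
have := l2normD (a *: e 0) (b *: e 0).
by rewrite -scalerDl !l2normZ l2norm_delta !mulr1.
Qed.

Lemma modcN a : modc (- a) = modc a.
Proof. by rewrite /modc; case: a => p q; rewrite /sqmod /= !sqrrN. Qed.

Lemma modcB a b : modc (a - b) = modc (b - a).
Proof. by rewrite -modcN opprB. Qed.

Lemma modcB_le a b c : modc (a - c) <= modc (a - b) + modc (b - c).
Proof. by apply: le_trans (modcD _ _); rewrite addrA subrK. Qed.

Lemma modc_sum n (F : nat -> C) : modc (\sum_(k < n) F k) <= \sum_(k < n) modc (F k).
Proof.
elim: n => [|n IH]; first by rewrite !big_ord0 modc0.
by rewrite !big_ord_recr /=; apply: le_trans (modcD _ _) _; rewrite lerD2r.
Qed.

Lemma modc_eq0 a : (forall eps : R, 0 < eps -> modc a <= eps) -> a = 0.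
Proof.
move=> h; have : modc a <= 0 by apply/ler_addgt0Pr => eps /h; rewrite add0r.
rewrite le_eqVlt ltNge modc_ge0 orbF /modc sqrtr_eq0 /sqmod; case: a {h} => p q /= pq.
by have [-> ->] : p = 0 /\ q = 0 by split; nra.
Qed.

Lemma norm1P a : `|a| = 1 <-> conjc a * a = 1.
Proof.
rewrite mulrC -sqr_normc; split=> [->|/eqP]; first by rewrite expr1n.
by rewrite sqrf_eq1 => /orP[/eqP//|/eqP h]; have := normr_ge0 a; rewrite h oppr_ge0 ler10.
Qed.

Lemma modc_unimod a : conjc a * a = 1 -> modc a = 1.
Proof.
move=> h; have := modc1; rewrite -h modcM modc_conj => /eqP.
rewrite -expr2 sqrf_eq1 => /orP[/eqP//|/eqP h1].
by have := modc_ge0 a; rewrite h1 ler0N1.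
Qed.

Lemma entry_le x j k : modc (x (e k) j) <= opnorm x.
Proof.
rewrite -inner_delta; apply: le_trans (sqmod_inner_le _ _) _.
rewrite l2norm_delta mul1r; apply: le_trans (opnorm_bound _ _) _.
by rewrite l2norm_delta mulr1.
Qed.

Lemma adj_entryE x j k : adj x (e k) j = conjc (x (e j) k).
Proof. by rewrite -!inner_delta adj_entry. Qed.

Definition isdiag x f := forall k, x (e k) = f k *: e k.

Lemma isdiag_ext x f g : f =1 g -> isdiag x f -> isdiag x g.
Proof. by move=> fg xf k; rewrite xf fg. Qed.

Lemma isdiag_inj x y f g : isdiag x f -> isdiag y g -> f =1 g -> x = y.
Proof. by move=> xf yg fg; apply: bop_ext_delta => k; rewrite xf yg fg. Qed.

Lemma isdiag_diag x f k : isdiag x f -> diag x k = f k.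
Proof. by move=> xf; rewrite /diag xf innerZr inner_delta deltaE eqxx mulr1. Qed.

Lemma isdiag_uniq x f g : isdiag x f -> isdiag x g -> f =1 g.
Proof. by move=> xf xg k; rewrite -(isdiag_diag k xf) (isdiag_diag k xg). Qed.

Lemma diagE x k : diag x k = x (e k) k.
Proof. by rewrite /diag inner_delta. Qed.

Lemma isdiag_of_offdiag x : (forall j k, j != k -> x (e k) j = 0) -> isdiag x (diag x).
Proof.
move=> h k; apply: ell2_ext => j; rewrite ell2ZE deltaE diagE.
by have [->|jk] := eqVneq j k; [rewrite mulr1|rewrite mulr0 h].
Qed.

Lemma isdiag_offdiag x f j k : isdiag x f -> j != k -> x (e k) j = 0.
Proof. by move=> xf /negPf jk; rewrite xf ell2ZE deltaE jk mulr0. Qed.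

Lemma isdiagM x y f g : isdiag x f -> isdiag y g -> isdiag (x * y) (fun k => f k * g k).
Proof. by move=> xf yg k; rewrite bopME yg bop_scale xf scalerA mulrC. Qed.

Lemma isdiag_lin a x y f g : isdiag x f -> isdiag y g ->
  isdiag (a *: x + y) (fun k => a * f k + g k).
Proof. by move=> xf yg k; rewrite bopDE bopZE xf yg scalerA -scalerDl. Qed.

Lemma isdiag0 : isdiag 0 (fun _ => 0).
Proof. by move=> k; rewrite scale0r. Qed.

Lemma isdiag1 : isdiag 1 (fun _ => 1).
Proof. by move=> k; rewrite scale1r. Qed.

Lemma isdiagD x y f g : isdiag x f -> isdiag y g -> isdiag (x + y) (fun k => f k + g k).
Proof. by move=> xf yg k; rewrite bopDE xf yg -scalerDl. Qed.

Lemma isdiag_adj x f : isdiag x f -> isdiag (adj x) (fun k => conjc (f k)).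
Proof.
move=> xf k; apply: ell2_ext => j; rewrite adj_entryE xf !ell2ZE !deltaE.
by have [->|jk] := eqVneq j k; rewrite /= ?mulr1 ?mulr0 ?conjc0.
Qed.

Lemma isdiag_le x f k : isdiag x f -> modc (f k) <= opnorm x.
Proof. by move=> xf; have := entry_le x k k; rewrite -diagE (isdiag_diag k xf). Qed.

(** Coordinate [k] is read through [adj x (e k)], so values on the basis suffice and [u] is never
    expanded. *)
Lemma isdiagE x f u k : isdiag x f -> x u k = f k * u k.
Proof.
move=> xf; rewrite -[LHS]inner_delta -adjP (isdiag_adj xf).
by rewrite innerZl conjcK inner_delta.
Qed.

Lemma diag_sqnorm_le f (M : R) (h : int -> C) : 0 <= M -> (forall k, modc (f k) <= M) ->
  (sqnorm (fun k => (f k * h k)%R) <= (M ^+ 2)%:E * sqnorm h)%E.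
Proof.
move=> M0 fM; rewrite /sqnorm -esumZl ?sqr_ge0//; last by move=> k; exact: sqmod_ge0.
apply: le_esum => k _; rewrite lee_fin sqmodM; apply: ler_wpM2r; first exact: sqmod_ge0.
by rewrite -[sqmod (f k)]sqr_sqrtr ?sqmod_ge0// ler_sqr ?nnegrE ?sqrtr_ge0//; exact: fM.
Qed.

Lemma isdiag_opnorm x f (M : R) : isdiag x f -> 0 <= M -> (forall k, modc (f k) <= M) ->
  opnorm x <= M.
Proof.
move=> xf M0 fM; apply: opnorm_le => // u.
rewrite -ler_sqr ?nnegrE ?mulr_ge0 ?l2norm_ge0// exprMn !l2normK.
rewrite -lee_fin EFinM !sqnorm_fin.
have -> : (x u : int -> C) = fun k => f k * u k.
  by apply: funext => k; exact: isdiagE.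
exact: diag_sqnorm_le.
Qed.

Lemma isdiag_exists f (M : R) : (forall k, modc (f k) <= M) -> exists x, isdiag x f.
Proof.
move=> fM; have M0 : 0 <= M by exact: le_trans (modc_ge0 _) (fM 0).
have fin u : (fun k => f k * u k) \in @sqsummable R.
  rewrite unfold_in; apply/asboolP; apply: le_lt_trans (diag_sqnorm_le u M0 fM) _.
  by apply: lte_mul_pinfty; rewrite ?lee_fin ?sqr_ge0// ell2P.
pose T u := Ell2 (fin u).
have TB : T \in @bounded_linear R.
  rewrite unfold_in; apply/asboolP; split=> [a u v|].
    by apply: ell2_ext => k; rewrite ell2DE ell2ZE /= mulrDr mulrCA.
  exists M => u; rewrite -ler_sqr ?nnegrE ?mulr_ge0 ?l2norm_ge0// exprMn !l2normK.
  by rewrite -lee_fin EFinM !sqnorm_fin; exact: diag_sqnorm_le.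
exists (Bop TB) => k; apply: ell2_ext => j; rewrite ell2ZE /=.
by have [->//|_] := eqVneq j k; rewrite !mulr0.
Qed.

Lemma isdiag_unitary x f : isdiag x f -> (forall k, conjc (f k) * f k = 1) -> unitary x.
Proof.
move=> xf f1; have xf' := isdiag_adj xf; split.
  by apply: isdiag_inj (isdiagM xf' xf) isdiag1 _ => k; rewrite f1.
by apply: isdiag_inj (isdiagM xf xf') isdiag1 _ => k; rewrite mulrC f1.
Qed.

Lemma unitary_isdiag x f k : unitary x -> isdiag x f -> conjc (f k) * f k = 1.
Proof.
move=> [h _] xf; have := isdiagM (isdiag_adj xf) xf; rewrite h => h1.
exact: (isdiag_uniq h1 isdiag1 k).
Qed.

Definition half (k : int) : int := (k %/ 2)%Z.

Lemma halfP (k : int) : exists i : bool, k = 2 * half k + i%:Z.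
Proof.
have [h|h] : k = 2 * (k %/ 2)%Z \/ k = 2 * (k %/ 2)%Z + 1 by lia.
  by exists false; rewrite addr0.
by exists true.
Qed.

Lemma halfE (k : int) (i : bool) : half (2 * k + i%:Z) = k.
Proof. by rewrite /half; case: i; lia. Qed.

Lemma adjU_delta k : adj U (e k) = e (k - 1).
Proof.
apply: ell2_ext => j; rewrite adj_entryE U_delta !deltaE -subr_eq eq_sym.
by case: (j == _); rewrite ?conjc1 ?conjc0.
Qed.

Lemma unitaryU : unitary U.
Proof.
by split; apply: bop_ext_delta => k; rewrite bopME ?U_delta adjU_delta ?U_delta
  ?subrK ?addrK.
Qed.

Lemma S_delta i k : S_ i (e k) = e (2 * k + i%:Z).
Proof.
case: i; first by rewrite -[S_ true]/(U * S2) bopME S2_delta U_delta.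
by rewrite -[S_ false]/S2 S2_delta addr0.
Qed.

Lemma adjS_delta i k :
  adj (S_ i) (e k) = if k == 2 * half k + i%:Z then e (half k) else 0.
Proof.
apply: ell2_ext => j; rewrite adj_entryE S_delta !deltaE.
have [j'|] := eqVneq k (2 * j + i%:Z).
  by rewrite j' halfE eqxx deltaE eqxx conjc1.
move=> kj; rewrite conjc0; case: eqP => // k'; rewrite deltaE.
by have [jk|//] := eqVneq j (half k); rewrite jk -k' eqxx in kj.
Qed.

Lemma adjS_S i j : adj (S_ i) * S_ j = (i == j)%:R.
Proof.
apply: bop_ext_delta => k; rewrite bopME S_delta adjS_delta halfE.
rewrite (inj_eq (addrI _)); have [->|ij] := eqVneq i j; first by rewrite eqxx.
by case: i j ij => [] [].
Qed.

Lemma isdiag_conjS i x f : isdiag x f -> isdiag (S_ i * x * adj (S_ i))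
  (fun k => if k == 2 * half k + i%:Z then f (half k) else 0).
Proof.
move=> xf k; rewrite 2!bopME adjS_delta; case: ifP => [/eqP k'|_].
  by rewrite xf bop_scale S_delta -k'.
by rewrite !bop_0 scale0r.
Qed.

Lemma isdiag_phi x f : isdiag x f -> isdiag (phi x) (fun k => f (half k)).
Proof.
move=> xf; apply: isdiag_ext (isdiagD (isdiag_conjS true xf) (isdiag_conjS false xf)).
move=> k /=; have [i ki] := halfP k; rewrite {1 4}ki !(inj_eq (addrI _)).
by case: i {ki} => /=; rewrite ?addr0 ?add0r.
Qed.

Lemma isdiag_iter_phi n x f : isdiag x f ->
  isdiag (iter n (@phi R) x) (fun k => f (iter n half k)).
Proof.
move=> xf; elim: n => [|n IH] //=; apply: isdiag_ext (isdiag_phi IH) => k.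
by rewrite -iterSr.
Qed.

Lemma isdiag_prod n (x_ : nat -> bop) (f_ : nat -> int -> C) :
  (forall j, isdiag (x_ j) (f_ j)) ->
  isdiag (\prod_(j < n) x_ j) (fun k => \prod_(j < n) f_ j k).
Proof.
move=> h; elim: n => [|n IH].
  by rewrite big_ord0; apply: isdiag_ext isdiag1 => k; rewrite big_ord0.
rewrite big_ord_recr; apply: isdiag_ext (isdiagM IH (h n)) => k.
by rewrite big_ord_recr.
Qed.

(** Indicator of the residue class of [r] modulo 2^l, a ball of the 2-adic metric. *)
Definition ind (l : nat) (r k : int) : C := ((2 ^+ l %| k - r)%Z)%:R.

(** Prefixing a binary digit: [2 h + j] is congruent to [2 r + i] modulo 2^(l+1) exactly when the
    digits agree and [h] is congruent to [r] modulo 2^l. *)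
Lemma ind_half l r (i : bool) k :
  (if k == 2 * half k + i%:Z then ind l r (half k) else 0) = ind l.+1 (2 * r + i%:Z) k.
Proof.
rewrite /ind; have [j] := halfP k; move: (half k) => h ->.
rewrite (inj_eq (addrI _)) exprS; have [->|ij] := eqVneq (j%:Z : int) i%:Z.
  have -> : 2 * h + i%:Z - (2 * r + i%:Z) = 2 * (h - r) by ring.
  by rewrite dvdz_mul2l.
case: dvdzP => // -[q]; move: (2 ^+ l : int) => p E.
by exfalso; case: i j ij E => [] [] // _ /=; nia.
Qed.

Lemma P_word_cons i al : P_word R (i :: al) = S_ i * P_word R al * adj (S_ i).
Proof. by rewrite /P_word /S_word big_cons adjM !mulrA. Qed.

Lemma P_word_nil : P_word R [::] = 1.
Proof. by rewrite /P_word /S_word big_nil adj1 mulr1. Qed.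

(** A word spells the binary digits of the class, its first letter being the least significant
    one. *)
Lemma P_word_class al : exists r, isdiag (P_word R al) (ind (size al) r).
Proof.
elim: al => [|i al [r IH]].
  exists 0; rewrite P_word_nil; apply: isdiag_ext isdiag1 => k.
  by rewrite /ind expr0 dvd1z.
exists (2 * r + i%:Z); rewrite P_word_cons.
by apply: isdiag_ext (isdiag_conjS i IH) => k; rewrite ind_half.
Qed.

Lemma class_P_word l r : exists al, isdiag (P_word R al) (ind l r).
Proof.
elim: l r => [|l IH] r.
  exists [::]; rewrite P_word_nil; apply: isdiag_ext isdiag1 => k.
  by rewrite /ind expr0 dvd1z.
have [i ri] := halfP r; have [al h] := IH (half r).
exists (i :: al); rewrite P_word_cons ri.
by apply: isdiag_ext (isdiag_conjS i h) => k; rewrite ind_half.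
Qed.

Lemma ind_period l r k (q : int) : ind l r (k + 2 ^+ l * q) = ind l r k.
Proof. by rewrite /ind -!eqz_mod_dvd addrC mulrC modzMDl. Qed.

(* Uniform continuity for the 2-adic metric on the integers. *)
Definition UC f := forall eps : R, 0 < eps ->
  exists l : nat, forall (n q : int), modc (f (n + 2 ^+ l * q) - f n) <= eps.

Lemma UC_weaken f eps l l' : (l <= l')%N ->
  (forall n q : int, modc (f (n + 2 ^+ l * q) - f n) <= eps) ->
  forall n q : int, modc (f (n + 2 ^+ l' * q) - f n) <= eps.
Proof. by move=> /subnKC <- h n q; rewrite exprD -mulrA. Qed.

Lemma norm_cvg_isdiag (x_ : nat -> bop) x : norm_cvg x_ x ->
  (forall n, exists f, isdiag (x_ n) f) -> isdiag x (diag x).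
Proof.
move=> /norm_cvgP xx dx; apply: isdiag_of_offdiag => j k jk.
apply: modc_eq0 => eps /xx [N hN]; have [f xf] := dx N.
have := entry_le (x_ N - x) j k.
have -> : (x_ N - x) (e k) j = - (x (e k) j).
  rewrite bopBE -[LHS]/(x_ N (e k) j - x (e k) j).
  by rewrite (isdiag_offdiag xf jk) sub0r.
by rewrite modcN => /le_trans; apply; exact/ltW/hN.
Qed.

(** With the periodicity of the symbols of [P_word], this puts D2 among diagonal operators with
    uniformly continuous entries; [UC_D2] is the converse. *)
Lemma UC_cstar : cstar_algebra [set x | exists2 f, isdiag x f & UC f].
Proof.
have spl (eps : R) : 0 < eps -> 0 < eps / 2 by move=> eps0; exact: divr_gt0.
split=> [|a x y [f xf uf] [g yg ug]|x y [f xf uf] [g yg ug]|x [f xf uf]|x_ x dx xx].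
- exists (fun _ => 0); first exact: isdiag0.
  by move=> eps eps0; exists 0%N => n q; rewrite subrr modc0 ltW.
- exists (fun k => a * f k + g k); first exact: isdiag_lin.
  move=> eps eps0; have p : 0 < eps / 2 / (modc a + 1).
    by rewrite divr_gt0 ?spl// ltr_wpDl ?modc_ge0.
  have [l1 h1] := uf _ p; have [l2 h2] := ug _ (spl _ eps0).
  exists (maxn l1 l2) => n q.
  have {}h1 := UC_weaken (leq_maxl l1 l2) h1 n q.
  have {}h2 := UC_weaken (leq_maxr l1 l2) h2 n q.
  rewrite opprD addrACA -mulrBr; apply: le_trans (modcD _ _) _.
  rewrite modcM (splitr eps); apply: lerD => //.
  apply: le_trans (ler_wpM2l (modc_ge0 a) h1) _.
  rewrite mulrCA ger_pMr ?spl// ler_pdivrMr ?ltr_wpDl ?modc_ge0// mul1r.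
  by rewrite lerDl.
- exists (fun k => f k * g k); first exact: isdiagM.
  move=> eps eps0; set M := opnorm x + opnorm y + 1.
  have M0 : 0 < M by rewrite ltr_wpDl ?addr_ge0 ?opnorm_ge0.
  have xM : opnorm x <= M by rewrite /M -addrA lerDl addr_ge0 ?opnorm_ge0.
  have yM : opnorm y <= M by rewrite /M (addrC (opnorm x)) -addrA lerDl addr_ge0 ?opnorm_ge0.
  have p : 0 < eps / 2 / M by rewrite divr_gt0 ?spl.
  have [l1 h1] := uf _ p; have [l2 h2] := ug _ p.
  exists (maxn l1 l2) => n q.
  have {}h1 := UC_weaken (leq_maxl l1 l2) h1 n q.
  have {}h2 := UC_weaken (leq_maxr l1 l2) h2 n q.
  set m := n + _ in h1 h2 *.
  have -> : f m * g m - f n * g n = f m * (g m - g n) + g n * (f m - f n) by ring.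
  apply: le_trans (modcD _ _) _; rewrite !modcM (splitr eps).
  have E (z w : R) : 0 <= z -> z <= M -> 0 <= w -> w <= eps / 2 / M -> z * w <= eps / 2.
    move=> z0 zM w0 wM; apply: le_trans (ler_pM z0 w0 zM wM) _.
    by rewrite mulrC divfK ?gt_eqF.
  apply: lerD; apply: E; rewrite ?modc_ge0//.
    exact: le_trans (isdiag_le m xf) xM.
  exact: le_trans (isdiag_le n yg) yM.
- exists (fun k => conjc (f k)); first exact: isdiag_adj.
  move=> eps /uf [l h]; exists l => n q.
  by rewrite -rmorphB modc_conj.
exists (diag x).
  by apply: norm_cvg_isdiag xx _ => n; have [f xf _] := dx n; exists f.
move=> eps eps0; have p : 0 < eps / 3 by exact: divr_gt0.
have /norm_cvgP/(_ _ p)[N /(_ N (leqnn N))/ltW hN] := xx.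
have [f xf /(_ _ p)[l h]] := dx N; exists l => n q.
have E k : modc (diag x k - f k) <= eps / 3.
  rewrite modcB; apply: le_trans hN; have := entry_le (x_ N - x) k k.
  rewrite bopBE -[X in modc X]/(x_ N (e k) k - x (e k) k).
  by rewrite -!diagE (isdiag_diag k xf).
set m := n + _ in h *.
apply: le_trans (modcB_le _ (f m) _) _.
have h1 := modcB_le (f m) (f n) (diag x n).
have h2 := E m; have h3 := E n; rewrite modcB in h3; have h4 := h n q.
rewrite -/m in h4.
by move: h1 h2 h3 h4; do 4 move: (modc _); move=> *; lra.
Qed.

Lemma D2_UC x : D2 x -> exists2 f, isdiag x f & UC f.
Proof.
apply: cstar_gen_sub UC_cstar _ x => _ [al _ <-].
have [r h] := P_word_class al; exists (ind (size al) r) => // eps eps0.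
by exists (size al) => n q; rewrite ind_period subrr modc0 ltW.
Qed.

Lemma D2_UCdiag x : D2 x -> isdiag x (diag x) /\ UC (diag x).
Proof.
move=> /D2_UC [f xf uf]; have fE : diag x = f by apply: funext => k; exact: isdiag_diag.
by rewrite fE.
Qed.

Lemma ind_mod l (r : nat) (k : int) : (r < 2 ^ l)%N ->
  ind l r k = (r == `|(k %% 2 ^+ l)%Z|%N)%:R.
Proof.
move=> rl; rewrite /ind; congr (nat_of_bool _)%:R.
have p0 : (2 ^+ l : int) != 0 by rewrite expf_neq0.
have rp : (r%:Z %% 2 ^+ l)%Z = r%:Z.
  by rewrite modz_small//= -[2]/(2%:R) -natrX natz.
rewrite -eqz_mod_dvd -[RHS]eqz_nat gez0_abs ?modz_ge0// -rp.
by rewrite eq_sym modz_mod.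
Qed.

(** Up to [eps], [f k] depends only on [k] modulo 2^l, so [x] is close to the combination of the
    class projections with coefficients [f r], 0 <= r < 2^l. *)
Lemma UC_D2 x f : isdiag x f -> UC f -> D2 x.
Proof.
move=> xf uf; have cD := cstar_genP (range (P_word R)).
apply: (subspace_approx (cstar_subspace cD)) => eps /uf [l h].
have [D0 Dlin _ _ _] := cD.
have [y Dy yE] : exists2 y, D2 y & isdiag y (fun k => \sum_(r < 2 ^ l) f r%:Z * ind l r k).
  elim: (2 ^ l)%N => [|N [y Dy yE]].
    by exists 0 => //; apply: isdiag_ext isdiag0 => k; rewrite big_ord0.
  have [al hal] := class_P_word l N.
  exists (f N%:Z *: P_word R al + y).
    by apply: Dlin => //; apply: cstar_gen_mem; exists al.
  apply: isdiag_ext (isdiag_lin (f N%:Z) hal yE) => k.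
  by rewrite big_ord_recr /= addrC.
exists y => //; have eps0 : 0 <= eps by apply: le_trans (h 0 0); exact: modc_ge0.
have -> : y - x = (-1) *: x + y by rewrite scaleN1r addrC.
apply: isdiag_opnorm (isdiag_lin (-1) xf yE) eps0 _ => k.
  set s := \sum_(_ < _) _; have -> : s = f (k %% 2 ^+ l)%Z.
    have p0 : (2 ^+ l : int) != 0 by rewrite expf_neq0.
    have r0 : (`|(k %% 2 ^+ l)%Z| < 2 ^ l)%N.
      rewrite -ltz_nat gez0_abs ?modz_ge0//.
      by rewrite -[X in _ < X]natz natrX ltz_pmod// exprn_gt0.
    rewrite /s (bigD1 (Ordinal r0)) //= big1 ?addr0.
      by rewrite ind_mod// eqxx mulr1 gez0_abs ?modz_ge0.
    move=> i ni; rewrite ind_mod ?ltn_ord//; case: eqVneq => [E|_]; last by rewrite mulr0.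
    by case/eqP: ni; exact: val_inj.
  have := h (k %% 2 ^+ l)%Z (k %/ 2 ^+ l)%Z.
  rewrite [X in f X - _](_ : _ = k); last by rewrite addrC mulrC -divz_eq.
  by move=> H; rewrite mulN1r addrC modcB.
Qed.

End Diagonal.

(** * Diagonal elements of Q2 *)

Section TwoAdicRing.
Variable R : realType.
Local Notation C := (R[i]).
Local Notation ell2 := (ell2 R).
Local Notation bop := (bop R).
Local Notation e := (delta R).
Local Notation U := (U R).
Local Notation S2 := (S2 R).
Local Notation Q2 := (Q2 R).
Local Notation D2 := (D2 R).
Implicit Types (u v w : ell2) (x y z T : bop).

(* [T] maps [e n] to [e m] with [2^s m = 2^t n + b] when [n] lies in the
   periodic set [chi] and such an [m] exists, and to [0] otherwise. *)
Definition affine_monomial T : Prop :=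
  exists (s t l : nat) (b : int) (chi : int -> bool),
    (forall n q : int, chi (n + 2 ^+ l * q) = chi n) /\
    forall m n : int, T (e n) m = (chi n && (2 ^+ s * m == 2 ^+ t * n + b))%:R.

Lemma pow2_neq0 k : (2 ^+ k : int) != 0. Proof. by rewrite expf_neq0. Qed.

Lemma affine_monomial_U : affine_monomial U.
Proof.
exists 0%N, 0%N, 0%N, 1, xpredT; split=> // m n.
by rewrite U_delta deltaE !expr0 !mul1r.
Qed.

Lemma affine_monomial_S2 : affine_monomial S2.
Proof.
exists 0%N, 1%N, 0%N, 0, xpredT; split=> // m n.
by rewrite S2_delta deltaE expr0 expr1 mul1r addr0.
Qed.

Lemma affine_monomial_adj T : affine_monomial T -> affine_monomial (adj T).
Proof.
move=> [s [t [l [b [chi [per TE]]]]]].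
(* The inverse affine map, defined where the preimage (2^s m - b)/2^t is an integer lying in [chi].
   Period 2^(t+l) moves that preimage by a multiple of 2^l. *)
exists t, s, (t + l)%N, (- b),
  (fun m => (2 ^+ t %| 2 ^+ s * m - b)%Z && chi ((2 ^+ s * m - b) %/ 2 ^+ t)%Z).
split=> [m q|n m].
  have -> : 2 ^+ s * (m + 2 ^+ (t + l) * q) - b =
      2 ^+ l * (2 ^+ s * q) * 2 ^+ t + (2 ^+ s * m - b) by rewrite exprD; ring.
  rewrite divzMDl ?pow2_neq0// [X in chi X]addrC per; congr (_ && _).
  by apply/dvdz_mod0P/dvdz_mod0P; rewrite modzMDl.
rewrite adj_entryE TE conjc_nat; congr (nat_of_bool _)%:R.
have [E|ne] := eqVneq (2 ^+ t * n) (2 ^+ s * m - b).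
  rewrite -E [2 ^+ t * n]mulrC mulzK ?pow2_neq0// dvdz_mull//= andbT.
  by rewrite [n * _]mulrC E subrK eqxx andbT.
rewrite andbF; apply/negbTE; apply: contra_neqN ne => /andP[_ /eqP ->].
by rewrite addrK.
Qed.

Lemma affine_monomial_mul T' T :
  affine_monomial T' -> affine_monomial T -> affine_monomial (T' * T).
Proof.
move=> [s' [t' [l' [b' [chi' [per' TE']]]]]] [s [t [l [b [chi [per TE]]]]]].
pose dv n := (2 ^+ s %| 2 ^+ t * n + b)%Z.
pose w n := ((2 ^+ t * n + b) %/ 2 ^+ s)%Z.
have wE n : dv n -> 2 ^+ t * n + b = 2 ^+ s * w n.
  by move=> h; rewrite /w [RHS]mulrC divzK.
have Tn n : T (e n) = if chi n && dv n then e (w n) else 0.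
  apply: ell2_ext => m; rewrite TE; case: (chi n) => //=.
  have [h|h] := boolP (dv n).
    by rewrite (wE n h) (inj_eq (mulfI (pow2_neq0 s))) deltaE.
  case: eqP => // E; case/negP: h.
  by rewrite /dv -E dvdz_mulr.
(* Composition of the affine maps. In the period, [l] serves [chi], [s] the integrality of the
   intermediate point [w n], and [l'] the condition [chi' (w n)]. *)
exists (s + s')%N, (t + t')%N, (l + s + l')%N, (2 ^+ t' * b + 2 ^+ s * b'),
  (fun n => [&& chi n, dv n & chi' (w n)]); split=> [n q|m n].
  have E : 2 ^+ t * (n + 2 ^+ (l + s + l') * q) + b =
      2 ^+ l' * (2 ^+ (t + l) * q) * 2 ^+ s + (2 ^+ t * n + b) by rewrite !exprD; ring.
  have -> : chi (n + 2 ^+ (l + s + l') * q) = chi n.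
    by rewrite -addnA exprD -mulrA per.
  rewrite /dv /w E divzMDl ?pow2_neq0// [X in chi' X]addrC per'.
  by congr [&& _, _ & _]; apply/dvdz_mod0P/dvdz_mod0P; rewrite modzMDl.
rewrite bopME Tn; have [/andP[cn dn]|h] := boolP (chi n && dv n).
  rewrite cn dn TE' /=; congr (_ && _)%:R.
  have -> : 2 ^+ (t + t') * n + (2 ^+ t' * b + 2 ^+ s * b') =
      2 ^+ s * (2 ^+ t' * w n + b').
    transitivity (2 ^+ t' * (2 ^+ t * n + b) + 2 ^+ s * b'); first by rewrite exprD; ring.
    by rewrite wE//; ring.
  by rewrite exprD -mulrA (inj_eq (mulfI (pow2_neq0 s))).
by rewrite bop_0 andbA (negPf h).
Qed.

(** Elements on which a family of subadditive, uniformly norm-bounded functions tends to 0 along the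
    decreasing sets [D a]. The common bound [K] gives norm closure; both asymptotic properties of Q2
    are instances. *)
Lemma asymptotic_subspace (I : Type) (D : nat -> set I) (p : I -> bop -> R) (K : R) :
  (forall m n, (m <= n)%N -> D n `<=` D m) ->
  (forall i (a : C) x y, p i (a *: x + y) <= modc a * p i x + p i y) ->
  (forall i x, p i x <= K * opnorm x) ->
  closed_subspace [set x | forall eps, 0 < eps -> exists a, forall i, D a i -> p i x <= eps].
Proof.
move=> Ddec plin pK; split=> [eps eps0|a x y px py eps eps0|x_ x px xx eps eps0].
- exists 0%N => i _; apply: le_trans (pK i 0) _.
  by rewrite opnorm0 mulr0 ltW.
- have q1 : 0 < eps / 2 / (modc a + 1) by rewrite !divr_gt0// ltr_wpDl ?modc_ge0.
  have [n1 h1] := px _ q1; have [n2 h2] := py _ (divr_gt0 eps0 (ltr0Sn _ 1)).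
  exists (maxn n1 n2) => i Di; apply: le_trans (plin _ _ _ _) _.
  have {}h1 := h1 i (Ddec _ _ (leq_maxl n1 n2) i Di).
  have {}h2 := h2 i (Ddec _ _ (leq_maxr n1 n2) i Di).
  rewrite [leRHS](splitr eps); apply: lerD => //.
  apply: le_trans (ler_wpM2l (modc_ge0 a) h1) _.
  rewrite mulrCA ger_pMr ?divr_gt0// ler_pdivrMr ?ltr_wpDl ?modc_ge0// mul1r.
  by rewrite lerDl.
have K0 : 0 < `|K| + 1 by rewrite ltr_wpDl.
have e2 : 0 < eps / 2 by exact: divr_gt0.
have /norm_cvgP/(_ _ (divr_gt0 e2 K0))[N /(_ N (leqnn N))/ltW hN] := xx.
have [n h] := px N _ e2; exists n => i Di.
have -> : x = (1 : C) *: (x - x_ N) + x_ N by rewrite scale1r subrK.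
apply: le_trans (plin _ _ _ _) _; rewrite modc1 mul1r [leRHS](splitr eps).
apply: lerD; last exact: h.
apply: le_trans (pK _ _) _; rewrite opnormB.
apply: le_trans (_ : (`|K| + 1) * opnorm (x_ N - x) <= _).
  apply: ler_wpM2r; first exact: opnorm_ge0.
  by apply: le_trans (ler_norm _) _; rewrite lerDl.
by rewrite mulrC -ler_pdivlMr.
Qed.

Lemma diag_lin (a : C) x y k : diag (a *: x + y) k = a * diag x k + diag y k.
Proof. by rewrite !diagE. Qed.

Lemma diag_le x k : modc (diag x k) <= opnorm x.
Proof. by rewrite diagE entry_le. Qed.

Lemma pow2_gt k : k%:Z < 2 ^+ k.
Proof. by rewrite -[2]/(2%:R) -natrX natz ltz_nat ltn_expl. Qed.

(** One parameter controls both the congruence and the excluded window, so that the sets decrease in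
    [a] as [asymptotic_subspace] requires. *)
Definition cofinite_UC_at (a : nat) (i : int * int) : Prop :=
  [/\ exists q : int, i.1 = i.2 + 2 ^+ a * q, (a <= `|i.1|)%N & (a <= `|i.2|)%N].

Lemma cofinite_UC_dec (a b : nat) : (a <= b)%N -> cofinite_UC_at b `<=` cofinite_UC_at a.
Proof.
move=> ab [m n] [/= [q ->] h1 h2]; split=> /=; try exact: leq_trans ab _.
by exists (2 ^+ (b - a) * q); rewrite mulrA -exprD subnKC.
Qed.

(** A monomial with s = t and b = 0 has a periodic diagonal. Any other one has a diagonal supported
    on solutions of (2^s - 2^t) n = b, of which there is at most one. *)
Lemma Q2_cofinite_UC x : Q2 x -> forall eps, 0 < eps ->
  exists a, forall i, cofinite_UC_at a i -> modc (diag x i.1 - diag x i.2) <= eps.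
Proof.
pose A := [set x : bop | forall eps : R, 0 < eps -> exists a, forall i, cofinite_UC_at a i ->
  modc (diag x i.1 - diag x i.2) <= eps].
suff QA : Q2 `<=` A by exact: (QA x).
apply: (@cstar_gen_sub_span _ _ affine_monomial A).
- apply: (@asymptotic_subspace _ _ (fun i x => modc (diag x i.1 - diag x i.2)) 2).
  + exact: cofinite_UC_dec.
  + move=> [m n] a y z /=; rewrite !diag_lin.
    have -> : a * diag y m + diag z m - (a * diag y n + diag z n) =
      a * (diag y m - diag y n) + (diag z m - diag z n) by ring.
    by apply: le_trans (modcD _ _) _; rewrite modcM.
  + move=> [m n] y /=; apply: le_trans (modcD _ _) _; rewrite modcN mulr2n mulrDl mul1r.
    by apply: lerD; exact: diag_le.
- exact: affine_monomial_mul.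
- exact: affine_monomial_adj.
- by move=> _ [->|->]; [exact: affine_monomial_U|exact: affine_monomial_S2].
move=> T [s [t [l [b [chi [per TE]]]]]] eps eps0.
have [[st b0]|nst] := pselect (s = t /\ b = 0).
  exists l => -[m n] [/= [q ->] _ _].
  by rewrite !diagE !TE st b0 !addr0 !eqxx per subrr modc0 ltW.
(* A nonzero integer factor 2^s - 2^t forces |k| <= |b|; a zero factor would give s = t and b =
   0. *)
have z (k : int) : (`|b|.+1 <= `|k|)%N -> diag T k = 0.
  move=> bk; rewrite diagE TE; case: eqP; rewrite ?andbF// => E; exfalso.
  have E1 : (2 ^+ s - 2 ^+ t) * k = b by rewrite mulrBl E; ring.
  have [E2|n0] := eqVneq (2 ^+ s - 2 ^+ t : int) 0.
    apply: nst; split; last by rewrite -E1 E2 mul0r.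
    have := congr1 (fun i : int => `|i|%N) (subr0_eq E2); rewrite !abszX /= => /eqP.
    by rewrite eqn_exp2l// => /eqP.
  by move: bk n0; rewrite -E1 abszM; move: (2 ^+ s - 2 ^+ t) => p; nia.
exists `|b|.+1 => -[m n] [/= _ h1 h2].
by rewrite !z// subrr modc0 ltW.
Qed.

(** Starting the exponents at [j] brings the points into any given residue class of [n] and out of
    any finite set; taking [j] of them makes a shift by a fixed amount negligible. *)
Definition orbit_vec (n : int) (j : nat) : ell2 := \sum_(i < j) e (n + 2 ^+ (j + i)).

Definition orbit_state n j x : C := inner (orbit_vec n j) (x (orbit_vec n j)).

Lemma orbit_stateE n j x : orbit_state n j x =
  \sum_(i < j) \sum_(k < j) x (e (n + 2 ^+ (j + k))) (n + 2 ^+ (j + i)).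
Proof.
rewrite /orbit_state /orbit_vec.
rewrite (inner_suml _ j (fun i => e (n + 2 ^+ (j + i)))); apply: eq_bigr => i _.
rewrite (bop_sum x j (fun i => e (n + 2 ^+ (j + i)))).
rewrite (inner_sumr _ j (fun i => x (e (n + 2 ^+ (j + i))))); apply: eq_bigr => k _.
by rewrite inner_delta.
Qed.

Lemma orbit_point_inj (n : int) j i k :
  (n + 2 ^+ (j + i) == n + 2 ^+ (j + k)) = (i == k).
Proof.
rewrite (inj_eq (addrI n)) -[2]/(2%:R) -!natrX !natz eqz_nat eqn_exp2l//.
by rewrite eqn_add2l.
Qed.

Lemma orbit_state_diag n j x f : isdiag x f ->
  orbit_state n j x = \sum_(i < j) f (n + 2 ^+ (j + i)).
Proof.
move=> xf; rewrite orbit_stateE; apply: eq_bigr => i _.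
rewrite (bigD1 i)//= big1 ?addr0; first by rewrite -diagE (isdiag_diag _ xf).
by move=> k ki; rewrite (isdiag_offdiag xf)// orbit_point_inj eq_sym.
Qed.

Lemma orbit_vec_norm n j : l2norm (orbit_vec n j) ^+ 2 = j%:R.
Proof.
apply: (@complexI R); rewrite -inner_self -[inner _ _]/(orbit_state n j 1).
by rewrite (orbit_state_diag _ _ (@isdiag1 R)) sumr_const card_ord rmorph_nat.
Qed.

Lemma orbit_state_le n j x : modc (orbit_state n j x) <= opnorm x * j%:R.
Proof.
apply: le_trans (sqmod_inner_le _ _) _; rewrite -(orbit_vec_norm n) expr2 mulrA mulrC.
apply: ler_wpM2r; first exact: l2norm_ge0.
exact: opnorm_bound.
Qed.

Lemma sum_ltn_le (j t : nat) : (\sum_(i < j) (i < t) <= t)%N.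
Proof.
suff : (\sum_(i < j) (i < t) <= minn j t)%N by lia.
elim: j => [|j IH]; first by rewrite big_ord0.
rewrite big_ord_recr /=; apply: leq_trans (leq_add IH (leqnn _)) _.
by case: (ltnP j t) => h; rewrite /=; lia.
Qed.

Lemma sum_geq_le (j K s : nat) : (\sum_(i < j) (K <= s + i) <= (s + j) - K)%N.
Proof.
elim: j => [|j IH]; first by rewrite big_ord0.
rewrite big_ord_recr /=; apply: leq_trans (leq_add IH (leqnn _)) _.
by case: (leqP K (s + j)) => h; rewrite /=; lia.
Qed.

(** Each [i] has at most one partner [k], so the count misses [j] only by the indices without a
    partner. *)
Lemma orbit_count (s t j : nat) :
  modc (\sum_(i < j) \sum_(k < j) ((s + i)%N == (t + k)%N)%:R - j%:R : C) <= (s + t)%:R.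
Proof.
have E (i : 'I_j) : \sum_(k < j) ((s + i)%N == (t + k)%N)%:R =
    ((t <= s + i) && (s + i < t + j))%N%:R :> C.
  have [/andP[h1 h2]|h] := boolP ((t <= s + i) && (s + i < t + j))%N.
    have kj : (s + i - t < j)%N by lia.
    rewrite (bigD1 (Ordinal kj))//= big1 ?addr0; first by rewrite subnKC// eqxx.
    move=> k kn; case: eqP => // E; case/eqP: kn; apply: val_inj => /=; lia.
  rewrite big1// => k _; case: eqP => // E; exfalso.
  by have := ltn_ord k; move: h; rewrite E; lia.
rewrite (eq_bigr _ (fun i _ => E i)) modcB.
have -> : j%:R - \sum_(i < j) ((t <= s + i) && (s + i < t + j))%N%:R =
    (\sum_(i < j) ~~ ((t <= s + i) && (s + i < t + j)))%N%:R :> C.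
  rewrite natr_sum -{1}[j]card_ord -sumr_const -sumrB; apply: eq_bigr => i _.
  by case: (_ && _); rewrite ?subrr// subr0.
rewrite -(rmorph_nat (real_complex R)) modc_real ?ler0n// ler_nat.
(* No partner means s + i < t, hence i < t, or t + j <= s + i, hence j <= s + i: at most [t] and [s]
   indices respectively. *)
apply: (@leq_trans (\sum_(i < j) ((i < t) + (j <= s + i)))%N).
  apply: leq_sum => i _; have := ltn_ord i.
  case: (leqP t (s + i)) => h1; case: (ltnP (s + i) (t + j)) => h2 //= _.
  - by rewrite (leq_trans (leq_addl t j) h2) addn_gt0 orbT.
  - by rewrite (leq_ltn_trans (leq_addl s i) h1).
  - by rewrite (leq_ltn_trans (leq_addl s i) h1).
rewrite big_split /= addnC; apply: leq_add; last exact: sum_ltn_le.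
by apply: leq_trans (sum_geq_le _ _ _) _; rewrite addnK.
Qed.

(** If the affine map fixes [n], it acts on the points n + 2^i as a shift of exponents and the state
    is [chi n] times the count of [orbit_count]. Otherwise it sends no point of a late orbit into
    that orbit, and the state and the diagonal entry both vanish. *)
Lemma Q2_orbit_state x n : Q2 x -> forall eps, 0 < eps -> exists a, forall j, (a < j)%N ->
  modc (orbit_state n j x - j%:R * diag x n) / j%:R <= eps.
Proof.
pose A := [set x : bop | forall eps : R, 0 < eps -> exists a, forall j, (a < j)%N ->
  modc (orbit_state n j x - j%:R * diag x n) / j%:R <= eps].
have mj (j : nat) : modc (j%:R : C) = j%:R.
  by rewrite -(rmorph_nat (real_complex R)) modc_real.
suff QA : Q2 `<=` A by exact: (QA x).
apply: (@cstar_gen_sub_span _ _ affine_monomial A).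
- apply: (@asymptotic_subspace _ (fun a => [set j | (a < j)%N])
      (fun j x => modc (orbit_state n j x - j%:R * diag x n) / j%:R) 2).
  + by move=> a b ab j /=; exact: leq_ltn_trans.
  + move=> j a y z; rewrite mulrA -mulrDl; apply: ler_wpM2r; first by rewrite invr_ge0.
    have -> : orbit_state n j (a *: y + z) - j%:R * diag (a *: y + z) n =
        a * (orbit_state n j y - j%:R * diag y n) + (orbit_state n j z - j%:R * diag z n).
      by rewrite diag_lin /orbit_state bopDE bopZE innerDr innerZr; ring.
    by apply: le_trans (modcD _ _) _; rewrite modcM.
  (* At [j = 0] the quotient is 0, as the inverse of 0 is 0. *)
  + move=> j y; have [->|j0] := posnP j; first by rewrite invr0 mulr0 mulr_ge0 ?opnorm_ge0.
    rewrite ler_pdivrMr ?ltr0n//; apply: le_trans (modcD _ _) _.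
    rewrite modcN modcM mj -mulrA mulr2n mulrDl mul1r.
    apply: lerD; first exact: orbit_state_le.
    by rewrite mulrC; apply: ler_wpM2r; rewrite ?ler0n// diag_le.
- exact: affine_monomial_mul.
- exact: affine_monomial_adj.
- by move=> _ [->|->]; [exact: affine_monomial_U|exact: affine_monomial_S2].
move=> T [s [t [l [b [chi [per TE]]]]]] eps eps0.
(* The failure of [n] to be fixed; it vanishes exactly when the affine equation holds at (n, n). *)
pose c := 2 ^+ t * n + b - 2 ^+ s * n.
have stE j : orbit_state n j T = \sum_(i < j) \sum_(k < j)
    (chi (n + 2 ^+ (j + k)) && (2 ^+ (s + (j + i)) == 2 ^+ (t + (j + k)) + c))%:R.
  rewrite orbit_stateE; apply: eq_bigr => i _; apply: eq_bigr => k _.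
  rewrite TE; congr (_ && _)%:R; rewrite !(exprD _ s) !(exprD _ t) /c.
  by apply/eqP/eqP; lia.
have [c0|cn0] := eqVneq c 0.
  have dg : diag T n = (chi n)%:R.
    by rewrite diagE TE eq_sym -subr_eq0 -/c c0 eqxx andbT.
  pose B := (Num.bound ((s + t)%:R / eps)).
  (* Beyond [l], all orbit points share the value [chi n]; beyond [B], the error (s + t)/j is at
     most [eps]. *)
  exists (maxn l B) => j; rewrite gtn_max => /andP[lj Bj].
  have j0 : 0 < j%:R :> R by rewrite ltr0n; exact: leq_ltn_trans Bj.
  rewrite ler_pdivrMr// dg stE.
  have -> : \sum_(i < j) \sum_(k < j)
      (chi (n + 2 ^+ (j + k)) && (2 ^+ (s + (j + i)) == 2 ^+ (t + (j + k)) + c))%:R =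
      (chi n)%:R * \sum_(i < j) \sum_(k < j) ((s + i)%N == (t + k)%N)%:R :> C.
    rewrite mulr_sumr; apply: eq_bigr => i _; rewrite mulr_sumr; apply: eq_bigr => k _.
    have -> : (j + k = l + (j - l + k))%N by lia.
    rewrite exprD per c0 addr0 -natrM mulnb; congr (_ && _)%:R.
    rewrite -[2]/(2%:R) -!natrX !natz eqz_nat eqn_exp2l//.
    by apply/eqP/eqP; lia.
  rewrite [j%:R * _]mulrC -mulrBr modcM.
  apply: le_trans (_ : 1 * modc (\sum_(i < j) \sum_(k < j)
      ((s + i)%N == (t + k)%N)%:R - j%:R) <= _).
    by apply: ler_wpM2r; [exact: modc_ge0|case: (chi n); rewrite ?modc1 ?modc0].
  rewrite mul1r; apply: le_trans (orbit_count s t j) _.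
  rewrite -ler_pdivrMl// mulrC; apply: le_trans (ltW (archi_boundP _)) _.
    by rewrite divr_ge0 ?ler0n ?(ltW eps0).
  by rewrite ler_nat ltnW.
exists `|c|%N => j cj; rewrite diagE TE stE.
have -> : (2 ^+ s * n == 2 ^+ t * n + b) = false.
  by apply/negbTE; apply: contra cn0 => /eqP E; rewrite /c -E subrr.
rewrite andbF mulr0 subr0 big1 ?modc0 ?mul0r ?(ltW eps0)// => i _; rewrite big1// => k _.
case: eqP => [E|]; rewrite ?andbF//; exfalso.
(* A match would make 2^j divide the nonzero [c], impossible since |c| < j < 2^j. *)
have {}E : c = 2 ^+ j * (2 ^+ (s + i) - 2 ^+ (t + k)).
  have -> : c = 2 ^+ (s + (j + i)) - 2 ^+ (t + (j + k)) by rewrite E; ring.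
  by rewrite !exprD; ring.
have := pow2_gt j; have : (`|c| < j)%N by [].
move: cn0; rewrite E abszM mulf_eq0 negb_or; move: (2 ^+ j : int) (_ - _) => p r.
move=> /andP[_ r0]; have : (`|p| <= `|p| * `|r|)%N by rewrite leq_pmulr// absz_gt0.
by move: (`|p| * `|r|)%N => w; lia.
Qed.

(** The entries at [m] and [n] are compared through their orbit averages: paired orbit points differ
    by m - n, a multiple of 2^a, and are far out, so [Q2_cofinite_UC] applies to each pair. *)
Lemma Q2_diag_D2 x f : Q2 x -> isdiag x f -> D2 x.
Proof.
move=> Qx xf; apply: (UC_D2 xf) => eps eps0.
have e3 : 0 < eps / 3 by exact: divr_gt0.
have [a ha] := Q2_cofinite_UC Qx e3; exists a => n q; set m := n + _.
have [J1 h1] := Q2_orbit_state n Qx e3; have [J2 h2] := Q2_orbit_state m Qx e3.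
(* Since 2^(j+i) > j, the terms [a], |n| and |m| keep both orbits outside the excluded window. *)
pose j := (J1 + J2 + a + `|n| + `|m|)%N.+1.
have j0 : 0 < j%:R :> R by rewrite ltr0n.
have jJ1 : (J1 < j)%N by rewrite /j; lia.
have jJ2 : (J2 < j)%N by rewrite /j; lia.
have {}h1 := h1 j jJ1; have {}h2 := h2 j jJ2.
rewrite ler_pdivrMr// (isdiag_diag _ xf) (orbit_state_diag _ _ xf) in h1.
rewrite ler_pdivrMr// (isdiag_diag _ xf) (orbit_state_diag _ _ xf) in h2.
have h3 : modc (\sum_(i < j) f (m + 2 ^+ (j + i)) - \sum_(i < j) f (n + 2 ^+ (j + i)))
    <= eps / 3 * j%:R.
  rewrite -sumrB; apply: le_trans (modc_sum j (fun i =>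
    f (m + 2 ^+ (j + i)) - f (n + 2 ^+ (j + i)))) _.
  apply: (@le_trans _ _ (\sum_(i < j) eps / 3)); last by rewrite sumr_const card_ord mulr_natr.
  apply: ler_sum => i _.
  have big (k : int) : (a + `|k|%N < j)%N -> (a <= `|(k + 2 ^+ (j + i))%R|)%N.
    move=> h; have := pow2_gt (j + i); move: (2 ^+ (j + i) : int) => p; lia.
  have := ha (m + 2 ^+ (j + i), n + 2 ^+ (j + i)); rewrite /= !(isdiag_diag _ xf).
  apply; split=> /=; last 2 first.
  - by apply: big; rewrite /j; lia.
  - by apply: big; rewrite /j; lia.
  by exists q; rewrite /m addrAC.
rewrite -(ler_pM2r j0).
have mj : modc (j%:R : C) = j%:R by rewrite -(rmorph_nat (real_complex R)) modc_real.
rewrite -{1}mj -modcM [X in modc X](_ : _ = - (\sum_(i < j) f (m + 2 ^+ (j + i)) - j%:R * f m) +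
  (\sum_(i < j) f (m + 2 ^+ (j + i)) - \sum_(i < j) f (n + 2 ^+ (j + i)) +
   (\sum_(i < j) f (n + 2 ^+ (j + i)) - j%:R * f n))); last by ring.
apply: le_trans (modcD _ _) _; rewrite modcN.
apply: le_trans (lerD h2 (le_trans (modcD _ _) (lerD h3 h1))) _.
by rewrite le_eqVlt; apply/orP; left; apply/eqP; field.
Qed.

End TwoAdicRing.

(** * Strong limits, commutants and the implementing unitary *)

Section StrongLimits.
Variable R : realType.
Local Notation C := (R[i]).
Local Notation ell2 := (ell2 R).
Local Notation bop := (bop R).
Implicit Types (u : ell2) (x y z : bop).

Lemma strong_cvgP (x_ : nat -> bop) x : strong_cvg x_ x <->
  forall u (eps : R), 0 < eps ->
    exists N, forall n, (N <= n)%N -> l2norm (x_ n u - x u) < eps.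
Proof.
split=> h u.
  move=> eps eps0; have /cvgrPdist_lt/(_ eps eps0)[N _ hN] := h u.
  exists N => n /hN /=; rewrite sub0r normrN ger0_norm//; exact: l2norm_ge0.
apply/cvgrPdist_lt => eps /(h u)[N hN]; exists N => // n /hN /=.
by rewrite sub0r normrN ger0_norm//; exact: l2norm_ge0.
Qed.

Lemma strong_cvg_uniq (x_ : nat -> bop) x y :
  strong_cvg x_ x -> strong_cvg x_ y -> x = y.
Proof.
move=> /strong_cvgP hx /strong_cvgP hy; apply: bop_ext => u.
apply/eqP; rewrite -subr_eq0; apply/eqP/l2norm_small => eps eps0.
have e2 : 0 < eps / 2 by exact: divr_gt0.
have [N /(_ _ (leq_maxl N _)) hN] := hx u _ e2.
have [M /(_ _ (leq_maxr _ M)) hM] := hy u _ e2.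
have {}hN := hN M; have {}hM := hM N; set n := maxn _ _ in hN hM.
have -> : x u - y u = (x_ n u - y u) - (x_ n u - x u).
  by rewrite opprB [RHS]addrC addrA subrK.
apply: le_trans (l2normD _ _) _; rewrite l2normN [leRHS](splitr eps).
by apply: lerD; exact: ltW.
Qed.

(** On a truncation only finitely many entries matter and they stabilize; the tail is controlled by
    the uniform bound M + M. *)
Lemma strong_cvg_isdiag (x_ : nat -> bop) x (f_ : nat -> int -> C) (f : int -> C) (M : R) :
  (forall n, isdiag (x_ n) (f_ n)) -> isdiag x f ->
  (forall n k, modc (f_ n k) <= M) -> (forall k, modc (f k) <= M) ->
  (forall k, exists N, forall n, (N <= n)%N -> f_ n k = f k) ->
  strong_cvg x_ x.
Proof.
move=> xf_ xf M_ M1 ev; apply/strong_cvgP => u eps eps0.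
have M0 : 0 <= M by exact: le_trans (modc_ge0 _) (M1 0).
have K0 : 0 < M + M + 1 by rewrite ltr_wpDl// addr_ge0.
have [K /ltW uK] := trunc_cvg u (divr_gt0 eps0 K0).
have [N hN] : exists N, forall n, (N <= n)%N ->
    forall k : int, - (K%:Z) <= k < K%:Z -> f_ n k = f k.
  elim: K {uK} => [|K [N IH]]; first by exists 0%N => n _ k; lia.
  have [N1 h1] := ev K%:Z; have [N2 h2] := ev (Negz K).
  exists (maxn N (maxn N1 N2)) => n; rewrite !geq_max => /and3P[n0 n1 n2] k kK.
  have [->|k1] := eqVneq k K%:Z; first exact: h1.
  have [->|k2] := eqVneq k (Negz K); first exact: h2.
  by apply: IH => //; lia.
exists N => n /hN {}hN; rewrite -bopBE.
have -> : (x_ n - x) u = (x_ n - x) (u - trunc u K).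
  rewrite bop_sub [X in _ = _ - X](_ : _ = 0) ?subr0// bop_trunc big1// => k _.
  have kK := ltn_ord k.
  by rewrite !bopBE !xf_ !xf !hN ?subrr ?scaler0 ?addr0//; lia.
apply: le_lt_trans (opnorm_bound _ _) _.
have h : opnorm (x_ n - x) <= M + M.
  apply: le_trans (opnormD _ _) _; rewrite opnormN.
  by apply: lerD; [exact: isdiag_opnorm (xf_ n) M0 (M_ n)|exact: isdiag_opnorm xf M0 M1].
apply: le_lt_trans (ler_pM (opnorm_ge0 _) (l2norm_ge0 _) h uK) _.
by rewrite mulrCA gtr_pMr// ltr_pdivrMr// mul1r ltrDl.
Qed.

End StrongLimits.

(** * Automorphisms of generated C*-algebras implemented by unitaries *)

Section Conjugation.
Variable R : realType.
Local Notation bop := (bop R).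
Implicit Types (x y u : bop) (G : set bop).

Lemma unitaryM x y : unitary x -> unitary y -> unitary (x * y).
Proof.
move=> [x1 x2] [y1 y2]; rewrite /unitary adjM; split.
  by rewrite mulrA -(mulrA (adj y)) x1 mulr1.
by rewrite mulrA -(mulrA x) y2 mulr1.
Qed.

Lemma unitary_adj x : unitary x -> unitary (adj x).
Proof. by move=> [x1 x2]; rewrite /unitary adjK. Qed.

Lemma conj_cstar_gen G u : unitary u ->
  (forall x, G x -> cstar_gen G (u * x * adj u)) ->
  forall x, cstar_gen G x -> cstar_gen G (u * x * adj u).
Proof.
move=> uu hG; have [A0 Alin AM Aadj Acl] := cstar_genP G.
have [lin mul ad] := star_hom_conj setT uu.
suff h : cstar_gen G `<=` [set x | cstar_gen G (u * x * adj u)] by exact: h.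
apply: cstar_gen_sub => //; split=> [|a x y hx hy|x y hx hy|x hx|x_ x hx xx] /=.
- by rewrite mulr0 mul0r.
- by rewrite lin//; exact: Alin.
- by rewrite mul//; exact: AM.
- by rewrite ad//; exact: Aadj.
by apply: Acl hx _; apply: norm_cvgMr; exact: norm_cvgMl.
Qed.

(** Both directions are checked on generators because surjectivity needs conjugation by [adj u] to
    preserve the algebra too. *)
Lemma conj_automorphism G u : unitary u ->
  (forall x, G x -> cstar_gen G (u * x * adj u)) ->
  (forall x, G x -> cstar_gen G (adj u * x * u)) ->
  automorphism (cstar_gen G) (fun x => u * x * adj u).
Proof.
move=> uu h1 h2; split; first exact: star_hom_conj.
have [u1 u2] := uu.
have K x : u * (adj u * x * u) * adj u = x.
  by rewrite -!mulrA u2 mulr1 mulrA u2 mul1r.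
have K' x : adj u * (u * x * adj u) * u = x.
  by rewrite -!mulrA u1 mulr1 mulrA u1 mul1r.
split.
- by move=> x Gx; exact: conj_cstar_gen.
- by move=> x y _ _ E; rewrite -(K' x) E K'.
move=> x Gx; exists (adj u * x * u); last exact: K.
rewrite -[X in _ * X]adjK; apply: conj_cstar_gen => //; first exact: unitary_adj.
by move=> y Gy; rewrite adjK; exact: h2.
Qed.

End Conjugation.

(** * Commutants of O2 and Q2 on the sequence space *)

Section CanonicalRepresentation.
Variable R : realType.
Local Notation C := (R[i]).
Local Notation ell2 := (ell2 R).
Local Notation bop := (bop R).
Local Notation e := (delta R).
Local Notation U := (U R).
Local Notation S1 := (S1 R).
Local Notation S2 := (S2 R).
Local Notation S_ := (S_ R).
Local Notation O2 := (O2 R).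
Local Notation Q2 := (Q2 R).
Local Notation D2 := (D2 R).
Implicit Types (u v w : ell2) (x y z T : bop) (f g : int -> C).

Lemma O2_S i : O2 (S_ i).
Proof. by apply: cstar_gen_mem; case: i; [left; exact: erefl|right; exact: erefl]. Qed.

Lemma Q2_U : Q2 U. Proof. by apply: cstar_gen_mem; left; exact: erefl. Qed.
Lemma Q2_S2 : Q2 S2. Proof. by apply: cstar_gen_mem; right; exact: erefl. Qed.

Lemma O2_1 : O2 1.
Proof.
have [_ _ AM Aadj _] := cstar_genP [set S1; S2].
have <- : adj (S_ false) * S_ false = 1 by rewrite adjS_S eqxx.
by apply: AM; [apply: Aadj|]; exact: O2_S.
Qed.

Lemma O2_Q2 : O2 `<=` Q2.
Proof.
apply: cstar_gen_sub; first exact: cstar_genP.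
have [_ _ AM _ _] := cstar_genP [set U; S2].
by move=> _ [->|->]; [apply: AM; [exact: Q2_U|exact: Q2_S2]|exact: Q2_S2].
Qed.

Lemma Q2_1 : Q2 1. Proof. exact: (O2_Q2 O2_1). Qed.

Lemma P_word_O2 al : O2 (P_word R al).
Proof.
have [_ _ AM Aadj _] := cstar_genP [set S1; S2].
elim: al => [|i al IH]; first by rewrite P_word_nil; exact: O2_1.
by rewrite P_word_cons; apply: (AM); [apply: (AM) => //|apply: Aadj]; exact: O2_S.
Qed.

Lemma D2_Q2 : D2 `<=` Q2.
Proof.
apply: cstar_gen_sub; first exact: cstar_genP.
by move=> _ [al _ <-]; apply: O2_Q2; exact: P_word_O2.
Qed.

(** Outside 0 and -1, [half] strictly decreases the absolute value. *)
Lemma half_ind (P : int -> Prop) : P 0 -> P (-1) ->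
  (forall k, P (half k) -> P k) -> forall k, P k.
Proof.
move=> P0 P1 Ph k; have [n] := ubnP `|k|%N; elim: n k => // n IH k kn.
have [->//|k0] := eqVneq k 0; have [->//|k1] := eqVneq k (-1).
by apply: Ph; apply: IH; rewrite /half; lia.
Qed.

Lemma S_entry i u (j : bool) k : S_ i u (2 * k + j%:Z) = if j == i then u k else 0.
Proof.
rewrite -[LHS]inner_delta -adjP adjS_delta halfE (inj_eq (addrI _)).
have [->|ji] := eqVneq j i; first by rewrite eqxx inner_delta.
by case: i j ji => [] [] //= _; rewrite inner0l.
Qed.

(** The integer -i is the fixed point of n |-> 2 n + i. Reading the equation at 2 h + j gives 0
    unless j = i, and otherwise passes from 2 h + i to [h]. *)
Lemma S_fixed i u : S_ i u = u -> u = u (- i%:Z) *: e (- i%:Z).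
Proof.
move=> Su; apply: ell2_ext => k; rewrite ell2ZE deltaE.
have [->|] := eqVneq k (- i%:Z); first by rewrite mulr1.
rewrite mulr0; elim/half_ind: k => [||k IH].
- case: i Su => // Su _.
  by rewrite -Su; exact: (S_entry true u false 0).
- case: i Su => // Su _.
  by rewrite -Su; exact: (S_entry false u true (-1)).
have [j kj] := halfP k; move: kj IH; move: (half k) => h -> IH ne.
rewrite -Su S_entry; case: eqP => // ji; apply: IH.
by apply: contra ne => /eqP ->; rewrite ji; apply/eqP; ring.
Qed.

(** The vector [e (- i)] is fixed by [S_ i], hence so is its image under [T], which makes it an
    eigenvector by [S_fixed]. Words in the [S_ i] carry the eigenvalues from 0 and -1 to all other
    basis vectors. *)
Lemma commute_S_isdiag T : (forall i, T * S_ i = S_ i * T) -> isdiag T (diag T).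
Proof.
move=> TS; have fix_ (i : bool) : T (e (- i%:Z)) = T (e (- i%:Z)) (- i%:Z) *: e (- i%:Z).
  apply: (@S_fixed i); rewrite -bopME -TS bopME S_delta; congr (T (e _)); ring.
move=> k; rewrite diagE; elim/half_ind: k => [||k IH].
- by have := fix_ false; rewrite oppr0.
- exact: (fix_ true).
have [j ->] := halfP k; rewrite -S_delta -bopME TS bopME IH bop_scale S_delta.
by rewrite ell2ZE deltaE eqxx mulr1.
Qed.

Lemma commutant_O2_isdiag T : commutant O2 T -> isdiag T (diag T).
Proof. by move=> h; apply: commute_S_isdiag => i; apply: h; exact: O2_S. Qed.

(** The commutant of O2 is itself diagonal, and diagonal operators commute. *)
Lemma isdiag_vonNeumann_O2 x f : isdiag x f -> vonNeumann O2 x.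
Proof.
move=> xf y /commutant_O2_isdiag yg.
by apply: isdiag_inj (isdiagM xf yg) (isdiagM yg xf) _ => k; exact: mulrC.
Qed.

Lemma commutant_Q2_scalar T : commutant Q2 T -> T = diag T 0 *: 1.
Proof.
move=> h; have TO : commutant O2 T by move=> y Oy; apply: h; exact: O2_Q2.
have Tg := commutant_O2_isdiag TO.
have gS k : diag T (k + 1) = diag T k.
  have E : (T * U) (e k) = (U * T) (e k) by rewrite (h U Q2_U).
  rewrite !bopME U_delta (Tg k) Tg bop_scale U_delta in E.
  have := congr1 (fun u : ell2 => u (k + 1)) E.
  by rewrite !ell2ZE deltaE eqxx !mulr1.
have gE k : diag T k = diag T 0.
  elim/int_rect: k => // n IH; rewrite -IH.
    by rewrite -(gS n%:Z); congr (diag T _); lia.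
  by rewrite -(gS (- n.+1%:Z)); congr (diag T _); lia.
apply: isdiag_inj Tg (_ : isdiag _ (fun=> diag T 0)) gE.
by move=> k.
Qed.

(** Irreducibility: commuting with [U] makes a diagonal symbol translation invariant, so the
    commutant is scalar and every unitary implements weakly. *)
Lemma vonNeumann_Q2 x : vonNeumann Q2 x.
Proof.
by move=> y /commutant_Q2_scalar ->; rewrite -scalerAr -scalerAl mulr1 mul1r.
Qed.

(** The class projections separate basis vectors: 2^(|j-k|+1) exceeds |j - k|, so distinct [j] and
    [k] are incongruent modulo it. *)
Lemma commute_P_word_isdiag x :
  (forall al, x * P_word R al = P_word R al * x) -> isdiag x (diag x).
Proof.
move=> h; apply: isdiag_of_offdiag => j k jk.
have [al Pal] := class_P_word R `|j - k|%N.+1 k.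
have E : (x * P_word R al) (e k) = (P_word R al * x) (e k) by rewrite h.
rewrite (bopME x) (bopME (P_word R al)) Pal bop_scale in E; have := congr1 (fun u : ell2 => u j) E => {E}.
rewrite (isdiagE _ _ Pal) ell2ZE.
have -> : ind R `|j - k|%N.+1 k k = 1 by rewrite /ind subrr dvdz0.
have -> : ind R `|j - k|%N.+1 k j = 0.
  rewrite /ind; case: dvdzP => // -[q E]; exfalso; move: jk; rewrite -subr_eq0 E.
  have := pow2_gt `|j - k|%N.+1; move: (2 ^+ _ : int) E => p E.
  have -> : `|j - k|%N = (`|q| * `|p|)%N by rewrite E abszM.
  rewrite mulf_eq0 negb_or => h1 /andP[q0 _].
  have : (`|p| <= `|q| * `|p|)%N by rewrite leq_pmull// absz_gt0.
  by move: h1; move: (`|q| * `|p|)%N => w; lia.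
by rewrite mul1r mul0r.
Qed.

(** * The cocycle of a unimodular symbol and the limits of [dprod] and [xseq] *)

Section UnimodularCocycle.
Variable f : int -> C.
Hypotheses (f1 : forall k, conjc (f k) * f k = 1) (f_0 : f 0 = 1) (f_m1 : f (-1) = 1).

Definition partial_cocycle (k : nat) (n : int) : C := \prod_(j < k) f (iter j half n).

(** The infinite product along the orbit of [n], cut at |n| factors: a crude bound for the time
    needed to reach 0 or -1. *)
Definition cocycle (n : int) : C := partial_cocycle `|n|%N n.

Lemma iter_half0 j : iter j half 0 = 0.
Proof. by elim: j => //= j ->. Qed.

Lemma iter_half_m1 j : iter j half (-1) = -1.
Proof. by elim: j => //= j ->. Qed.

Lemma cocycle_iter_half j n : (`|n| <= j)%N -> f (iter j half n) = 1.
Proof.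
elim: j n => [|j IH] n nj; first by have -> : n = 0 by lia.
have [->|n0] := eqVneq n 0; first by rewrite iter_half0.
have [->|n1] := eqVneq n (-1); first by rewrite iter_half_m1.
by rewrite iterSr; apply: IH; rewrite /half; lia.
Qed.

Lemma partial_cocycle_stable k n : (`|n| <= k)%N -> partial_cocycle k n = cocycle n.
Proof.
move=> /subnKC <-; elim: (k - _)%N => [|m IH]; first by rewrite addn0.
rewrite addnS /partial_cocycle big_ord_recr /= -/(partial_cocycle _ _) IH.
by rewrite cocycle_iter_half ?mulr1// leq_addr.
Qed.

Lemma cocycle_double n (i : bool) : cocycle (2 * n + i%:Z) = f (2 * n + i%:Z) * cocycle n.
Proof.
set m := 2 * n + _; pose k := (`|m| + `|n|)%N.
rewrite -(@partial_cocycle_stable k.+1 m); last by rewrite /k; lia.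
rewrite -(@partial_cocycle_stable k n); last by rewrite /k; lia.
rewrite /partial_cocycle big_ord_recl /=; congr (_ * _).
by apply: eq_bigr => j _; rewrite -iterS iterSr halfE.
Qed.

Lemma partial_cocycle_unimod k n : conjc (partial_cocycle k n) * partial_cocycle k n = 1.
Proof.
rewrite /partial_cocycle; elim: k => [|k IH]; first by rewrite !big_ord0 conjc1 mulr1.
by rewrite !big_ord_recr rmorphM /= mulrACA IH f1 mulr1.
Qed.

Lemma cocycle_unimod n : conjc (cocycle n) * cocycle n = 1.
Proof. exact: partial_cocycle_unimod. Qed.

Lemma cocycle0 : cocycle 0 = 1. Proof. by rewrite /cocycle /partial_cocycle big_ord0. Qed.

Lemma cocycle_m1 : cocycle (-1) = 1.
Proof. by rewrite /cocycle /partial_cocycle big_ord_recl big_ord0 mulr1. Qed.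

Definition coboundary (a : C) (n : int) : C :=
  if n == 0 then a else cocycle n * conjc (cocycle (n - 1)).

Definition twisted_cocycle (a : C) (n : int) : C :=
  if 0 <= n then cocycle n else conjc a * cocycle n.

Lemma twisted_cocycle_unimod a n : conjc a * a = 1 ->
  conjc (twisted_cocycle a n) * twisted_cocycle a n = 1.
Proof.
move=> a1; rewrite /twisted_cocycle; case: ifP => _; first exact: cocycle_unimod.
by rewrite rmorphM /= conjcK mulrACA cocycle_unimod mulr1 mulrC.
Qed.

(** [2 n + i] and [n] have the same sign, so the twist cancels; thus alpha is invisible to [S1] and
    [S2]. *)
Lemma twisted_cocycle_double a n (i : bool) : conjc a * a = 1 ->
  twisted_cocycle a (2 * n + i%:Z) * conjc (twisted_cocycle a n) = f (2 * n + i%:Z).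
Proof.
move=> a1; rewrite /twisted_cocycle.
have -> : (0 <= 2 * n + i%:Z) = (0 <= n) by case: i; lia.
have c1 := cocycle_unimod n; rewrite cocycle_double; case: ifP => _.
  by rewrite -mulrA [cocycle n * _]mulrC c1 mulr1.
rewrite rmorphM /= conjcK mulrACA a1 mul1r -mulrA.
by rewrite [cocycle n * _]mulrC c1 mulr1.
Qed.

(** The twist cancels except on the step from -1 to 0, where it leaves [a]. *)
Lemma twisted_cocycle_succ a n : conjc a * a = 1 ->
  twisted_cocycle a (n + 1) * conjc (twisted_cocycle a n) = coboundary a (n + 1).
Proof.
move=> a1; rewrite /twisted_cocycle /coboundary addrK.
have [n0|n0] := leP 0 n.
  have -> : 0 <= n + 1 by lia.
  by have -> : (n + 1 == 0) = false by lia.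
have [n1|n1] := eqVneq (n + 1) 0.
  have -> : n = -1 by lia.
  by rewrite /= cocycle0 cocycle_m1 mulr1 conjcK mul1r.
have -> : (0 <= n + 1) = false by lia.
by rewrite rmorphM /= conjcK mulrACA a1 mul1r.
Qed.

(** The two functions agree off 0, and 2^l tends to 0 in the 2-adic metric, so continuity determines
    the value at 0. *)
Lemma coboundary_UC_inj a b : UC (coboundary a) -> UC (coboundary b) -> a = b.
Proof.
move=> ua ub; apply/eqP; rewrite -subr_eq0; apply/eqP; apply: modc_eq0 => eps eps0.
have e2 : 0 < eps / 2 by exact: divr_gt0.
have [l1 h1] := ua _ e2; have [l2 h2] := ub _ e2.
have := UC_weaken (leq_maxl l1 l2) h1 0 1; have := UC_weaken (leq_maxr l1 l2) h2 0 1.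
rewrite add0r mulr1 /coboundary eqxx (negPf (pow2_neq0 _)).
set c := _ * _ => hb; rewrite modcB => ha.
apply: le_trans (modcB_le a c b) _.
by rewrite [leRHS](splitr eps); exact: lerD.
Qed.

(* The operators [S_1] and [S_2 U = U^2 S_2] determine [g (2 n + 1)] and the
   ratio of [g (2 m)] and [g m]. *)
Lemma coboundary_rec g :
  (forall n, f (2 * n + 1) = g (2 * n + 1) * f (2 * n)) ->
  (forall m, g (2 * m) * f (2 * m - 1) = g m * f (2 * m)) ->
  g =1 coboundary (g 0).
Proof.
(* At 0 the even relation is an identity, so [g 0] remains a free parameter. *)
move=> godd geven n; rewrite /coboundary; have [->//|n0] := eqVneq n 0.
suff E : g n * cocycle (n - 1) = cocycle n.
  by rewrite -E -mulrA [cocycle _ * _]mulrC cocycle_unimod mulr1.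
have odd_case h : g (2 * h + 1) * cocycle (2 * h + 1 - 1) = cocycle (2 * h + 1).
  rewrite addrK (cocycle_double h true) /= godd -mulrA; congr (_ * _).
  by have := cocycle_double h false; rewrite /= addr0.
elim/half_ind: n n0 => [//|_|n IH n0]; first exact: (odd_case (-1)).
have [i ni] := halfP n; move: ni n0 IH; move: (half n) => h ->.
case: i => /= n0 IH; first exact: odd_case.
rewrite addr0 in n0 *; have h0 : h != 0 by apply: contra n0 => /eqP ->; rewrite mulr0.
have -> : cocycle (2 * h) = f (2 * h) * cocycle h.
  by have := cocycle_double h false; rewrite /= addr0.
(* The predecessor of [2 h] has half [h - 1], so the even relation reduces the claim at [2 h] to the
   one at [h]. *)
have E : 2 * h - 1 = 2 * (h - 1) + 1 by ring.
rewrite E (cocycle_double (h - 1) true) /= -E mulrA geven -(IH h0); ring.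
Qed.

Variable d : bop.
Hypothesis df : isdiag d f.

Lemma isdiag_dprod k : isdiag (dprod d k) (partial_cocycle k).
Proof.
exact: (isdiag_prod k (fun j => isdiag_iter_phi j df)).
Qed.

Lemma partial_cocycle_le1 k n : modc (partial_cocycle k n) <= 1.
Proof. by rewrite modc_unimod// partial_cocycle_unimod. Qed.

Lemma dprod_strong_cvg d_oo : isdiag d_oo cocycle -> strong_cvg (dprod d) d_oo.
Proof.
move=> dc; apply: (strong_cvg_isdiag (M := 1) isdiag_dprod dc) => [k n|n|n].
- exact: partial_cocycle_le1.
- exact: partial_cocycle_le1.
by exists `|n|%N => k; exact: partial_cocycle_stable.
Qed.

(* Indicator of [2^i (2 Z + 1)]. *)
Fixpoint odd_part_ind (i : nat) (n : int) : C :=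
  if i is i'.+1 then if n == 2 * half n + false%:Z then odd_part_ind i' (half n) else 0
  else if n == 2 * half n + true%:Z then 1 else 0.

Lemma isdiag_odd_part i : isdiag (S2 ^+ i * S1 * adj S1 * adj S2 ^+ i) (odd_part_ind i).
Proof.
elim: i => [|i IH].
  rewrite !expr0 mul1r mulr1 -[S1 in S1 * _]mulr1.
  exact: (isdiag_conjS true (@isdiag1 R)).
rewrite exprS exprSr.
have -> : S2 * S2 ^+ i * S1 * adj S1 * (adj S2 ^+ i * adj S2) =
    S2 * (S2 ^+ i * S1 * adj S1 * adj S2 ^+ i) * adj S2 by rewrite !mulrA.
exact: (isdiag_conjS false IH).
Qed.

(** A nonzero [n] lies in exactly one set 2^i (2 Z + 1), with i < |n|, and 0 lies in none. The sums
    thus converge to the complement of the projection on [e 0], which the alpha term of [xseq]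
    fills. *)
Lemma sum_odd_part k n :
  [/\ \sum_(i < k) odd_part_ind i n = 0 \/ \sum_(i < k) odd_part_ind i n = 1,
      n = 0 -> \sum_(i < k) odd_part_ind i n = 0
    & n != 0 -> (`|n| <= k)%N -> \sum_(i < k) odd_part_ind i n = 1].
Proof.
elim: k n => [|k IH] n; first by rewrite big_ord0; split=> //; [left|lia].
rewrite big_ord_recl /=; have [j nj] := halfP n; have [h1 h2 h3] := IH (half n).
have -> : (n == 2 * half n + 1) = j by case: j nj; lia.
under eq_bigr => i _.
  have -> : (n == 2 * half n + 0) = ~~ j by case: j nj; lia.
  over.
case: j nj => /= nj; first by rewrite big1// addr0; split=> //; [right|lia].
rewrite add0r; split=> // [n0|n0 nk]; first by apply: h2; lia.
by apply: h3; lia.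
Qed.

Lemma isdiag_conjU x g : isdiag x g -> isdiag (U * x * adj U) (fun n => g (n - 1)).
Proof. by move=> xg n; rewrite !bopME adjU_delta xg bop_scale U_delta subrK. Qed.

Lemma isdiag_ketbra0 : isdiag (ketbra (e 0) (e 0)) (fun n => (n == 0)%:R).
Proof.
move=> n; rewrite /= inner_delta deltaE eq_sym.
by have [->|] := eqVneq n 0; rewrite // !scale0r.
Qed.

Lemma isdiag_xseq a k : isdiag (xseq d a k) (fun n => a * (n == 0)%:R +
  partial_cocycle k n * (\sum_(i < k) odd_part_ind i n) *
    conjc (partial_cocycle k (n - 1))).
Proof.
apply: (isdiag_lin a isdiag_ketbra0).
have -> T1 T2 T3 : T1 * T2 * U * T3 * adj U = T1 * T2 * (U * T3 * adj U).
  by rewrite !mulrA.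
apply: isdiagM; first apply: isdiagM.
- exact: isdiag_dprod.
- elim: k => [|k IH].
    by rewrite big_ord0; apply: isdiag_ext (@isdiag0 R) => n; rewrite big_ord0.
  rewrite big_ord_recr; apply: isdiag_ext (isdiagD IH (isdiag_odd_part k)) => n.
  by rewrite big_ord_recr.
apply: isdiag_ext (isdiag_conjU (isdiag_prod k
  (fun j => isdiag_iter_phi (k - j.+1) (isdiag_adj df)))) => n /=.
(* The factors of the last product come in reverse order; reindexing restores it since scalars
   commute. *)
rewrite rmorph_prod /= [RHS](reindex_inj rev_ord_inj) /=.
by [].
Qed.

Lemma xseq_strong_cvg a x : isdiag x (coboundary a) -> strong_cvg (xseq d a) x.
Proof.
move=> xa; have a0 := modc_ge0 a.
apply: (strong_cvg_isdiag (M := modc a + 1) (isdiag_xseq a) xa) => [k n|n|n].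
- have [s01 s0 _] := sum_odd_part k n.
  apply: le_trans (modcD _ _) _; rewrite !modcM modc_conj; apply: lerD.
    by case: (n == 0); rewrite ?modc1 ?modc0 ?mulr1 ?mulr0.
  rewrite !(modc_unimod (partial_cocycle_unimod _ _)) mul1r mulr1.
  by case: s01 => ->; rewrite ?modc1 ?modc0.
- rewrite /coboundary; case: ifP => _; first by rewrite lerDl.
  by rewrite modcM modc_conj !(modc_unimod (cocycle_unimod _)) mulr1 lerDr.
exists (`|n| + `|n - 1|)%N => k nk; have [_ s0 s1] := sum_odd_part k n.
rewrite /coboundary; have [n0|n0] := eqVneq n 0.
  by rewrite s0// mulr0 mul0r addr0 mulr1.
rewrite s1//; last by lia.
by rewrite mulr0 add0r mulr1 !partial_cocycle_stable//; lia.
Qed.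

End UnimodularCocycle.

End CanonicalRepresentation.

(** * Extensions to Q2 *)

Section Extension.
Variable R : realType.
Local Notation C := (R[i]).
Local Notation bop := (bop R).
Local Notation e := (delta R).
Local Notation U := (U R).
Local Notation S1 := (S1 R).
Local Notation S2 := (S2 R).
Local Notation S_ := (S_ R).
Local Notation O2 := (O2 R).
Local Notation Q2 := (Q2 R).
Local Notation D2 := (D2 R).
Implicit Types (x y : bop) (g h : int -> C).

Lemma conj_isdiag_S (i : bool) x y g h : isdiag x g -> isdiag y h ->
  (forall n, g (2 * n + i%:Z) * conjc (g n) = h (2 * n + i%:Z)) ->
  x * S_ i * adj x = y * S_ i.
Proof.
move=> xg yh gh; apply: bop_ext_delta => n; rewrite !bopME (isdiag_adj xg) !bop_scale.
by rewrite !S_delta xg yh scalerA -gh mulrC.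
Qed.

Lemma conj_isdiag_U x y g h : isdiag x g -> isdiag y h ->
  (forall n, g (n + 1) * conjc (g n) = h (n + 1)) -> x * U * adj x = y * U.
Proof.
move=> xg yh gh; apply: bop_ext_delta => n; rewrite !bopME (isdiag_adj xg) !bop_scale.
by rewrite !U_delta xg yh scalerA -gh mulrC.
Qed.

Variable d : bop.
Hypotheses (d_in_D2 : D2 d) (d_unitary : unitary d).
Hypotheses (d_at_0 : diag d 0 = 1) (d_at_m1 : diag d (-1) = 1).
Let f : int -> C := diag d.

Lemma d_isdiag : isdiag d f. Proof. by have [] := D2_UCdiag d_in_D2. Qed.

Lemma f_unimod k : conjc (f k) * f k = 1.
Proof. exact: unitary_isdiag d_unitary d_isdiag. Qed.

Lemma implementing_exists (a : C) : conjc a * a = 1 ->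
  exists w x, [/\ isdiag w (twisted_cocycle f a), unitary w & isdiag x (coboundary f a)].
Proof.
move=> a1.
have tw k := twisted_cocycle_unimod f_unimod k a1.
have [w wE] : exists w, isdiag w (twisted_cocycle f a).
  by apply: (@isdiag_exists _ _ 1) => k; rewrite (modc_unimod (tw k)).
have [x xE] : exists x, isdiag x (coboundary f a).
  apply: (@isdiag_exists _ _ 1) => k; rewrite /coboundary; case: ifP => _.
    by rewrite (modc_unimod a1).
  by rewrite modcM modc_conj !(modc_unimod (cocycle_unimod f_unimod _)) mulr1.
by exists w, x; split=> //; exact: isdiag_unitary wE tw.
Qed.

Lemma conj_S_implementing i a w : conjc a * a = 1 -> isdiag w (twisted_cocycle f a) ->
  w * S_ i * adj w = d * S_ i.
Proof.
move=> a1 wE; apply: conj_isdiag_S wE d_isdiag _ => n.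
exact: twisted_cocycle_double f_unimod d_at_0 d_at_m1 _ _ _ a1.
Qed.

Lemma conj_U_implementing a w x : conjc a * a = 1 -> isdiag w (twisted_cocycle f a) ->
  isdiag x (coboundary f a) -> w * U * adj w = x * U.
Proof.
move=> a1 wE xE; apply: conj_isdiag_U wE xE _ => n.
exact: twisted_cocycle_succ.
Qed.

(** The images of [U] under the conjugation and its inverse are [x * U] and [adj x * U]; [D2 x] is
    what keeps them in Q2. *)
Lemma implementing_automorphism a w x : conjc a * a = 1 ->
  isdiag w (twisted_cocycle f a) -> unitary w -> isdiag x (coboundary f a) -> D2 x ->
  automorphism Q2 (fun y => w * y * adj w).
Proof.
move=> a1 wE wu xE Dx; have [_ _ QM Qadj _] := cstar_genP [set U; S2].
have w'E := isdiag_adj wE.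
apply: (conj_automorphism wu) => _ [->|->].
- rewrite (conj_U_implementing a1 wE xE).
  exact: (QM _ _ (@D2_Q2 R _ Dx) (@Q2_U R)).
- rewrite -[S2]/(S_ false) (conj_S_implementing false a1 wE).
  exact: (QM _ _ (@D2_Q2 R _ d_in_D2) (@Q2_S2 R)).
- rewrite -[X in _ * X]adjK (conj_isdiag_U w'E (isdiag_adj xE)).
    exact: (QM _ _ (Qadj _ (@D2_Q2 R _ Dx)) (@Q2_U R)).
  by move=> n; rewrite -(twisted_cocycle_succ d_at_m1 _ a1) rmorphM.
- rewrite -[X in _ * X]adjK -[S2]/(S_ false).
  rewrite (conj_isdiag_S (i := false) w'E (isdiag_adj d_isdiag)).
    exact: (QM _ _ (Qadj _ (@D2_Q2 R _ d_in_D2)) (@Q2_S2 R)).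
  move=> n; rewrite -(twisted_cocycle_double f_unimod d_at_0 d_at_m1 _ _ a1).
  by rewrite rmorphM.
Qed.

Variable lam : bop -> bop.
Hypothesis lamP : is_lambda d lam.

Lemma lambda_conj a w x : conjc a * a = 1 -> isdiag w (twisted_cocycle f a) ->
  unitary w -> O2 x -> lam x = w * x * adj w.
Proof.
move=> a1 wE wu; have [[hlam _] l1 l2] := lamP; move: x.
apply: (star_hom_eq (@O2_1 R) hlam (star_hom_conj O2 wu)) => _ [->|->].
  by rewrite l1 -[S1]/(S_ true) (conj_S_implementing true a1 wE).
by rewrite l2 -[S2]/(S_ false) (conj_S_implementing false a1 wE).
Qed.

Lemma one_unimod : conjc (1 : C) * 1 = 1. Proof. by rewrite conjc1 mulr1. Qed.

Lemma lambda_P_word al : lam (P_word R al) = P_word R al.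
Proof.
have [w [_ [wE wu _]]] := implementing_exists one_unimod.
rewrite (lambda_conj one_unimod wE wu (P_word_O2 al)).
have [r Pr] := P_word_class R al.
apply: isdiag_inj (isdiagM (isdiagM wE Pr) (isdiag_adj wE)) Pr _ => k.
rewrite mulrAC [_ * conjc _]mulrC.
by rewrite (twisted_cocycle_unimod f_unimod k one_unimod) mul1r.
Qed.

Variable L : bop -> bop.
Hypothesis LP : is_extension lam L.

(** Unitality follows from surjectivity: for a preimage [y] of 1, L 1 = L 1 * L y = L y = 1. *)
Lemma extension_1 : L 1 = 1.
Proof.
have [[[_ LM _] [_ _ surj]] _] := LP.
have [y Qy Ly] := surj 1 (@Q2_1 R).
transitivity (L 1 * L y); first by rewrite Ly mulr1.
by rewrite -LM ?mul1r//; exact: Q2_1.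
Qed.

Lemma extension_U_unitary : unitary (L U).
Proof.
have [[[_ LM Ladj] _] _] := LP; have [u1 u2] := unitaryU R.
have [_ _ _ Qadj _] := cstar_genP [set U; S2].
have QU' := Qadj _ (@Q2_U R).
have QU := @Q2_U R; rewrite /unitary -(Ladj _ QU).
by rewrite -(LM _ _ QU' QU) -(LM _ _ QU QU') u1 u2 extension_1.
Qed.

Lemma dcheck_U : dcheck L * U = L U.
Proof. by rewrite /dcheck -mulrA (unitaryU R).1 mulr1. Qed.

Lemma dcheck_Q2 : Q2 (dcheck L).
Proof.
have [[_ [Lfun _ _]] _] := LP.
have [_ _ QM Qadj _] := cstar_genP [set U; S2].
exact: (QM _ _ (Lfun _ (@Q2_U R)) (Qadj _ (@Q2_U R))).
Qed.

(* [L] fixes [D2] pointwise and [D2] is invariant under conjugation by [U], so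
   that [dcheck L] commutes with the diagonal. *)
Lemma dcheck_isdiag : isdiag (dcheck L) (diag (dcheck L)).
Proof.
apply: commute_P_word_isdiag => al.
have [[[_ LM _] _] Lext] := LP; have [u1 u2] := unitaryU R.
have QP be : Q2 (P_word R be) by apply: O2_Q2; exact: P_word_O2.
have LPw be : L (P_word R be) = P_word R be.
  by rewrite Lext ?lambda_P_word//; exact: P_word_O2.
(* [be] codes the class translated by -1, so that [U] intertwines [P_word be] with [P_word al]. *)
have [r Pr] := P_word_class R al; have [be Pbe] := class_P_word R (size al) (r - 1).
have E : P_word R al * U = U * P_word R be.
  apply: bop_ext_delta => k.
  rewrite (bopME (P_word R al)) (bopME U) Pbe U_delta Pr bop_scale U_delta.
  by congr (_ *: _); rewrite /ind opprB addrA.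
have E' : adj U * P_word R al = P_word R be * adj U.
  by rewrite -[X in X * adj U]mul1r -u1 -(mulrA (adj U)) -E -!mulrA u2 mulr1.
rewrite /dcheck -mulrA E' mulrA -{1}LPw -LM//; last exact: Q2_U.
rewrite -E LM//; last exact: Q2_U.
by rewrite LPw mulrA.
Qed.

Lemma dcheck_D2 : D2 (dcheck L).
Proof. exact: Q2_diag_D2 dcheck_Q2 dcheck_isdiag. Qed.

Lemma dcheck0_unimod : conjc (diag (dcheck L) 0) * diag (dcheck L) 0 = 1.
Proof.
apply: unitary_isdiag dcheck_isdiag.
by apply: unitaryM; [exact: extension_U_unitary|exact/unitary_adj/unitaryU].
Qed.

Lemma dcheck_coboundary : isdiag (dcheck L) (coboundary f (diag (dcheck L) 0)).
Proof.
apply: isdiag_ext dcheck_isdiag; set g := diag (dcheck L).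
have gP : isdiag (dcheck L) g by exact: dcheck_isdiag.
have [[[_ LM _] _] Lext] := LP; have [_ l1 l2] := lamP.
have LUe n : L U (e n) = g (n + 1) *: e (n + 1) by rewrite -dcheck_U bopME U_delta gP.
have LS2 : L S2 = d * S2 by rewrite Lext ?l2//; exact: (@O2_S R false).
have LS2e n : L S2 (e n) = f (2 * n) *: e (2 * n) by rewrite LS2 bopME S2_delta d_isdiag.
have coef (a b : C) n : a *: e n = b *: e n -> a = b.
  by move=> /(congr1 (fun u : ell2 R => u n)); rewrite !ell2ZE deltaE eqxx !mulr1.
(* Obtained by applying [L] to S1 = U S2. *)
have odd_eq n : f (2 * n + 1) = g (2 * n + 1) * f (2 * n).
  have E : L S1 = L U * L S2 by rewrite -LM//; [exact: Q2_U|exact: Q2_S2].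
  have := congr1 (fun x : bop => x (e n)) E.
  rewrite (bopME (L U)) LS2e bop_scale LUe scalerA.
  rewrite Lext ?l1; last exact: (@O2_S R true).
  rewrite bopME (@S_delta R true) d_isdiag => /coef ->.
  by rewrite mulrC.
apply: (coboundary_rec f_unimod d_at_0 d_at_m1) => // m.
have QU := @Q2_U R; have QS := @Q2_S2 R.
have [_ _ QM _ _] := cstar_genP [set U; S2].
have E : L S2 * L U = L U * (L U * L S2).
  rewrite -!LM//; last exact: (QM _ _ QU QS).
  congr (L _); apply: bop_ext_delta => n.
  by rewrite !bopME U_delta !S2_delta !U_delta; congr (e _); ring.
(* Both sides of S2 U = U^2 S2 send [e (m - 1)] to [e (2 m)]. The coefficients give g(m) f(2m) =
   g(2m) g(2m-1) f(2m-2), and [odd_eq] turns the last two factors into f(2m-1). *)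
have := congr1 (fun x : bop => x (e (m - 1))) E.
rewrite (bopME (L S2)) (bopME (L U) (L U * L S2)) (bopME (L U) (L S2)).
rewrite LUe !bop_scale !LS2e !bop_scale !LUe !bop_scale !LUe !scalerA subrK.
have -> : 2 * (m - 1) + 1 + 1 = 2 * m by ring.
move=> /coef ->; have := odd_eq (m - 1).
have -> : 2 * (m - 1) + 1 = 2 * m - 1 by ring.
by move=> ->; ring.
Qed.

Lemma extension_conj w x : isdiag w (twisted_cocycle f (diag (dcheck L) 0)) ->
  unitary w -> Q2 x -> L x = w * x * adj w.
Proof.
move=> wE wu; have [[hL _] Lext] := LP; have [_ _ l2] := lamP; move: x.
apply: (star_hom_eq (@Q2_1 R) hL (star_hom_conj Q2 wu)) => _ [->|->].
  by rewrite (conj_U_implementing dcheck0_unimod wE dcheck_coboundary) dcheck_U.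
rewrite Lext ?l2; last exact: (@O2_S R false).
by rewrite -[S2]/(S_ false) (conj_S_implementing false dcheck0_unimod wE).
Qed.

End Extension.

Theorem theorem4p6 (R : realType) (d : bop R) (d_in_D2 : D2 R d)
    (d_unitary : unitary d) (d_at_0 : diag d 0 = 1) (d_at_m1 : diag d (-1) = 1) :
  (exists d_oo : bop R, strong_cvg (dprod d) d_oo) /\
  (forall lam : bop R -> bop R, is_lambda d lam ->
   [/\ weakly_inner (O2 R) lam,
       exists pi : bop R -> bop R,
         representation (Q2 R) pi /\ extends (O2 R) lam pi,
       ((exists L : bop R -> bop R, is_extension lam L) <->
        (exists! alpha : R[i], `|alpha| = 1 /\
           exists2 x : bop R, strong_cvg (xseq d alpha) x & D2 R x)) /\
       (forall L : bop R -> bop R, is_extension lam L ->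
        forall (alpha : R[i]) (x : bop R), `|alpha| = 1 ->
          strong_cvg (xseq d alpha) x -> D2 R x ->
          x = dcheck L /\ alpha = diag (dcheck L) 0)
     & forall L : bop R -> bop R, is_extension lam L ->
       (inner_aut (O2 R) lam \/ diag (dcheck L) 0 = 1) ->
       weakly_inner (Q2 R) L]).
Proof.
have dE := d_isdiag d_in_D2; have f1 := f_unimod d_in_D2 d_unitary.
have xlim a : conjc a * a = 1 -> forall x, strong_cvg (xseq d a) x ->
    isdiag x (coboundary (diag d) a).
  move=> a1 x xx; have [_ [y [_ _ yE]]] := implementing_exists d_in_D2 d_unitary a1.
  by rewrite (strong_cvg_uniq xx (xseq_strong_cvg f1 d_at_0 d_at_m1 dE yE)).
have uc a x : isdiag x (coboundary (diag d) a) -> D2 R x -> UC (coboundary (diag d) a).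
  move=> xE /D2_UC[g xg ug].
  by have <- : g = coboundary (diag d) a by apply: funext; exact: isdiag_uniq xE.
(* Twist 1 gives the untwisted cocycle: [w] is the strong limit of [dprod d] and implements
   [lam]. *)
have [w [_ [wE wu _]]] := implementing_exists d_in_D2 d_unitary (one_unimod R).
split.
  exists w; apply: (dprod_strong_cvg f1 d_at_0 d_at_m1 dE).
  by apply: isdiag_ext wE => k; rewrite /twisted_cocycle conjc1 mul1r; case: ifP.
move=> lam lamP.
have lamE x := lambda_conj d_in_D2 d_unitary d_at_0 d_at_m1 lamP (x := x) (one_unimod R) wE wu.
have ext_uniq L : is_extension lam L -> forall alpha x, `|alpha| = 1 ->
    strong_cvg (xseq d alpha) x -> D2 R x -> x = dcheck L /\ alpha = diag (dcheck L) 0.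
  move=> LP a x /norm1P a1 xx Dx; have xE := xlim a a1 x xx.
  have cE := dcheck_coboundary d_in_D2 d_unitary d_at_0 d_at_m1 lamP LP.
  have cD := dcheck_D2 d_in_D2 d_unitary d_at_0 d_at_m1 lamP LP.
  (* Both [x] and [dcheck L] lie in D2, so both symbols are uniformly continuous coboundaries and
     their values at 0 coincide. *)
  have E := coboundary_UC_inj (uc _ _ xE Dx) (uc _ _ cE cD).
  by split=> //; apply: isdiag_inj xE cE _ => k; rewrite E.
split.
- exists w; first exact: isdiag_vonNeumann_O2 wE.
  by split=> // x Ox; exact: lamE.
- exists (fun x => w * x * adj w); split; last by move=> x Ox; rewrite lamE.
  by split; [exact: star_hom_conj|rewrite mulr1 wu.2].
- split=> //; split=> [[L LP]|[a [[/norm1P a1 [x xx Dx]] _]]].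
    exists (diag (dcheck L) 0); split=> [|b [b1 [x xx Dx]]]; last first.
      by have [_ ->] := ext_uniq L LP b x b1 xx Dx.
    have cE := dcheck_coboundary d_in_D2 d_unitary d_at_0 d_at_m1 lamP LP.
    split; first by apply/norm1P; exact: (dcheck0_unimod d_in_D2 d_unitary d_at_0 d_at_m1 lamP LP).
    exists (dcheck L); first exact: (xseq_strong_cvg f1 d_at_0 d_at_m1 dE cE).
    exact: (dcheck_D2 d_in_D2 d_unitary d_at_0 d_at_m1 lamP LP).
  have xE := xlim a a1 x xx.
  have [v [_ [vE vu _]]] := implementing_exists d_in_D2 d_unitary a1.
  exists (fun y => v * y * adj v); split.
    exact: (implementing_automorphism d_in_D2 d_unitary d_at_0 d_at_m1 a1 vE vu xE Dx).
  by move=> y Oy; rewrite (lambda_conj d_in_D2 d_unitary d_at_0 d_at_m1 lamP a1 vE vu Oy).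
(* The unitary twisted by the value of [dcheck L] at 0 implements [L], and the von Neumann algebra
   of Q2 contains every bounded operator. *)
move=> L LP _; have c1 := dcheck0_unimod d_in_D2 d_unitary d_at_0 d_at_m1 lamP LP.
have [v [_ [vE vu _]]] := implementing_exists d_in_D2 d_unitary c1.
exists v; first exact: vonNeumann_Q2.
by split=> // x Qx; exact: (extension_conj d_in_D2 d_unitary d_at_0 d_at_m1 lamP LP vE vu).
Qed.
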